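(* Let $k$ be a finite field of characteristic $2$, let $d$ be a positive odd integer, and let $\{X_n\}_{n\ge 0}$ be a basic $\mathbf{Z}_2$-tower over $k$ with ramification invariant $d$. For each $n$ let $$a_n := \dim_k \ker\left( V : H^0(X_n,\Omega^1_{X_n/k}) \to H^0(X_n,\Omega^1_{X_n/k})\right)$$ be the $a$-number of $X_n$, where $V$ is the Cartier operator. Then for every integer $n>1$, $$a_n = \frac{d}{24}\cdot 2^{2n} + \frac{d + (-1)^{(d-1)/2}\cdot 3}{12} = \frac{d}{4}\cdot\frac{2^{2n-1}+1}{3} + \frac{(-1)^{(d-1)/2}}{4}.$$
   Context: A curve over a perfect field $k$ is a smooth, projective, geometrically connected $k$-scheme of dimension one. The Cartier operator on a curve $X$ over a perfect field of characteristic $p$ is the usual additive, $p^{-1}$-linear operator $V$ on differentials, preserving $H^0(X,\Omega^1_{X/k})$. Basic $\mathbf{Z}_p$-tower: let $k$ be a finite field of characteristic $p$ and $d$ a positive integer prime to $p$. A basic $\mathbf{Z}_p$-tower with ramification invariant $d$ is the tower of curves $\cdots\to X_2\to X_1\to X_0=\mathbf{P}^1_k$ (with $\mathbf{P}^1_k$ having function field $k(x)$) given by the Artin--Schreier--Witt equation $$Fy-y=\sum_{1\le i\le d,\ \gcd(i,p)=1}[c_i x^i],\qquad c_i\in k,\ c_d\neq 0,$$ in the $p$-typical Witt vectors $W(k(x))$. Here $F$ is the Witt vector Frobenius and $[\cdot]:k(x)\to W(k(x))$ is the Teichmüller map. Concretely, $X_n$ is the curve whose function field is the $\mathbf{Z}/p^n\mathbf{Z}$-extension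 of $k(x)$ obtained by adjoining the components $y_1,\dots,y_n$ of a solution $(y_1,\dots,y_n)\in W_n$ of the truncation of this equation to length-$n$ Witt vectors. *)

(* Defs.v *)
From HB Require Import structures.
From mathcomp Require Import all_boot all_order all_algebra all_field.
From mathcomp Require Import mpoly.

Set Implicit Arguments.
Unset Strict Implicit.
Unset Printing Implicit Defensive.

Import GRing.Theory.
Local Open Scope ring_scope.

Section WittPolynomials.
Variables (p n : nat).

Definition ghost (R : comNzRingType) (x : 'I_n -> R) (m : nat) : R :=
  \sum_(i < n | (i <= m)%N) (p ^ i)%:R * x i ^+ (p ^ (m - i)).

(* [op] is + or - on the polynomial ring, whose variables are
   X_i = 'X_(lshift n i) and Y_i = 'X_(rshift n i).  [witt_polys op m] lists
   the polynomials S_0, ..., S_{m-1} (m <= n) determined by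
     \sum_(i <= j) p^i S_i^(p^(j-i)) = op (ghost X j) (ghost Y j),  j < m. *)
Variable op : {mpoly rat[n + n]} -> {mpoly rat[n + n]} -> {mpoly rat[n + n]}.

Fixpoint witt_polys (m : nat) : seq {mpoly rat[n + n]} :=
  if m is j.+1 then
    let S := witt_polys j in
    let wX := ghost (fun i : 'I_n => 'X_(lshift n i) : {mpoly rat[n + n]}) j in
    let wY := ghost (fun i : 'I_n => 'X_(rshift n i) : {mpoly rat[n + n]}) j in
    rcons S ((p%:R ^- j) *:
      (op wX wY - \sum_(i < j) (p ^ i)%:R * S`_i ^+ (p ^ (j - i))))
  else [::].

(* By Witt's theorem the S_i have integral coefficients when p is prime, so
   that taking numerators merely reads these coefficients in R. *)
Definition witt_op (R : comNzRingType) (x y : {ffun 'I_n -> R}) :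
    {ffun 'I_n -> R} :=
  [ffun i : 'I_n =>
     mmap (fun q : rat => (numq q)%:~R)
          (fun j : 'I_(n + n) =>
             match split j with inl a => x a | inr b => y b end)
          (witt_polys n)`_i].

End WittPolynomials.

Section WittVectors.
Variables (p n : nat) (R : comNzRingType).
Implicit Types x y : {ffun 'I_n -> R}.

Definition witt_add x y := witt_op p +%R x y.
Definition witt_sub x y := witt_op p (fun a b => a - b) x y.
Definition witt0 : {ffun 'I_n -> R} := [ffun=> 0].
Definition teichmuller (a : R) : {ffun 'I_n -> R} :=
  [ffun i : 'I_n => if i == 0 :> nat then a else 0].
(* For R of characteristic p, the Witt vector Frobenius is componentwise. *)
Definition witt_frobenius x : {ffun 'I_n -> R} := [ffun i => x i ^+ p].

End WittVectors.

Definition of_poly (k : fieldType) (L : fieldExtType {fraction {poly k}}) :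
  {rmorphism {poly k} -> L} := in_alg L \o @tofrac {poly k}.

Definition of_const (k : fieldType) (L : fieldExtType {fraction {poly k}}) :
  {rmorphism k -> L} := of_poly L \o polyC.

(* [layer n] is the function field of X_n, and [sol n] is the truncation to
   length n of a solution y of the Artin-Schreier-Witt equation; the component
   y_{i+1} is [sol n i]. *)
Record basic_tower (p : nat) (k : fieldType) (d : nat) := BasicTower {
  tower_coef : nat -> k;
  layer :> nat -> fieldExtType {fraction {poly k}};
  sol : forall n, {ffun 'I_n -> layer n};
  incl : forall n, 'AHom(layer n, layer n.+1);
  tower_coef_neq0 : tower_coef d != 0;
  sol_eq : forall n,
    witt_sub p (witt_frobenius p (sol n)) (sol n) =
    \big[witt_add p (n:=n) (R:=layer n) / witt0 n (layer n)]_(1 <= i < d.+1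
        | coprime i p) teichmuller n (of_poly (layer n) (tower_coef i *: 'X^i));
  sol_gen : forall n, <<1 & codom (sol n)>>%VS = fullv :> {vspace layer n};
  incl_sol : forall n (i : 'I_n),
    incl n (sol n i) = sol n.+1 (widen_ord (leqnSn n) i)
}.

(* A curve over k is represented by its function field L; iota : k -> L is the
   inclusion of the constants. *)

Section Differentials.
Variables (k L : fieldType) (iota : {rmorphism k -> L}).

Definition is_derivation (M : lmodType L) (D : L -> M) : Prop :=
  [/\ {morph D : f g / f + g},
      forall f g, D (f * g) = f *: D g + g *: D f
    & forall c : k, D (iota c) = 0].

Definition is_kaehler (Omega : lmodType L) (D : L -> Omega) : Prop :=
  is_derivation D /\
  forall (M : lmodType L) (E : L -> M), is_derivation E ->
    exists phi : {linear Omega -> M},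
      (forall f, phi (D f) = E f) /\
      (forall psi : {linear Omega -> M},
         (forall f, psi (D f) = E f) -> psi =1 phi).

(* The local rings at the closed points of a smooth projective curve are the
   valuation rings k <= O < L of its function field. *)
Definition is_place (O : {pred L}) : Prop :=
  [/\ subring_closed O,
      forall c : k, iota c \in O,
      forall f : L, f \in O \/ f^-1 \in O
    & exists f : L, f \notin O].

Variables (Omega : lmodType L) (D : L -> Omega).

(* w belongs to the stalk of the sheaf of differentials at O, i.e. to the
   O-submodule of Omega generated by D O. *)
Definition regular_at (O : {pred L}) (w : Omega) : Prop :=
  exists m (f g : 'I_m -> L),
    (forall i, f i \in O /\ g i \in O) /\ w = \sum_(i < m) f i *: D (g i).

Definition global_differential (w : Omega) : Prop :=
  forall O : {pred L}, is_place O -> regular_at O w.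

(* For k perfect and L a function field in one variable over k, these
   properties characterize the Cartier operator. *)
Definition is_cartier (p : nat) (V : Omega -> Omega) : Prop :=
  [/\ {morph V : v w / v + w},
      forall f w, V (f ^+ p *: w) = f *: V w,
      forall f, V (D f) = 0
    & forall f, V (f ^+ p.-1 *: D f) = D f].

Definition is_basis (S : Omega -> Prop) (a : nat) (e : 'I_a -> Omega) : Prop :=
  (forall w, S w <-> exists c : 'I_a -> k, w = \sum_i iota (c i) *: e i) /\
  (forall c : 'I_a -> k, \sum_i iota (c i) *: e i = 0 -> forall i, c i = 0).

Definition has_dim (S : Omega -> Prop) (a : nat) : Prop :=
  exists e : 'I_a -> Omega, is_basis S e.

Definition is_a_number (V : Omega -> Omega) (a : nat) : Prop :=
  has_dim (fun w => global_differential w /\ V w = 0) a.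

End Differentials.

(* Main.v *)
From HB Require Import structures.
Require Import Defs.
From mathcomp Require Import all_boot all_order all_algebra all_field.
From mathcomp Require Import generic_quotient mpoly zify ring.
From mathcomp Require classical_sets.
From Stdlib Require Import Classical ClassicalEpsilon FunctionalExtensionality.

(* In characteristic 2 the field L of X_n is L^2 + x L^2, the kernel of the
   Cartier operator consists of the forms a^2 dx, and a^2 dx is regular exactly
   when a is regular outside infinity and has order at most g - 1 there: indeed
   X_n is etale over the affine line, so dx has the only zeros and poles at the
   unique place at infinity.  Hence a_n = dim L((g - 1) oo).

   The affine ring R_n is built by successive quadratic extensions
   R_(j+1) = R_j + R_j y with y^2 + y in R_j of odd pole order.  Pole orders of
   a + b y never cancel, so dim L(t oo) satisfies N_(j+1)(t) = N_j(t) + N_j(t - r)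
   with r the order of y, and above a bound N_j is a floor function plus a
   constant.  The bound g_n - 1 is smaller than r_n and large for X_(n-1), which
   gives the formula.

   The pole orders come from the Artin-Schreier-Witt equation Fy - y = f.  If
   z^2 + z = g has odd order, every a = al^2 + g be^2 below z is the square of
   b = al + be z up to be^2 z, whose order is smaller by that of z.  Replacing f
   by f - sum V^m([a] - [b^2] + [b]) thus kills its next component and lowers
   the order of the others by exactly that of z. *)

Set Implicit Arguments.
Unset Strict Implicit.
Unset Printing Implicit Defensive.

Import Order.TTheory GRing.Theory Num.Theory.
Local Open Scope ring_scope.

(** * Witt vectors *)

(** In characteristic 2 the ghost components lose information, so identities and order estimates for
    Witt vectors are proved for independent variables over the integers, where pole orders become
    weights of monomials and division by 2^m is harmless, and are then evaluated. To first order in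
    eta, V^s([eta + beta] - [beta]) has m-th component eta beta^(2^(m-s) - 1); hence all later
    components drop by the same amount.

    Two generators occur at each level. The component z of the modified vector has the wanted odd
    order, but z^2 + z may have finite poles; the component of the given solution satisfies an
    equation over the affine ring, but its order is not controlled. They differ by an element of the
    lower field, which the vanishing of H^1 in degree 2g - 1 replaces by an element of the affine
    ring, up to an error of order below that of z.

    That dx generates the differentials away from infinity needs enough places: localizations of R
    at maximal ideals are valuation rings because R/pR is reduced for irreducible p, which follows
    again from the decomposition into squares and x times squares.

    Orders are counted on X_n, where x has order 2^n. *)

Section FrobeniusLift.
Variables (N : nat).
Local Notation P := {mpoly int[N]}.

(** The lift to Z[X] of the Frobenius of F_2[X], as required by Dwork's lemma. *)
Definition frob : P -> P := mmap (fun z : int => z%:~R) (fun i => 'X_i ^+ 2).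
HB.instance Definition _ := GRing.RMorphism.copy frob
  (mmap (intr : int -> P) (fun i : 'I_N => 'X_i ^+ 2)).

Lemma frobX i : frob 'X_i = 'X_i ^+ 2.
Proof. by rewrite /frob mmapX mmap1U. Qed.

Lemma frob_mod2 (p : P) : exists q, frob p = p ^+ 2 + q *+ 2.
Proof.
elim/mpolyind: p => [|c m p _ _ [q e]] /=.
  by exists 0; rewrite rmorph0 expr0n /= mul0rn addr0.
have [q1 e1] : exists q1, frob (c *: 'X_[m]) = (c *: 'X_[m]) ^+ 2 + q1 *+ 2.
  (* c^2 - c is even, so the coefficient agrees with its own square modulo 2. *)
  have [z ez] : exists z : int, c = c ^+ 2 + z *+ 2.
    exists (- (c * (c - 1) %/ 2)%Z).
    suff : (2 %| c * (c - 1))%Z by move/divzK => /= ?; lia.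
    by have [k [->|->]] : exists k : int, c = k *+ 2 \/ c = k *+ 2 + 1;
      [exists (c %/ 2)%Z; lia | apply/dvdzP; exists (k * (k *+ 2 - 1)); ring
      | apply/dvdzP; exists (k * (k *+ 2 + 1)); ring].
  exists (z *: 'X_[m] ^+ 2).
  rewrite /frob mmapZ mmapX /mmap1.
  have -> : \prod_(i < N) ('X_i ^+ 2) ^+ m i = 'X_[m] ^+ 2 :> P.
    rewrite [in RHS]mpolyXE_id -prodrXl; apply: eq_bigr => i _.
    by rewrite -!exprM mulnC.
  rewrite exprZn scalerMnl -scalerDl -ez.
  by rewrite -[in RHS](intz c) scaler_int mulrzl.
rewrite raddfD /= e1 e; move: (c *: _) => a.
exists (q1 + q - a * p); ring.
Qed.

Lemma frob_expn (p : P) i :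
  exists q, frob p ^+ (2 ^ i) = p ^+ (2 ^ i.+1) + q *+ (2 ^ i.+1).
Proof.
elim: i => [|i [q e]]; first exact: frob_mod2.
rewrite expnSr exprM e; exists (p ^+ (2 ^ i.+1) * q + q ^+ 2 *+ 2 ^ i).
rewrite (expnSr 2 i.+1) (exprM p); move: (p ^+ _) => a.
rewrite !expnS; move: (2 ^ i)%N => m.
ring.
Qed.

Lemma mpoly_mulrnI m (p q : P) : (0 < m)%N -> p *+ m = q *+ m -> p = q.
Proof.
move=> m0 e; apply/mpolyP => j; have := congr1 (fun r => r@_j) e.
by rewrite !mcoeffMn => /eqP; rewrite eqr_pMn2r // => /eqP.
Qed.

(** By [frob_expn] the components found so far account for [frob (w m)] modulo 2^(m+1), hence also
    for [w m.+1]; the quotient of the remainder by 2^(m+1) is the next component. *)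
Lemma dwork (w : nat -> P) :
    (forall m, exists q, w m.+1 = frob (w m) + q *+ (2 ^ m.+1)) ->
  exists x : nat -> P,
    forall m, w m = \sum_(i < m.+1) x i ^+ (2 ^ (m - i)) *+ (2 ^ i).
Proof.
move=> hw.
suff H m : exists s : seq P, size s = m.+1 /\ forall j, (j <= m)%N ->
    w j = \sum_(i < j.+1) s`_i ^+ (2 ^ (j - i)) *+ (2 ^ i).
  pose S m := proj1_sig (constructive_indefinite_description _ (H m)).
  have SP m : size (S m) = m.+1 /\ forall j, (j <= m)%N ->
      w j = \sum_(i < j.+1) (S m)`_i ^+ (2 ^ (j - i)) *+ (2 ^ i).
    exact: proj2_sig (constructive_indefinite_description _ (H m)).
  (* Lists of different lengths agree where both are defined, because over a torsion-free ring ghost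
     components determine components; they therefore glue to one sequence. *)
  have St m : forall i j, (i <= j)%N -> (j <= m)%N -> (S m)`_i = (S j)`_i.
    elim/ltn_ind => i IH j ij jm.
    have e1 := (SP m).2 i (leq_trans ij jm); have e2 := (SP j).2 i ij.
    have := etrans (esym e1) e2; rewrite !big_ord_recr /=.
    rewrite (eq_bigr (fun l : 'I_i => (S j)`_l ^+ (2 ^ (i - l)) *+ (2 ^ l))).
      by move/addrI; rewrite !subnn !expr1; apply: mpoly_mulrnI; rewrite expn_gt0.
    by move=> l _; rewrite (IH l (ltn_ord l) j) // (leq_trans (ltnW (ltn_ord l))).
  exists (fun i => (S i)`_i) => m; rewrite ((SP m).2 m) //.
  by apply: eq_bigr => i _; rewrite (St m i i) // -ltnS.
elim: m => [|m [s [ss hs]]].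
  exists [:: w 0%N]; split=> // j; rewrite leqn0 => /eqP ->.
  by rewrite big_ord1.
have [q hq] := hw m.
have [q' hq'] : exists q', frob (w m) =
    \sum_(i < m.+1) s`_i ^+ (2 ^ (m.+1 - i)) *+ (2 ^ i) + q' *+ (2 ^ m.+1).
  rewrite (hs m) // raddf_sum /=.
  have := fun i : 'I_m.+1 => frob_expn s`_i (m - i).
  move/(_ _)/constructive_indefinite_description.
  move=> /= h; pose Q i := proj1_sig (h i).
  exists (\sum_i Q i); rewrite -sumrMnl -big_split /=; apply: eq_bigr => i _.
  rewrite raddfMn /= rmorphXn /= (proj2_sig (h i)) -/(Q i) mulrnDl -mulrnA.
  have lim : (i <= m)%N by rewrite -ltnS.
  by rewrite -expnD subSn // addSn subnK.
exists (rcons s (q + q')); split; first by rewrite size_rcons ss.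
move=> j; rewrite leq_eqVlt => /orP[/eqP->|]; last first.
  rewrite ltnS => jm; rewrite (hs j jm); apply: eq_bigr => i _.
  by rewrite nth_rcons ss (leq_trans (ltn_ord i)).
rewrite big_ord_recr /= nth_rcons ss ltnn eqxx subnn expr1.
rewrite hq hq' mulrnDl [_ *+ _ + _]addrC addrA; congr (_ + _ + _).
by apply: eq_bigr => i _; rewrite nth_rcons ss ltn_ord.
Qed.
End FrobeniusLift.

(** * Integrality of the Witt polynomials for addition and subtraction *)

Section IntegralWittPolynomials.
Variable n : nat.
Variable op : forall R : comNzRingType, R -> R -> R.
Hypothesis op_morph : forall (R S : comNzRingType) (f : {rmorphism R -> S}) a b,
  f (op a b) = op (f a) (f b).
Hypothesis op_mod : forall (R : comNzRingType) (a b c d : R) m,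
  op (a + c *+ m) (b + d *+ m) = op a b + op c d *+ m.

Local Notation P := {mpoly int[n + n]}.

Lemma ghost_morph (R S : comNzRingType) (f : {rmorphism R -> S})
    (x : 'I_n -> R) m :
  f (ghost 2 x m) = ghost 2 (fun i => f (x i)) m.
Proof.
rewrite /ghost rmorph_sum /=; apply: eq_bigr => i _.
by rewrite rmorphM rmorphXn rmorph_nat.
Qed.

Lemma ghost_frob (v : 'I_n -> 'I_(n + n)) m :
  exists q, ghost 2 (fun i => 'X_(v i) : P) m.+1 =
    frob (ghost 2 (fun i => 'X_(v i) : P) m) + q *+ (2 ^ m.+1).
Proof.
(* The new variable of index m + 1, or 0 when that index is out of range; all other terms match
   under [frob]. *)
exists (\sum_(i < n | i == m.+1 :> nat) 'X_(v i)).
rewrite ghost_morph /ghost -sumrMnl big_mkcond.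
rewrite [X in X + _]big_mkcond [X in _ + X]big_mkcond -big_split /=.
apply: eq_bigr => i _; rewrite frobX -exprM -expnS.
have [im|im|im] := ltngtP (val i) m.+1.
- by rewrite -ltnS im addr0 subSn.
- by rewrite leqNgt (ltnW im) addr0.
- by rewrite im ltnn subnn add0r expr1 mulr_natl.
Qed.

Lemma op_witt_int : exists s : nat -> P, forall m,
  op (ghost 2 (fun i => 'X_(lshift n i)) m) (ghost 2 (fun i => 'X_(rshift n i)) m)
  = \sum_(i < m.+1) s i ^+ (2 ^ (m - i)) *+ (2 ^ i).
Proof.
apply: dwork => m.
have [q ->] := ghost_frob (fun i => lshift n i) m.
have [q' ->] := ghost_frob (fun i => rshift n i) m.
by exists (op q q'); rewrite op_mod op_morph.
Qed.

Definition int_witt : nat -> P :=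
  proj1_sig (constructive_indefinite_description _ op_witt_int).

Lemma int_wittP m :
  op (ghost 2 (fun i => 'X_(lshift n i)) m) (ghost 2 (fun i => 'X_(rshift n i)) m)
  = \sum_(i < m.+1) int_witt i ^+ (2 ^ (m - i)) *+ (2 ^ i).
Proof. exact: (proj2_sig (constructive_indefinite_description _ op_witt_int)). Qed.

Lemma int_witt_morph (R : comNzRingType) (f : {rmorphism P -> R}) m :
  op (ghost 2 (fun i => f 'X_(lshift n i)) m) (ghost 2 (fun i => f 'X_(rshift n i)) m)
  = \sum_(i < m.+1) f (int_witt i) ^+ (2 ^ (m - i)) *+ (2 ^ i).
Proof.
rewrite -(ghost_morph f) -(ghost_morph f) -(op_morph f) int_wittP rmorph_sum.
by apply: eq_bigr => i _; rewrite rmorphMn rmorphXn.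
Qed.

Lemma ghost_ext (R : comNzRingType) (x y : 'I_n -> R) m :
  x =1 y -> ghost 2 x m = ghost 2 y m.
Proof. by move=> e; apply: eq_bigr => i _; rewrite e. Qed.

(** Both sequences solve the same ghost recursion, in which the last term can be divided by 2^m over
    Q. *)
Lemma witt_polys_int m i : (i < m)%N ->
  (witt_polys 2 (@op {mpoly rat[n + n]}) m)`_i
  = map_mpoly (intr : int -> rat) (int_witt i).
Proof.
have sz j : size (witt_polys 2 (@op {mpoly rat[n + n]}) j) = j.
  by elim: j => //= j IH; rewrite size_rcons IH.
elim: m i => // m IH i; rewrite ltnS /= nth_rcons sz.
case: (ltngtP i m) => [im _|//|-> _]; first exact: IH.
have : op (ghost 2 (fun i => 'X_(lshift n i)) m) (ghost 2 (fun i => 'X_(rshift n i)) m)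
    = \sum_(i < m.+1) map_mpoly (intr : int -> rat) (int_witt i) ^+ (2 ^ (m - i)) *+ (2 ^ i).
  apply: etrans (int_witt_morph (map_mpoly (intr : int -> rat)) m).
  have h (v : 'I_n -> 'I_(n + n)) : (fun i => 'X_(v i) : {mpoly rat[n + n]})
      =1 (fun i => map_mpoly (intr : int -> rat) 'X_(v i)).
    by move=> l; rewrite map_mpolyX.
  exact: congr2 (ghost_ext m (h _)) (ghost_ext m (h _)).
rewrite big_ord_recr /= subnn expr1 => e.
rewrite {}e [X in _ - X](eq_bigr (fun j : 'I_m => map_mpoly (intr : int -> rat) (int_witt j) ^+ (2 ^ (m - j)) *+ (2 ^ j))).
  rewrite [X in X - _]addrC addrK -[map_mpoly _ _ *+ _]scaler_nat scalerA natrX.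
  by rewrite mulVf ?scale1r // expf_neq0.
by move=> j _; rewrite IH // mulr_natl.
Qed.

Definition wvals (R : comNzRingType) (x y : {ffun 'I_n -> R}) (j : 'I_(n + n)) : R :=
  match split j with inl a => x a | inr b => y b end.

Lemma witt_opE (R : comNzRingType) (x y : {ffun 'I_n -> R}) i :
  witt_op 2 (@op {mpoly rat[n + n]}) x y i
  = mmap (intr : int -> R) (wvals x y) (int_witt i).
Proof.
rewrite /witt_op ffunE witt_polys_int //.
set q := int_witt i; rewrite /mmap -/(wvals x y).
(* Z embeds in Q, so the support does not change, and the numerator of an integer is that
   integer. *)
have ep : perm_eq (msupp (map_mpoly (intr : int -> rat) q)) (msupp q).
  apply: uniq_perm; rewrite ?msupp_uniq // => m.
  by rewrite !mcoeff_msupp mcoeff_map_mpoly /= intr_eq0.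
rewrite (perm_big _ ep) /=; apply: eq_bigr => m _.
by rewrite mcoeff_map_mpoly /= numq_int.
Qed.

Lemma witt_op_ghost (R : comNzRingType) (x y : {ffun 'I_n -> R}) m : (m < n)%N ->
  ghost 2 (witt_op 2 (@op {mpoly rat[n + n]}) x y) m
  = op (ghost 2 x m) (ghost 2 y m).
Proof.
move=> mn.
have -> : op (ghost 2 x m) (ghost 2 y m) = \sum_(i < m.+1)
    mmap (intr : int -> R) (wvals x y) (int_witt i) ^+ (2 ^ (m - i)) *+ (2 ^ i).
  apply: etrans (int_witt_morph (mmap (intr : int -> R) (wvals x y)) m).
  have hx : x =1 (fun i => mmap (intr : int -> R) (wvals x y) 'X_(lshift n i)).
    move=> j; rewrite mmapX mmap1U /wvals; case: splitP => k /= e.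
      by congr (x _); apply: ord_inj.
    by have := ltn_ord j; lia.
  have hy : y =1 (fun i => mmap (intr : int -> R) (wvals x y) 'X_(rshift n i)).
    move=> j; rewrite mmapX mmap1U /wvals; case: splitP => k /= e.
      by have := ltn_ord k; lia.
    by congr (y _); apply: ord_inj; lia.
  exact: congr2 (ghost_ext m hx) (ghost_ext m hy).
rewrite /ghost (big_ord_widen n
  (fun i => mmap intr (wvals x y) (int_witt i) ^+ (2 ^ (m - i)) *+ (2 ^ i))) //.
apply: eq_big => [j|j _]; first by rewrite ltnS.
by rewrite witt_opE mulr_natl.
Qed.

Lemma witt_op_morph (R S : comNzRingType) (f : {rmorphism R -> S})
    (x y : {ffun 'I_n -> R}) i :
  f (witt_op 2 (@op {mpoly rat[n + n]}) x y i)
  = witt_op 2 (@op {mpoly rat[n + n]}) [ffun i => f (x i)] [ffun i => f (y i)] i.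
Proof.
rewrite !witt_opE /mmap rmorph_sum /=; apply: eq_bigr => m _.
rewrite rmorphM rmorph_int; congr (_ * _).
rewrite /mmap1 rmorph_prod; apply: eq_bigr => j _.
by rewrite rmorphXn /wvals; case: (split j) => a; rewrite ffunE.
Qed.

(** Integral coefficients keep Witt operations inside any subring [S]; below, [S] is an affine ring
    or the field of a layer. *)
Lemma witt_op_closed (R : comNzRingType) (S : R -> Prop) (x y : {ffun 'I_n -> R}) :
    S 1 -> (forall a b, S a -> S b -> S (a - b)) ->
    (forall a b, S a -> S b -> S (a * b)) ->
    (forall i, S (x i)) -> (forall i, S (y i)) ->
  forall i, S (witt_op 2 (@op {mpoly rat[n + n]}) x y i).
Proof.
move=> S1 SB SM Sx Sy i; rewrite witt_opE.
have S0 : S 0 by rewrite -(subrr 1); exact: SB.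
have SN a : S a -> S (- a) by rewrite -sub0r; exact: SB.
have SD a b : S a -> S b -> S (a + b) by move=> Sa Sb; rewrite -[b]opprK; apply/SB/SN.
have Sn k : S k%:R by elim: k => // k IH; rewrite -[k.+1]addn1 natrD; apply: SD.
have Sz (z : int) : S z%:~R.
  by case: z => k; rewrite ?NegzE ?mulrNz; [exact: Sn | exact/SN/Sn].
apply: (big_ind S) => // m _; apply: (SM) => //.
have Sexp a l : S a -> S (a ^+ l).
  by move=> Sa; elim: l => // l IH; rewrite exprS; exact: SM.
rewrite /mmap1; apply: (big_ind S) => // j _; apply: Sexp.
by rewrite /wvals; case: (split j).
Qed.
End IntegralWittPolynomials.

(* an alias of {ffun 'I_n -> R}, to carry Witt rather than pointwise addition *)
Definition wv (n : nat) (R : comNzRingType) : Type := {ffun 'I_n -> R}.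
HB.instance Definition _ n R := Choice.copy (wv n R) {ffun 'I_n -> R}.

(** * The additive group of truncated Witt vectors and its Verschiebung filtration *)

Section WittGroup.
Variable n : nat.

Definition wcomp (R : comNzRingType) (x : wv n R) (i : 'I_n) : R :=
  (x : {ffun 'I_n -> R}) i.

Lemma wvP (R : comNzRingType) (x y : wv n R) : wcomp x =1 wcomp y -> x = y.
Proof. by move=> e; apply/ffunP. Qed.

Definition wmap (R S : comNzRingType) (f : R -> S) (x : wv n R) : wv n S :=
  [ffun i => f (wcomp x i)].

Lemma wmapE (R S : comNzRingType) (f : R -> S) x i :
  wcomp (wmap f x) i = f (wcomp x i).
Proof. by rewrite /wcomp ffunE. Qed.

Definition torsionfree (R : comNzRingType) :=
  forall m (p q : R), (0 < m)%N -> p *+ m = q *+ m -> p = q.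

(** One free variable over Z per component: a generic family specializes to any given one. *)
Lemma wv_lift (I : finType) (R : comNzRingType) (x : I -> wv n R) :
  exists (P : comNzRingType) (f : {rmorphism P -> R}) (X : I -> wv n P),
    torsionfree P /\ forall i, x i = wmap f (X i).
Proof.
pose J : finType := (I * 'I_n)%type.
exists {mpoly int[#|J|]}, (mmap (intr : int -> R) (fun v => wcomp (x (enum_val v).1) (enum_val v).2)).
exists (fun i => [ffun j => 'X_(enum_rank (i, j))]); split=> [m p q|i].
  exact: mpoly_mulrnI.
apply: wvP => j; rewrite wmapE /wcomp ffunE /= mmapX mmap1U.
by rewrite enum_rankK.
Qed.

Lemma ghost_split (R : comNzRingType) (x : 'I_n -> R) (m : 'I_n) :
  ghost 2 x m =
    x m *+ 2 ^ m + \sum_(i < n | (i < m)%N) (2 ^ i)%:R * x i ^+ (2 ^ (m - i)).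
Proof.
rewrite /ghost (bigD1 m) //= subnn expr1 mulr_natl; congr (_ + _).
by apply: eq_bigl => i; rewrite -val_eqE ltn_neqAle andbC.
Qed.

Lemma ghost_inj_upto (R : comNzRingType) (tf : torsionfree R) (x y : wv n R) j :
    (forall m : 'I_n, (m <= j)%N -> ghost 2 (wcomp x) m = ghost 2 (wcomp y) m) ->
  forall m : 'I_n, (m <= j)%N -> wcomp x m = wcomp y m.
Proof.
move=> e [m mn]; elim/ltn_ind: m mn => m IH mn mj.
have := e (Ordinal mn) mj; rewrite !ghost_split.
have -> : \sum_(i < n | (i < Ordinal mn)%N) (2 ^ i)%:R * wcomp x i ^+ (2 ^ (Ordinal mn - i)) =
    \sum_(i < n | (i < Ordinal mn)%N) (2 ^ i)%:R * wcomp y i ^+ (2 ^ (Ordinal mn - i)).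
  apply: eq_bigr => -[i i_n] im.
  by rewrite (IH i im i_n (leq_trans (ltnW im) mj)).
by move/addIr; apply: tf; rewrite expn_gt0.
Qed.

Lemma ghost_inj (R : comNzRingType) (tf : torsionfree R) (x y : wv n R) :
  (forall m : 'I_n, ghost 2 (wcomp x) m = ghost 2 (wcomp y) m) -> x = y.
Proof.
by move=> e; apply: wvP => m; apply: (@ghost_inj_upto _ tf _ _ m) => // i _.
Qed.

(* identities are checked on ghost components after lifting to a torsion-free ring *)
Lemma wv_transfer (I : finType) (t1 t2 : forall R : comNzRingType, (I -> wv n R) -> wv n R) :
    (forall (R S : comNzRingType) (f : {rmorphism R -> S}) X,
      t1 S (fun i => wmap f (X i)) = wmap f (t1 R X)) ->
    (forall (R S : comNzRingType) (f : {rmorphism R -> S}) X,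
      t2 S (fun i => wmap f (X i)) = wmap f (t2 R X)) ->
    (forall (R : comNzRingType) X (m : 'I_n),
      ghost 2 (wcomp (t1 R X)) m = ghost 2 (wcomp (t2 R X)) m) ->
  forall R x, t1 R x = t2 R x.
Proof.
move=> n1 n2 e R x; have [P [f [X [tf eX]]]] := wv_lift x.
have -> : x = (fun i => wmap f (X i)) by apply: functional_extensionality.
by rewrite n1 n2 (ghost_inj tf (e P X)).
Qed.

Definition addop (R : comNzRingType) (a b : R) := a + b.
Definition subop (R : comNzRingType) (a b : R) := a - b.

Lemma addop_morph (R S : comNzRingType) (f : {rmorphism R -> S}) a b :
  f (addop a b) = addop (f a) (f b).
Proof. exact: rmorphD. Qed.
Lemma subop_morph (R S : comNzRingType) (f : {rmorphism R -> S}) a b :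
  f (subop a b) = subop (f a) (f b).
Proof. exact: rmorphB. Qed.
Lemma addop_mod (R : comNzRingType) (a b c d : R) m :
  addop (a + c *+ m) (b + d *+ m) = addop a b + addop c d *+ m.
Proof. by rewrite /addop mulrnDl addrACA. Qed.
Lemma subop_mod (R : comNzRingType) (a b c d : R) m :
  subop (a + c *+ m) (b + d *+ m) = subop a b + subop c d *+ m.
Proof. by rewrite /subop mulrnBl opprD addrACA. Qed.

Section Ops.
Variable R : comNzRingType.
Implicit Types x y z : wv n R.
Definition wadd x y : wv n R := witt_add 2 x y.
Definition wsub x y : wv n R := witt_sub 2 x y.
Definition wzero : wv n R := witt0 n R.

Lemma ghost_wadd x y (m : 'I_n) :
  ghost 2 (wcomp (wadd x y)) m = ghost 2 (wcomp x) m + ghost 2 (wcomp y) m.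
Proof. exact: (witt_op_ghost addop_morph addop_mod x y (ltn_ord m)). Qed.
Lemma ghost_wsub x y (m : 'I_n) :
  ghost 2 (wcomp (wsub x y)) m = ghost 2 (wcomp x) m - ghost 2 (wcomp y) m.
Proof. exact: (witt_op_ghost subop_morph subop_mod x y (ltn_ord m)). Qed.
Lemma ghost_wzero m : ghost 2 (wcomp wzero) m = 0.
Proof.
by rewrite /ghost big1 // => i _; rewrite /wcomp ffunE expr0n expn_eq0 mulr0.
Qed.
End Ops.

Lemma wmap_add (R S : comNzRingType) (f : {rmorphism R -> S}) x y :
  wadd (wmap f x) (wmap f y) = wmap f (wadd x y).
Proof.
apply: wvP => i; rewrite wmapE.
exact: esym (witt_op_morph addop_morph addop_mod f x y i).
Qed.
Lemma wmap_sub (R S : comNzRingType) (f : {rmorphism R -> S}) x y :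
  wsub (wmap f x) (wmap f y) = wmap f (wsub x y).
Proof.
apply: wvP => i; rewrite wmapE.
exact: esym (witt_op_morph subop_morph subop_mod f x y i).
Qed.
Lemma wmap_zero (R S : comNzRingType) (f : {rmorphism R -> S}) :
  wzero S = wmap f (wzero R).
Proof. by apply: wvP => i; rewrite wmapE /wcomp !ffunE rmorph0. Qed.

Definition pick3 (T : Type) (a b c : T) (i : 'I_3) : T :=
  if i == 0 :> nat then a else if i == 1 :> nat then b else c.

Lemma waddA (R : comNzRingType) : associative (@wadd R).
Proof.
move=> x y z.
pose t1 S (X : 'I_3 -> wv n S) := wadd (X (inord 0)) (wadd (X (inord 1)) (X (inord 2))).
pose t2 S (X : 'I_3 -> wv n S) := wadd (wadd (X (inord 0)) (X (inord 1))) (X (inord 2)).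
have : t1 R (pick3 x y z) = t2 R (pick3 x y z); last by rewrite /t1 /t2 /pick3 !inordK.
apply: wv_transfer => [? ? f X|? ? f X|N X m].
- by rewrite /t1 /t2 !wmap_add.
- by rewrite /t1 /t2 !wmap_add.
- by rewrite /t1 /t2 !ghost_wadd addrA.
Qed.

Lemma waddC (R : comNzRingType) : commutative (@wadd R).
Proof.
move=> x y.
pose t1 S (X : 'I_3 -> wv n S) := wadd (X (inord 0)) (X (inord 1)).
pose t2 S (X : 'I_3 -> wv n S) := wadd (X (inord 1)) (X (inord 0)).
have : t1 R (pick3 x y y) = t2 R (pick3 x y y); last by rewrite /t1 /t2 /pick3 !inordK.
apply: wv_transfer => [? ? f X|? ? f X|N X m].
- by rewrite /t1 /t2 !wmap_add.
- by rewrite /t1 /t2 !wmap_add.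
- by rewrite /t1 /t2 !ghost_wadd addrC.
Qed.

Lemma wadd0 (R : comNzRingType) : left_id (wzero R) (@wadd R).
Proof.
move=> x.
pose t1 S (X : 'I_3 -> wv n S) := wadd (wzero S) (X (inord 0)).
pose t2 S (X : 'I_3 -> wv n S) := X (inord 0).
have : t1 R (pick3 x x x) = t2 R (pick3 x x x); last by rewrite /t1 /t2 /pick3 !inordK.
apply: wv_transfer => [? ? f X|//|N X m].
- by rewrite /t1 /t2 (wmap_zero f) !wmap_add.
- by rewrite /t1 /t2 !ghost_wadd ghost_wzero add0r.
Qed.

Definition wopp (R : comNzRingType) (x : wv n R) : wv n R := wsub (wzero R) x.

Lemma wmap_opp (R S : comNzRingType) (f : {rmorphism R -> S}) x :
  wopp (wmap f x) = wmap f (wopp x).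
Proof. by rewrite /wopp (wmap_zero f) wmap_sub. Qed.

Lemma waddN (R : comNzRingType) : left_inverse (wzero R) (@wopp R) (@wadd R).
Proof.
move=> x.
pose t1 S (X : 'I_3 -> wv n S) := wadd (wopp (X (inord 0))) (X (inord 0)).
pose t2 S (X : 'I_3 -> wv n S) := wzero S.
have : t1 R (pick3 x x x) = t2 R (pick3 x x x); last by rewrite /t1 /t2 /pick3 !inordK.
apply: wv_transfer => [? ? f X|? ? f X|N X m].
- by rewrite /t1 /t2 wmap_opp wmap_add.
- exact: wmap_zero.
- by rewrite /t1 /t2 ghost_wadd ghost_wsub ghost_wzero sub0r addNr.
Qed.

Lemma wsubE (R : comNzRingType) (x y : wv n R) : wsub x y = wadd x (wopp y).
Proof.
pose t1 S (X : 'I_3 -> wv n S) := wsub (X (inord 0)) (X (inord 1)).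
pose t2 S (X : 'I_3 -> wv n S) := wadd (X (inord 0)) (wopp (X (inord 1))).
have : t1 R (pick3 x y y) = t2 R (pick3 x y y); last by rewrite /t1 /t2 /pick3 !inordK.
apply: wv_transfer => [? ? f X|? ? f X|N X m].
- by rewrite /t1 /t2 !wmap_sub.
- by rewrite /t1 /t2 !wmap_opp !wmap_add.
- by rewrite /t1 /t2 !ghost_wadd !ghost_wsub ghost_wzero sub0r.
Qed.

HB.instance Definition _ (R : comNzRingType) :=
  GRing.isZmodule.Build (wv n R) (@waddA R) (@waddC R) (@wadd0 R) (@waddN R).

Lemma witt_subE (R : comNzRingType) (x y : wv n R) : witt_sub 2 x y = x - y.
Proof. exact: wsubE. Qed.

Lemma wmap_is_additive (R S : comNzRingType) (f : {rmorphism R -> S}) :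
  {morph (wmap f : wv n R -> wv n S) : x y / x - y}.
Proof. by move=> x y; rewrite -!witt_subE; apply/esym/wmap_sub. Qed.

HB.instance Definition _ (R S : comNzRingType) (f : {rmorphism R -> S}) :=
  GRing.isZmodMorphism.Build (wv n R) (wv n S) (wmap f) (@wmap_is_additive R S f).

Definition wghost (R : comNzRingType) (m : nat) (x : wv n R) : R := ghost 2 (wcomp x) m.

Lemma wghost0 (R : comNzRingType) m : wghost m (0 : wv n R) = 0.
Proof. exact: ghost_wzero. Qed.
Lemma wghostB (R : comNzRingType) (m : 'I_n) : {morph @wghost R m : x y / x - y}.
Proof. by move=> x y; rewrite -witt_subE; apply: ghost_wsub. Qed.
Lemma wghostD (R : comNzRingType) (m : 'I_n) : {morph @wghost R m : x y / x + y}.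
Proof. by move=> x y; apply: ghost_wadd. Qed.

(* V^s [a], with V the Verschiebung *)
Definition vt (R : comNzRingType) (s : nat) (a : R) : wv n R :=
  [ffun i : 'I_n => if i == s :> nat then a else 0].

Lemma vtE (R : comNzRingType) s (a : R) i :
  wcomp (vt s a) i = if i == s :> nat then a else 0.
Proof. by rewrite /wcomp ffunE. Qed.

Lemma wghost_vt (R : comNzRingType) s (a : R) (m : 'I_n) :
  wghost m (vt s a) = if (s <= m)%N then a ^+ (2 ^ (m - s)) *+ 2 ^ s else 0.
Proof.
rewrite /wghost /ghost; case: ifP => sm.
  have sn : (s < n)%N := leq_ltn_trans sm (ltn_ord m).
  rewrite (bigD1 (Ordinal sn)) //= vtE eqxx big1 ?addr0 ?mulr_natl //.
  move=> i /andP[_]; rewrite -val_eqE /= => ni.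
  by rewrite vtE (negbTE ni) expr0n expn_eq0 mulr0.
rewrite big1 // => i im; rewrite vtE ifN ?expr0n ?expn_eq0 ?mulr0 //.
by apply: contraFN sm => /eqP <-.
Qed.

Lemma wmap_vt (R S : comNzRingType) (f : {rmorphism R -> S}) s a :
  wmap f (vt s a) = vt s (f a).
Proof. by apply: wvP => i; rewrite wmapE !vtE; case: ifP => // _; rewrite rmorph0. Qed.

Lemma vt0 (R : comNzRingType) s : vt s (0 : R) = 0.
Proof. by apply: wvP => i; rewrite vtE /wcomp ffunE; case: ifP. Qed.

(** V^i [x_i] contributes exactly the i-th summand of each ghost component, so the identity holds
    after lifting. *)
Lemma wv_decomp (R : comNzRingType) (x : wv n R) : x = \sum_(i < n) vt i (wcomp x i).
Proof.
have [P [f [X [tf eX]]]] := wv_lift (fun _ : 'I_1 => x).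
rewrite (eX ord0); move: (X ord0) => {eX X}y.
have {1}-> : y = \sum_(i < n) vt i (wcomp y i).
  apply: (ghost_inj tf) => m; rewrite -!/(wghost _ _) (big_morph (wghost m) (wghostD m) (wghost0 _ m)).
  rewrite {1}/wghost /ghost [in LHS]big_mkcond /=; apply: eq_bigr => i _.
  by rewrite wghost_vt mulr_natl.
by rewrite raddf_sum; apply: eq_bigr => i _; rewrite wmapE /= wmap_vt.
Qed.

Definition wlow (R : comNzRingType) (j : nat) (x : wv n R) :=
  forall i : 'I_n, (i < j)%N -> wcomp x i = 0.

(** When the components below j vanish, so do the ghost components below j, and the j-th one is 2^j
    x_j, which is additive. *)
Lemma wlowB_comp (R : comNzRingType) (x y : wv n R) (j : 'I_n) :
  wlow j x -> wlow j y ->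
  wlow j (x - y) /\ wcomp (x - y) j = wcomp x j - wcomp y j.
Proof.
move=> lx ly.
have [P [f [X [tf eX]]]] := wv_lift (fun i : 'I_3 => pick3 x y y i).
(* A generic lift has nonzero components below j; [cut] erases them without changing the image in
   R. *)
pose cut (z : wv n P) : wv n P :=
  [ffun i : 'I_n => if (i < j)%N then 0 else wcomp z i].
have ex : x = wmap f (cut (X (inord 0))).
  apply: wvP => i; rewrite wmapE {2}/wcomp ffunE; case: ifP => ij.
    by rewrite rmorph0 lx.
  by rewrite -wmapE -eX /pick3 inordK.
have ey : y = wmap f (cut (X (inord 1))).
  apply: wvP => i; rewrite wmapE {2}/wcomp ffunE; case: ifP => ij.
    by rewrite rmorph0 ly.
  by rewrite -wmapE -eX /pick3 inordK.
have gc z (m : 'I_n) : (m <= j)%N ->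
    wghost m (cut z) = if m == j :> nat then wcomp z j *+ 2 ^ j else 0.
  move=> mj; rewrite /wghost /ghost; case: ifP => [/eqP mj'|nmj].
    rewrite (bigD1 j) ?mj' //= /wcomp ffunE ltnn subnn expr1 big1 ?addr0 ?mulr_natl //.
    move=> i /andP[ij]; rewrite -val_eqE /= => nij.
    by rewrite ffunE ltn_neqAle nij ij expr0n expn_eq0 mulr0.
  rewrite big1 // => i im; rewrite /wcomp ffunE ifT ?expr0n ?expn_eq0 ?mulr0 //.
  by apply: leq_ltn_trans im _; rewrite ltn_neqAle nmj.
have H := @ghost_inj_upto _ tf (cut (X (inord 0)) - cut (X (inord 1)))
  (vt j (wcomp (X (inord 0)) j - wcomp (X (inord 1)) j)) j.
have {}H : forall m : 'I_n, (m <= j)%N ->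
   wcomp (cut (X (inord 0)) - cut (X (inord 1))) m =
   wcomp (vt j (wcomp (X (inord 0)) j - wcomp (X (inord 1)) j)) m.
  apply: H => m mj; rewrite -!/(wghost _ _) wghostB !gc // wghost_vt.
  have [mej|nmj] := eqVneq (m : nat) j.
    by rewrite mej leqnn subnn expr1 mulrnBl.
  by rewrite ifN ?subr0 // -ltnNge ltn_neqAle nmj.
have cj z : wcomp (cut z) j = wcomp z j by rewrite /wcomp ffunE ltnn.
split=> [i ij|]; rewrite ex ey -raddfB /= !wmapE.
  by rewrite H ?(ltnW ij) // vtE ltn_eqF // rmorph0.
by rewrite H // vtE eqxx !cj rmorphB.
Qed.

Lemma wlow0 (R : comNzRingType) j : wlow j (0 : wv n R).
Proof. by move=> i _; rewrite /wcomp ffunE. Qed.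

Lemma wlow_sum (R : comNzRingType) (I : finType) (x : I -> wv n R) (j : 'I_n) :
  (forall l, wlow j (x l)) ->
  wlow j (\sum_l x l) /\ wcomp (\sum_l x l) j = \sum_l wcomp (x l) j.
Proof.
move=> lx; apply: (big_rec2 (fun a b => wlow j a /\ wcomp a j = b)).
  by split; [exact: wlow0 | rewrite /wcomp ffunE].
move=> i b a _ [la <-].
have [l1 e1] := wlowB_comp (@wlow0 R j) la.
have [l2 e2] := wlowB_comp (lx i) l1.
have z0 : wcomp (0 : wv n R) j = 0 by rewrite /wcomp ffunE.
rewrite z0 !sub0r in e1 e2 l2; rewrite opprK e1 opprK in e2 l2.
by split.
Qed.

Lemma wv_closed (R : comNzRingType) (S : R -> Prop) :
    S 1 -> (forall a b, S a -> S b -> S (a - b)) ->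
    (forall a b, S a -> S b -> S (a * b)) ->
  forall x y : wv n R, (forall i, S (wcomp x i)) -> (forall i, S (wcomp y i)) ->
  forall i, S (wcomp (x - y) i).
Proof.
move=> S1 SB SM x y Sx Sy; rewrite -witt_subE.
exact: (witt_op_closed subop_morph subop_mod).
Qed.

Lemma wv_closed_sum (R : comNzRingType) (S : R -> Prop) :
    S 1 -> (forall a b, S a -> S b -> S (a - b)) ->
    (forall a b, S a -> S b -> S (a * b)) ->
  forall (I : finType) (x : I -> wv n R),
    (forall l i, S (wcomp (x l) i)) -> forall i, S (wcomp (\sum_l x l) i).
Proof.
move=> S1 SB SM I x Sx; have S0 : S 0 by rewrite -(subrr 1); apply: SB.
apply: (big_ind (fun w : wv n R => forall i, S (wcomp w i))) => // [i|y z Sy Sz]; first by rewrite /wcomp ffunE.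
rewrite -[z]opprK -[- z]sub0r; apply: wv_closed => //.
by apply: wv_closed => // i; rewrite /wcomp ffunE.
Qed.

Section FrobeniusChar2.
Variables (R : comNzRingType) (ch : 2%N \in [pchar R]).

Lemma witt_frobeniusE (x : wv n R) : witt_frobenius 2 x = wmap (pFrobenius_aut ch) x.
Proof. by apply/ffunP => i; rewrite !ffunE. Qed.
End FrobeniusChar2.
End WittGroup.

Lemma mulrn_exp2 (D : int) s m : (s <= m)%N ->
  D *+ 2 ^ m = D *+ 2 ^ s * (2 ^ (m - s))%N%:Z.
Proof.
by move=> sm; rewrite -mulr_natr natz mulrnAl -mulr_natr natz -mulrA -PoszM -expnD subnK.
Qed.

(** * Filtered rings and first-order expansion of Witt vectors *)

Record filtered (R : comNzRingType) (F : int -> R -> Prop) : Prop := Filtered {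
  fil0 : forall z, F z 0;
  filB : forall z a b, F z a -> F z b -> F z (a - b);
  fil_le : forall z z' a, z <= z' -> F z a -> F z' a;
  fil1 : F 0 1;
  filM : forall z z' a b, F z a -> F z' b -> F (z + z') (a * b) }.

Section Filtered.
Variables (R : comNzRingType) (F : int -> R -> Prop).
Hypothesis FF : filtered F.

Lemma filN z a : F z a -> F z (- a).
Proof. by move=> Fa; rewrite -sub0r; apply: (filB FF) => //; apply: (fil0 FF). Qed.

Lemma filD z a b : F z a -> F z b -> F z (a + b).
Proof. by move=> Fa Fb; rewrite -[b]opprK; apply/(filB FF)/filN. Qed.

Lemma fil_sum z (I : Type) (r : seq I) (Q : pred I) (a : I -> R) :
  (forall i, Q i -> F z (a i)) -> F z (\sum_(i <- r | Q i) a i).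
Proof. by move=> h; apply: (big_ind (F z)) => //; [exact: (fil0 FF) | exact: filD]. Qed.

Lemma filMn z a m : F z a -> F z (a *+ m).
Proof.
move=> Fa; elim: m => [|m IH]; first by rewrite mulr0n; apply: (fil0 FF).
by rewrite mulrS; apply: filD.
Qed.

Lemma filX z a m : F z a -> F (z * m%:Z) (a ^+ m).
Proof.
move=> Fa; elim: m => [|m IH]; first by rewrite mulr0; apply: (fil1 FF).
by rewrite exprS (_ : z * _ = z + z * m%:Z); [exact: (filM FF) | lia].
Qed.

(** The remainder of the first-order expansion in [eta] is quadratic in [eta], and each factor [eta]
    gains c over the order of [beta]. *)
Lemma fil_binom (B c : int) (eta beta : R) q : 0 <= c ->
  F (B - c) eta -> F B beta ->
  F (B * q.+1%:Z - c *+ 2)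
    ((eta + beta) ^+ q.+1 - beta ^+ q.+1 - (eta * beta ^+ q) *+ q.+1).
Proof.
move=> c0 Fe Fb; elim: q => [|q IH].
  rewrite [X in F _ X](_ : _ = 0); first exact: (fil0 FF).
  by rewrite !expr1 expr0; ring.
have -> : (eta + beta) ^+ q.+2 - beta ^+ q.+2 - (eta * beta ^+ q.+1) *+ q.+2 =
  (eta + beta) * ((eta + beta) ^+ q.+1 - beta ^+ q.+1 - (eta * beta ^+ q) *+ q.+1)
  + (eta * eta * beta ^+ q) *+ q.+1 by rewrite !exprS; ring.
apply: filD.
  rewrite (_ : B * _ - _ = B + (B * q.+1%:Z - c *+ 2)); last by lia.
  by apply: (filM FF) => //; apply: filD => //; apply: fil_le Fe => //; lia.
apply: filMn; rewrite (_ : B * _ - _ = B - c + (B - c) + B * q%:Z); last by lia.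
by apply: (filM FF); [exact: (filM FF) | exact: filX].
Qed.
End Filtered.

Section Family.
Variables (n : nat) (P : comNzRingType) (F : int -> P -> Prop).
Hypothesis FF : filtered F.
Hypothesis F_tf : forall z m a, (0 < m)%N -> F z (a *+ m) -> F z a.
Variables (I : finType) (pos : I -> nat) (eta beta h : I -> P) (D c : int).
Hypothesis c0 : 0 <= c.
Hypothesis Feta : forall l, F (D *+ 2 ^ pos l - c) (eta l).
Hypothesis Fbeta : forall l, F (D *+ 2 ^ pos l) (beta l).
Hypothesis Fh : forall l, F (D *+ 2 ^ pos l - c) (h l).

(** Models the sum of V^s([a] - [b^2] + [b]) with a = eta + beta, beta = b^2 and h = b. *)
Definition wfamily (R : comNzRingType) (eta beta h : I -> R) : wv n R :=
  \sum_l (vt n (pos l) (eta l + beta l) - vt n (pos l) (beta l) + vt n (pos l) (h l)).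

(* the part of wfamily that is linear in eta and h *)
Definition wlead (R : comNzRingType) (eta beta h : I -> R) (m : nat) : R :=
  \sum_(l | (pos l <= m)%N) eta l * beta l ^+ (2 ^ (m - pos l)).-1
  + \sum_(l | pos l == m) h l.

(** In the m-th ghost component [eta + beta] - [beta] contributes 2^m eta beta^(2^(m-s) - 1) up to
    terms quadratic in eta. The lower components of the family, of order at most D 2^i - c by
    induction, and the [h l] with [pos l < m] enter with an exponent at least 2, so they gain c at
    least twice. What remains is divided by 2^m with [F_tf]. *)
Lemma wfamily_lead (m : 'I_n) :
  F (D *+ 2 ^ m - c *+ 2)
    (wcomp (wfamily eta beta h) m - wlead eta beta h m).
Proof.
have Flead j : F (D *+ 2 ^ j - c) (wlead eta beta h j).
  apply: (filD FF); apply: (fil_sum FF) => l; last by move/eqP <-.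
  move=> lj; have q0 : (0 < 2 ^ (j - pos l))%N by rewrite expn_gt0.
  have e : D *+ 2 ^ j = D *+ 2 ^ pos l * (2 ^ (j - pos l))%N%:Z.
    exact: mulrn_exp2.
  rewrite e -(prednK q0) /= (_ : _ - c = D *+ 2 ^ pos l - c + D *+ 2 ^ pos l * (2 ^ (j - pos l)).-1%:Z).
    by apply: (filM FF) => //; apply: (filX FF).
  by lia.
case: m => m mn /=; elim/ltn_ind: m mn => m IH mn.
set X := wfamily eta beta h.
have FX i : (i < m)%N -> forall i_n : (i < n)%N, F (D *+ 2 ^ i - c) (wcomp X (Ordinal i_n)).
  move=> im i_n; rewrite -[wcomp _ _](subrK (wlead eta beta h i)).
  by apply: (filD FF) => //; apply: (fil_le FF) (IH i im i_n); lia.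
have := ghost_split (wcomp X) (Ordinal mn); rewrite -/(wghost _ _).
rewrite /X /wfamily (big_morph _ (wghostD (Ordinal mn)) (@wghost0 n P (Ordinal mn))) -/X.
rewrite (eq_bigr (fun l => if (pos l <= m)%N then
  ((eta l + beta l) ^+ (2 ^ (m - pos l)) - beta l ^+ (2 ^ (m - pos l))
   + h l ^+ (2 ^ (m - pos l))) *+ 2 ^ pos l else 0)); last first.
  move=> l _; rewrite wghostD wghostB !wghost_vt /=; case: ifP => _.
    by rewrite mulrnDl mulrnBl.
  by rewrite subrr addr0.
rewrite -big_mkcond /= => e.
apply: (@F_tf _ (2 ^ m)); first by rewrite expn_gt0.
have -> : (wcomp X (Ordinal mn) - wlead eta beta h m) *+ 2 ^ m =
   \sum_(l | (pos l <= m)%N)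
     (((eta l + beta l) ^+ (2 ^ (m - pos l)) - beta l ^+ (2 ^ (m - pos l))
       - (eta l * beta l ^+ (2 ^ (m - pos l)).-1) *+ (2 ^ (m - pos l))) *+ 2 ^ pos l
      + (if pos l == m then 0 else h l ^+ (2 ^ (m - pos l)) *+ 2 ^ pos l))
   - \sum_(i < n | (i < m)%N) (2 ^ i)%:R * wcomp X i ^+ (2 ^ (m - i)).
  rewrite mulrnBl -[X in X - _](addrK (\sum_(i < n | (i < m)%N) (2 ^ i)%:R * wcomp X i ^+ (2 ^ (m - i)))).
  rewrite -e addrAC; congr (_ - _); apply/eqP; rewrite subr_eq; apply/eqP.
  have eh : \sum_(l | pos l == m) h l *+ 2 ^ m = \sum_(l | (pos l <= m)%N)
    if pos l == m then h l *+ 2 ^ m else 0.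
    rewrite -big_mkcondr /=; apply: eq_bigl => l.
    by case: eqP => [->|]; rewrite ?leqnn ?andbF.
  rewrite /wlead mulrnDl -!sumrMnl eh -!big_split /=; apply: eq_bigr => l lm.
  have e2 C : C *+ 2 ^ m = C *+ 2 ^ (m - pos l) *+ 2 ^ pos l :> P.
    by rewrite -mulrnA -expnD subnK.
  rewrite (e2 (eta l * _)); case: eqP => [em|_].
    rewrite -em subnn expr1; move: (2 ^ pos l)%N => p.
    by move: (eta l * _) => C; ring.
  by move: (2 ^ pos l)%N (2 ^ (m - pos l))%N => p q; move: (eta l * _) => C; ring.
apply: (filB FF); apply: (fil_sum FF).
  move=> l lm; have q0 : (0 < 2 ^ (m - pos l))%N by rewrite expn_gt0.
  have e2 : D *+ 2 ^ m = D *+ 2 ^ pos l * (2 ^ (m - pos l))%N%:Z.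
    exact: mulrn_exp2.
  apply: (filD FF); first by apply: (filMn FF); rewrite e2 -(prednK q0); apply: (fil_binom FF).
  case: eqP => [_|/eqP ne]; first exact: (fil0 FF).
  apply: (filMn FF); apply: (fil_le FF) (filX FF (2 ^ (m - pos l)) (Fh l)).
  have : (2 <= 2 ^ (m - pos l))%N.
    by rewrite -{1}(expn1 2) leq_exp2l // subn_gt0 ltn_neqAle ne.
  by rewrite e2; move: (2 ^ (m - pos l))%N => q q2; rewrite mulrBl; nia.
move=> [i i_n] /= im; rewrite mulr_natl; apply: (filMn FF).
apply: (fil_le FF) (filX FF (2 ^ (m - i)) (FX i im i_n)).
have -> : D *+ 2 ^ m = D *+ 2 ^ i * (2 ^ (m - i))%N%:Z.
  exact: mulrn_exp2 (ltnW im).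
have : (2 <= 2 ^ (m - i))%N by rewrite -{1}(expn1 2) leq_exp2l // subn_gt0.
by move: (2 ^ (m - i))%N => q q2; rewrite mulrBl; nia.
Qed.
End Family.

Section Weights.
Variables (N : nat) (wt : 'I_N -> int).
Local Notation P := {mpoly int[N]}.

Definition weight (m : 'X_{1..N}) : int := \sum_i wt i *+ m i.
Definition wdeg (z : int) (p : P) : Prop := forall m, m \in msupp p -> weight m <= z.

Lemma weightD m1 m2 : weight (m1 + m2)%MM = weight m1 + weight m2.
Proof. by rewrite /weight -big_split; apply: eq_bigr => i _; rewrite mnmDE mulrnDr. Qed.

Lemma weight0 : weight 0%MM = 0.
Proof. by rewrite /weight big1 // => i _; rewrite mnm0E mulr0n. Qed.

Lemma weight1 i : weight U_(i)%MM = wt i.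
Proof.
rewrite /weight (bigD1 i) //= mnm1E eqxx mulr1n big1 ?addr0 // => j ji.
by rewrite mnm1E eq_sym (negbTE ji) mulr0n.
Qed.

Lemma wdeg_filtered : filtered wdeg.
Proof.
split=> [z m|z a b Fa Fb m|z z' a zz' Fa m ma|m|z z' a b Fa Fb m].
- by rewrite msupp0.
- by move/msuppB_le; rewrite mem_cat => /orP[/Fa|/Fb].
- exact: le_trans (Fa m ma) zz'.
- by rewrite msupp1 inE => /eqP ->; rewrite weight0.
move/msuppM_le/allpairsP => [[m1 m2] /= [/Fa h1 /Fb h2 ->]].
by rewrite weightD lerD.
Qed.

Lemma wdeg_mulrn z m p : (0 < m)%N -> wdeg z (p *+ m) -> wdeg z p.
Proof.
move=> m0 h j; rewrite mcoeff_msupp => pj; apply: h.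
by rewrite mcoeff_msupp mcoeffMn mulrn_eq0 negb_or pj andbT -lt0n.
Qed.

Lemma wdegX i : wdeg (wt i) 'X_i.
Proof. by move=> m; rewrite msuppX inE => /eqP ->; rewrite weight1. Qed.

Lemma wdeg_eval (R : comNzRingType) (G : int -> R -> Prop) (GG : filtered G)
    (v : 'I_N -> R) :
  (forall i, G (wt i) (v i)) -> forall z p, wdeg z p -> G z (mmap intr v p).
Proof.
move=> Gv z p dp; rewrite /mmap big_seq_cond; apply: (fil_sum GG) => m.
rewrite andbT => /dp mz; apply: (fil_le GG mz).
rewrite mulrzl; have Gm : G (weight m) (mmap1 v m).
  rewrite /mmap1 /weight; apply: (big_rec2 (fun y1 y2 => G y1 y2)); first exact: (fil1 GG).
  move=> i y1 y2 _ G12; apply: (filM GG) => //.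
  by rewrite -mulr_natr natz; apply: (filX GG).
case: (p@_m) => k; first exact: (filMn GG).
by rewrite NegzE mulrNz; apply/(filN GG)/(filMn GG).
Qed.
End Weights.

Section FamilyEval.
Variables (n : nat) (R : comNzRingType) (G : int -> R -> Prop).
Hypothesis GG : filtered G.
Variables (I : finType) (pos : I -> nat) (eta beta h : I -> R) (D c : int).
Hypothesis c0 : 0 <= c.
Hypothesis Geta : forall l, G (D *+ 2 ^ pos l - c) (eta l).
Hypothesis Gbeta : forall l, G (D *+ 2 ^ pos l) (beta l).
Hypothesis Gh : forall l, G (D *+ 2 ^ pos l - c) (h l).

(** Division by 2^m makes no sense in characteristic 2. The estimate is therefore taken from the
    polynomial ring over Z in variables for [eta], [beta] and [h], weighted by their expected
    orders, and evaluated. *)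
Lemma wfamily_bound (m : 'I_n) :
  G (D *+ 2 ^ m - c *+ 2)
    (wcomp (wfamily n pos eta beta h) m - wlead pos eta beta h m).
Proof.
pose J : finType := (I + (I + I))%type.
pose val3 (T : Type) (a b d : I -> T) (j : 'I_#|J|) : T := match enum_val j with
  | inl l => a l | inr (inl l) => b l | inr (inr l) => d l end.
pose wt := val3 int (fun l => D *+ 2 ^ pos l - c) (fun l => D *+ 2 ^ pos l)
  (fun l => D *+ 2 ^ pos l - c).
pose v := val3 R eta beta h.
pose X (j : J) : {mpoly int[#|J|]} := 'X_(enum_rank j).
have vX j : mmap (intr : int -> R) v (X j) = v (enum_rank j) by rewrite mmapX mmap1U.
have wX j : wdeg wt (wt (enum_rank j)) (X j) by exact: wdegX.
have Gv i : G (wt i) (v i).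
  by rewrite /wt /v /val3; case: (enum_val i) => [l|[l|l]].
have wE (T : Type) (a b d : I -> T) : (forall l, val3 T a b d (enum_rank (inl l : J)) = a l) *
   (forall l, val3 T a b d (enum_rank (inr (inl l) : J)) = b l) *
   (forall l, val3 T a b d (enum_rank (inr (inr l) : J)) = d l).
  by split; first split; move=> l; rewrite /val3 enum_rankK.
have vE : (forall l, v (enum_rank (inl l : J)) = eta l) *
   (forall l, v (enum_rank (inr (inl l) : J)) = beta l) *
   (forall l, v (enum_rank (inr (inr l) : J)) = h l) := wE _ _ _ _.
have H := @wfamily_lead n _ _ (wdeg_filtered wt) (@wdeg_mulrn _ wt)
  I pos (fun l => X (inl l)) (fun l => X (inr (inl l))) (fun l => X (inr (inr l)))
  D c c0 _ _ _ m.
have {H} := wdeg_eval GG Gv (H _ _ _).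
pose f : {rmorphism {mpoly int[#|J|]} -> R} := mmap (intr : int -> R) v.
rewrite -[mmap _ _ _]/(f _) rmorphB -(wmapE f).
have -> : wmap f (wfamily n pos (fun l => X (inl l)) (fun l => X (inr (inl l)))
    (fun l => X (inr (inr l)))) = wfamily n pos eta beta h.
  rewrite /wfamily raddf_sum; apply: eq_bigr => l _.
  by rewrite raddfD raddfB /= !wmap_vt rmorphD /f /= !vX !vE.
have -> : f (wlead pos (fun l => X (inl l)) (fun l => X (inr (inl l)))
    (fun l => X (inr (inr l))) m) = wlead pos eta beta h m.
  rewrite /wlead rmorphD !rmorph_sum; congr (_ + _); apply: eq_bigr => l _.
    by rewrite rmorphM rmorphXn /f /= !vX !vE.
  by rewrite /f /= !vX !vE.
apply=> l; [have := wX (inl l) | have := wX (inr (inl l)) | have := wX (inr (inr l))];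
  by rewrite /wt wE.
Qed.
End FamilyEval.

(** * Pole orders in quadratic extensions *)

Section Char2.
Variables (R : comNzRingType) (ch : 2%N \in [pchar R]).
Lemma addrr2 (a : R) : a + a = 0.
Proof. by rewrite -mulr2n -mulr_natr (pcharf0 ch) mulr0. Qed.
Lemma oppr2 (a : R) : - a = a.
Proof. by apply/eqP; rewrite eq_sym -addr_eq0 addrr2. Qed.
(** [ring] does not know that 2 = 0; [c] supplies half of the terms that cancel. *)
Lemma eq_char2 (c a b : R) : a = b + (c + c) -> a = b.
Proof. by rewrite addrr2 addr0. Qed.
End Char2.

Definition exact (R : comNzRingType) (F : int -> R -> Prop) (z : int) (a : R) : Prop :=
  F z a /\ ~ F (z - 1) a.

(* F z f reads "f lies in the subfield and has pole order at most z at the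
   place at infinity"; pole orders are multiples of u. *)
Record valued (k L : fieldType) (ev : {rmorphism {poly k} -> L}) (u : int)
    (F : int -> L -> Prop) : Prop := Valued {
  val_fil : filtered F;
  val_gt0 : 0 < u;
  val_const : forall c, F 0 (ev c%:P);
  val1 : ~ F (- 1) 1;
  valM : forall z z' a b, exact F z a -> exact F z' b -> exact F (z + z') (a * b);
  valE : forall z a, F z a -> a <> 0 -> exists s, s * u <= z /\ exact F (s * u) a;
  valV : forall z a, F z a -> exists z', F z' a^-1;
  val_res : forall z a b, exact F z a -> exact F z b ->
    exists c, F (z - 1) (a - ev c%:P * b) }.

Section Valued.
Variables (k L : fieldType) (ev : {rmorphism {poly k} -> L}) (u : int).
Variables (F : int -> L -> Prop).
Hypothesis V : valued ev u F.
Let FF := val_fil V.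

Lemma exact_neq0 z a : exact F z a -> a <> 0.
Proof. by case=> _ h e; apply: h; rewrite e; apply: (fil0 FF). Qed.

Lemma exact_le z z' a : exact F z a -> F z' a -> z <= z'.
Proof.
by case=> _ h Fa; rewrite leNgt; apply/negP => lt; apply: h; apply: (fil_le FF) Fa; lia.
Qed.

Lemma exact_uniq z z' a : exact F z a -> exact F z' a -> z = z'.
Proof.
move=> ea ea'; apply/eqP; rewrite eq_le (exact_le ea ea'.1).
exact: (exact_le ea' ea.1).
Qed.

Lemma exactD z a b : exact F z a -> F (z - 1) b -> exact F z (a + b).
Proof.
case=> Fa h Fb; split; first by apply: (filD FF) => //; apply: (fil_le FF) Fb; lia.
by move=> Fab; apply: h; rewrite -(addrK b a); apply: (filB FF).
Qed.

Lemma exact_unit z a : exact F z a -> exists s, z = s * u.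
Proof.
move=> ea; have [s [_ es]] := valE V ea.1 (exact_neq0 ea).
by exists s; apply: exact_uniq ea es.
Qed.

Lemma exactX2 z a : exact F z a -> exact F (z + z) (a ^+ 2).
Proof. by move=> ea; rewrite expr2; apply: (valM V). Qed.

Lemma exact1 : exact F 0 1.
Proof. by split; [exact: (fil1 FF) | rewrite sub0r; exact: (val1 V)]. Qed.

Lemma exactV z a : exact F z a -> exact F (- z) a^-1.
Proof.
move=> ea; have a0 := exact_neq0 ea; have [z' Fa'] := valV V ea.1.
have a'0 : a^-1 <> 0 by move/eqP; rewrite invr_eq0 => /eqP.
have [s [_ es]] := valE V Fa' a'0.
have := valM V ea es; rewrite mulfV; last by apply/eqP.
move=> e1; have := exact_uniq e1 exact1 => e2.
by have -> : - z = s * u by lia.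
Qed.

(** Squaring doubles orders, so the order of a square is even and one unit of slack in t costs
    nothing. *)
Lemma sqrt_bound t s s0 a : F s0 a -> F t (a ^+ 2) -> t <= s + s + 1 -> F s a.
Proof.
move=> Fa Fa2 ts; have [->|/eqP a0] := eqVneq a 0; first exact: (fil0 FF).
have [e [_ ea]] := valE V Fa a0.
by have := exact_le (exactX2 ea) Fa2; move=> h; apply: (fil_le FF) ea.1; lia.
Qed.

Lemma fil_lt z a : F z a -> (forall s, z <> s * u) -> F (z - 1) a.
Proof.
move=> Fa nz; have [->|/eqP a0] := eqVneq a 0; first exact: (fil0 FF).
have [s [sz es]] := valE V Fa a0.
by apply: (fil_le FF) es.1; have := nz s; lia.
Qed.

Lemma exact_or z a : F z a -> exact F z a \/ F (z - 1) a.
Proof. by move=> Fa; case: (classic (F (z - 1) a)) => h; [right | left]. Qed.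

Lemma fil_divr z z' a b : F z a -> F z' b -> exists s, F s (a / b).
Proof.
move=> Fa Fb; have [s Fs] := valV V Fb.
by exists (z + s); apply: (filM FF).
Qed.
End Valued.

Section Step.
Variables (k L : fieldType) (ev : {rmorphism {poly k} -> L}) (u o : int).
Variables (F : int -> L -> Prop) (y : L).
Hypothesis ch : 2%N \in [pchar L].
Hypothesis V : valued ev (2 * u) F.
Hypothesis o0 : 0 <= o.
Let r : int := u * (2 * o + 1).
Let g := y ^+ 2 + y.
Hypothesis eg : exact F (r + r) g.
Let FF := val_fil V.

Definition step_fil (r : int) (y : L) (F : int -> L -> Prop) (s : int) (f : L) : Prop :=
  exists a b, [/\ F s a, F (s - r) b & f = a + b * y].
Local Notation G := (step_fil r y F).

Let u0 : 0 < u. Proof. by have := val_gt0 V; lia. Qed.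
Let r0 : 0 < r. Proof. by rewrite /r mulr_gt0 //; lia. Qed.

Lemma step_parity s t : s * (2 * u) - r <> t * (2 * u).
Proof.
rewrite /r => e; have : u * (2 * (s - o - t) - 1) = 0 by [lia].
by move/eqP; rewrite mulf_eq0; lia.
Qed.

(** If y were a quotient of elements of the subfield, y^2 + y would have order at most 0, or twice a
    multiple of 2u; but its order is 2r with r an odd multiple of u. *)
Lemma step_free s a b : F s a -> F s b -> a + b * y = 0 -> a = 0 /\ b = 0.
Proof.
move=> Fa Fb e; have [b0|b0] := eqVneq b 0.
  by move: e; rewrite b0 mul0r addr0.
have ey : y = a / b.
  apply: (mulfI b0); rewrite mulrCA mulfV // mulr1.
  by apply/eqP; rewrite -subr_eq0 (oppr2 ch) addrC e.
have [t Ft] := fil_divr V Fa Fb; rewrite -ey in Ft.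
have y0 : y <> 0.
  by move=> y0; apply: (exact_neq0 V eg); rewrite /g y0 expr0n addr0.
have [t1 [_ et]] := valE V Ft y0.
exfalso; have [t0|t0] := lerP (t1 * (2 * u)) 0.
  have Fy : F 0 y by apply: (fil_le FF) et.1.
  have : F 0 g by apply: (filD FF) => //; rewrite -(addr0 0) expr2; apply: (filM FF).
  by move=> Fg; have := exact_le V eg Fg; lia.
have e2 : exact F (t1 * (2 * u) + t1 * (2 * u)) g.
  apply: (exactD V (exactX2 V et)); apply: (fil_le FF) et.1; lia.
have := exact_uniq V eg e2 => e3.
have := @step_parity 0 (- t1); lia.
Qed.

Lemma step_fil_inv s s' a b : F s' a -> F s' b -> G s (a + b * y) ->
  F s a /\ F (s - r) b.
Proof.
move=> Fa Fb [a' [b' [Fa' Fb' e]]].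
pose S := `|s| + `|s'| + `|s - r|.
have [] := @step_free S (a - a') (b - b').
- by apply: (filB FF); [apply: (fil_le FF) Fa | apply: (fil_le FF) Fa']; lia.
- by apply: (filB FF); [apply: (fil_le FF) Fb | apply: (fil_le FF) Fb']; lia.
- by rewrite mulrBl addrACA -opprD -e subrr.
by move/subr0_eq => -> /subr0_eq ->.
Qed.

Lemma step_filF s a : F s a -> G s a.
Proof. by move=> Fa; exists a, 0; rewrite mul0r addr0; split=> //; apply: (fil0 FF). Qed.

Lemma step_filF_inv s s' a : F s' a -> G s a -> F s a.
Proof.
move=> Fa Ga; have [] // := @step_fil_inv s `|s'| a 0; first by apply: (fil_le FF) Fa; lia.
  exact: (fil0 FF).
by rewrite mul0r addr0.
Qed.

Lemma step_exactF s a : exact F s a -> exact G s a.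
Proof.
move=> [Fa na]; split; first exact: step_filF.
by move=> h; apply: na; apply: (step_filF_inv Fa h).
Qed.

Lemma step_fil_gen s b : F (s - r) b -> G s (b * y).
Proof. by move=> Fb; exists 0, b; rewrite add0r; split=> //; apply: (fil0 FF). Qed.

Lemma step_exact_gen s b : exact F (s - r) b -> exact G s (b * y).
Proof.
move=> [Fb nb]; split; first exact: step_fil_gen.
move=> h; apply: nb; have [] := @step_fil_inv (s - 1) (s - r) 0 b.
- exact: (fil0 FF).
- by [].
- by rewrite add0r.
by move=> _; apply: (fil_le FF); lia.
Qed.

Lemma step_filtered : filtered G.
Proof.
split.
- by move=> z; apply/step_filF/(fil0 FF).
- move=> z _ _ [a [b [Fa Fb ->]]] [a' [b' [Fa' Fb' ->]]].
  exists (a - a'), (b - b'); split; [exact: (filB FF) | exact: (filB FF) | ring].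
- move=> z z' _ zz' [a [b [Fa Fb ->]]]; exists a, b; split=> //.
    exact: (fil_le FF) Fa.
  by apply: (fil_le FF) Fb; lia.
- exact/step_filF/(fil1 FF).
move=> z z' _ _ [a [b [Fa Fb ->]]] [a' [b' [Fa' Fb' ->]]].
exists (a * a' + b * b' * g), (a * b' + a' * b + b * b'); split.
- apply: (filD FF); first exact: (filM FF).
  rewrite (_ : z + z' = (z - r) + (z' - r) + (r + r)); last by lia.
  by apply: (filM FF); [exact: (filM FF) | exact: eg.1].
- apply: (filD FF); [apply: (filD FF)|].
  + by rewrite -addrA; apply: (filM FF).
  + by rewrite (_ : _ - r = z' + (z - r)); [apply: (filM FF) | lia].
  + by apply: (fil_le FF) (filM FF Fb Fb'); lia.
apply: (eq_char2 ch (c := - (b * b' * y))); rewrite /g; ring.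
Qed.

(** The norm of a + b y, the conjugate of y being y + 1. *)
Definition step_norm (a b : L) := a ^+ 2 + a * b + b ^+ 2 * g.

Lemma step_normE a b : step_norm a b = (a + b * y) * (a + b + b * y).
Proof.
apply: (eq_char2 ch (c := - (a * b * y))); rewrite /step_norm /g; ring.
Qed.

Lemma step_norm_fil s a b : F s a -> F (s - r) b -> F (s + s) (step_norm a b).
Proof.
move=> Fa Fb; apply: (filD FF); first apply: (filD FF).
- by rewrite expr2; apply: (filM FF).
- by apply: (fil_le FF) (filM FF Fa Fb); lia.
rewrite expr2 (_ : s + s = (s - r) + (s - r) + (r + r)); last by lia.
by apply: (filM FF); [exact: (filM FF) | exact: eg.1].
Qed.

(* the orders of a and of b y have different parities in units of u *)
Lemma step_exact_cases s a b : F s a -> F (s - r) b -> exact G s (a + b * y) ->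
  (exact F s a /\ F (s - r - 1) b) \/ (F (s - 1) a /\ exact F (s - r) b).
Proof.
move=> Fa Fb [_ ne]; case: (exact_or Fa) => [ea|Fa1].
  left; split=> //; apply: (fil_lt V Fb) => t et.
  by have [m em] := exact_unit V ea; have := @step_parity m t; lia.
right; split=> //; split=> // Fb1; apply: ne; exists a, b; split=> //.
by rewrite (_ : s - 1 - r = s - r - 1) //; lia.
Qed.

Lemma step_norm_exact s a b : F s a -> F (s - r) b -> exact G s (a + b * y) ->
  exact F (s + s) (step_norm a b).
Proof.
move=> Fa Fb eab; case: (step_exact_cases Fa Fb eab) => [[ea Fb1]|[Fa1 eb]].
  rewrite /step_norm -addrA; apply: (exactD V (exactX2 V ea)); apply: (filD FF).
    by apply: (fil_le FF) (filM FF Fa Fb1); lia.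
  by rewrite expr2; apply: (fil_le FF) (filM FF (filM FF Fb1 Fb1) eg.1); lia.
rewrite /step_norm [X in exact _ _ X]addrC (_ : s + s = (s - r) + (s - r) + (r + r)); last by lia.
apply: (exactD V (valM V (exactX2 V eb) eg)).
apply: (filD FF); first by rewrite expr2; apply: (fil_le FF) (filM FF Fa1 Fa1); lia.
by apply: (fil_le FF) (filM FF Fa1 Fb); lia.
Qed.

(** The norm doubles orders and is multiplicative, so a product of too small an order would have a
    norm of too small an order in the subfield, where orders are known to add. *)
Lemma step_valM z z' f f' : exact G z f -> exact G z' f' -> exact G (z + z') (f * f').
Proof.
move=> ef ef'; split; first exact: (filM step_filtered ef.1 ef'.1).
case: (ef.1) => a [b [Fa Fb e]]; case: (ef'.1) => a' [b' [Fa' Fb' e']].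
rewrite {}e in ef *; rewrite {}e' in ef' *.
have en := step_norm_exact Fa Fb ef; have en' := step_norm_exact Fa' Fb' ef'.
move=> [a2 [b2 [Fa2 Fb2 e2]]].
have F2 := step_norm_fil Fa2 Fb2.
have eN : step_norm a2 b2 = step_norm a b * step_norm a' b'.
  have [] := @step_free (`|z + z'| + `|z| + `|z'| + `|r|) (a2 - (a * a' + b * b' * g)) (b2 - (a * b' + a' * b + b * b')).
  - apply: (filB FF); first by apply: (fil_le FF) Fa2; lia.
    apply: (filD FF); first by apply: (fil_le FF) (filM FF Fa Fa'); lia.
    by apply: (fil_le FF) (filM FF (filM FF Fb Fb') eg.1); lia.
  - apply: (filB FF); first by apply: (fil_le FF) Fb2; lia.
    apply: (filD FF); [apply: (filD FF)|].
    + by apply: (fil_le FF) (filM FF Fa Fb'); lia.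
    + by apply: (fil_le FF) (filM FF Fa' Fb); lia.
    + by apply: (fil_le FF) (filM FF Fb Fb'); lia.
  - rewrite mulrBl addrACA -opprD -e2; apply: (eq_char2 ch (c := - (b * b' * y))).
    by rewrite /g; ring.
  move/subr0_eq => -> /subr0_eq ->.
  apply: (eq_char2 ch (c := g * (a * a' * (b * b') + a * a' * (b * b') + b * b * (b' * b')
    + a * b * (b' * b') + a' * b' * (b * b)))).
  rewrite /step_norm; move: g => g'; ring.
rewrite eN in F2; have := exact_le V (valM V en en') F2; lia.
Qed.

Lemma step_valE z f : G z f -> f <> 0 -> exists s, s * u <= z /\ exact G (s * u) f.
Proof.
move=> [a [b [Fa Fb ->]]] f0.
have Hb : b <> 0 -> exists s, s * u <= z /\ exact G (s * u) (b * y).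
  move=> b0; have [t [tz et]] := valE V Fb b0.
  exists (2 * t + (2 * o + 1)).
  have e : t * (2 * u) = (2 * t + (2 * o + 1)) * u - r by rewrite /r; ring.
  by split; [lia | apply: step_exact_gen; rewrite -e].
have Ha : a <> 0 -> exists s, s * u <= z /\ exact G (s * u) a /\ exists t, s * u = t * (2 * u).
  move=> a0; have [t [tz et]] := valE V Fa a0.
  have e : t * (2 * u) = (2 * t) * u by ring.
  exists (2 * t); rewrite -e; split=> //; split; last by exists t.
  exact: step_exactF.
have [a0|/eqP a0] := eqVneq a 0.
  by move: f0; rewrite a0 add0r => f0; apply: Hb => b0; apply: f0; rewrite b0 mul0r.
have [b0|/eqP b0] := eqVneq b 0.
  by rewrite b0 mul0r addr0; have [s [sz [es _]]] := Ha a0; exists s.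
have [s [sz [es [t et]]]] := Ha a0; have [s' [sz' es']] := Hb b0.
have exD w c d : exact G w c -> G (w - 1) d -> exact G w (c + d).
  move=> [Gc nc] Gd; split; first by apply: (filD step_filtered) => //; apply: (fil_le step_filtered) Gd; lia.
  by move=> h; apply: nc; rewrite -(addrK d c); apply: (filB step_filtered).
have [lt|lt|e] := ltgtP (s * u) (s' * u).
- exists s'; split=> //; rewrite addrC; apply: exD => //.
  by apply: (fil_le step_filtered) es.1; lia.
- exists s; split=> //; apply: exD => //.
  by apply: (fil_le step_filtered) es'.1; lia.
have [b1 [b1z eb1]] : exists t', t' * (2 * u) <= s' * u - r /\ exact F (t' * (2 * u)) b.
  have Fb' : F (s' * u - r) b.
    have [] := @step_fil_inv (s' * u) (z - r) 0 b (fil0 FF _) Fb; first by rewrite add0r; exact: es'.1.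
    by [].
  exact (valE V Fb' b0).
have : exact G (b1 * (2 * u) + r) (b * y).
  by apply: step_exact_gen; rewrite addrK.
move=> e1; have : s' * u = b1 * (2 * u) + r.
  have le1 : b1 * (2 * u) + r <= s' * u by lia.
  apply/eqP; rewrite eq_le le1 andbT leNgt; apply/negP => lt.
  by apply: es'.2; apply: (fil_le step_filtered) e1.1; lia.
by have := @step_parity t b1; lia.
Qed.

Lemma step_valV z f : G z f -> exists z', G z' f^-1.
Proof.
move=> [a [b [Fa Fb e]]]; have [->|f0] := eqVneq f 0.
  by exists 0; rewrite invr0; apply: (fil0 step_filtered).
have FN := step_norm_fil Fa Fb.
have nf : f * (a + b + b * y) = step_norm a b by rewrite step_normE e.
have [c0|c0] := eqVneq (a + b + b * y) 0.
  have [] := @step_free (`|z| + `|z - r|) (a + b) b => //.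
  - by apply: (filD FF); [apply: (fil_le FF) Fa | apply: (fil_le FF) Fb]; lia.
  - by apply: (fil_le FF) Fb; lia.
  move=> ab b0; move: f0; rewrite e b0 mul0r addr0.
  by rewrite b0 addr0 in ab; rewrite ab eqxx.
have N0 : step_norm a b != 0 by rewrite -nf mulf_neq0.
have [w Fw] := valV V FN.
have -> : f^-1 = (a + b) * (step_norm a b)^-1 + (b * (step_norm a b)^-1) * y.
  rewrite mulrAC -mulrDl -nf invfM mulrCA mulfV ?mulr1 //.
exists (`|z| + `|z - r| + `|w| + `|r|), ((a + b) * (step_norm a b)^-1), (b * (step_norm a b)^-1); split=> //.
  rewrite mulrDl; apply: (filD FF).
    by apply: (fil_le FF) (filM FF Fa Fw); lia.
  by apply: (fil_le FF) (filM FF Fb Fw); lia.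
by apply: (fil_le FF) (filM FF Fb Fw); lia.
Qed.

(** The parity of the order tells which of the two coordinates carries it; it is the same one for
    both elements, so the constant comes from the subfield. *)
Lemma step_val_res z f f' : exact G z f -> exact G z f' ->
  exists c, G (z - 1) (f - ev c%:P * f').
Proof.
move=> ef ef'; case: (ef.1) => a [b [Fa Fb e]]; case: (ef'.1) => a' [b' [Fa' Fb' e']].
rewrite {}e in ef *; rewrite {}e' in ef' *.
have key c : a + b * y - ev c%:P * (a' + b' * y) =
    (a - ev c%:P * a') + (b - ev c%:P * b') * y by ring.
have Fc c w d : F w d -> F w (ev c%:P * d).
  by move=> Fd; rewrite -(add0r w); apply: (filM FF) => //; apply: (val_const V).
case: (step_exact_cases Fa Fb ef) => [[ea Fb1]|[Fa1 eb]];
  case: (step_exact_cases Fa' Fb' ef') => [[ea' Fb1']|[Fa1' eb']].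
- have [c Fc1] := val_res V ea ea'; exists c; rewrite key.
  exists (a - ev c%:P * a'), (b - ev c%:P * b'); split=> //.
  rewrite (_ : z - 1 - r = z - r - 1); last by lia.
  by apply: (filB FF) => //; apply: Fc.
- have [t et] := exact_unit V ea; have [t' et'] := exact_unit V eb'.
  by have := @step_parity t t'; lia.
- have [t et] := exact_unit V ea'; have [t' et'] := exact_unit V eb.
  by have := @step_parity t t'; lia.
have [c Fc1] := val_res V eb eb'; exists c; rewrite key.
exists (a - ev c%:P * a'), (b - ev c%:P * b'); split=> //.
  by apply: (filB FF) => //; apply: Fc.
by rewrite (_ : z - 1 - r = z - r - 1) //; lia.
Qed.

Lemma step_valued : valued ev u G.
Proof.
split.
- exact: step_filtered.
- exact: u0.
- by move=> c; apply/step_filF/(val_const V).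
- by move=> h; apply: (val1 V); apply: step_filF_inv (fil1 FF) h.
- exact: step_valM.
- exact: step_valE.
- exact: step_valV.
- exact: step_val_res.
Qed.
End Step.

(** * The order at infinity on the rational function field *)

Section RationalFunctions.
Variables (k L : fieldType) (ev : {rmorphism {poly k} -> L}) (Q : int).
Hypothesis ev_inj : forall p : {poly k}, ev p = 0 -> p = 0.
Hypothesis Q0 : 0 < Q.

Lemma size_mulS (p q : {poly k}) : p != 0 -> q != 0 ->
  [/\ (0 < size p)%N, (0 < size q)%N & (size (p * q)%R).+1 = (size p + size q)%N].
Proof.
move=> p0 q0; rewrite size_mul // !size_poly_gt0; split=> //.
by rewrite -size_poly_gt0 in p0; rewrite prednK // addn_gt0 p0.
Qed.

(** [size] exceeds the degree by one, which cancels in the difference; p = 0 is set apart, its order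
    being minus infinity. *)
Definition rat_fil (z : int) (f : L) : Prop :=
  exists p q : {poly k}, [/\ q != 0, f * ev q = ev p
    & p = 0 \/ Q * ((size p)%:Z - (size q)%:Z) <= z].

Lemma ev_neq0 (p : {poly k}) : p != 0 -> ev p != 0.
Proof. by apply: contraNneq => /ev_inj ->. Qed.

Lemma rat_filE (p q : {poly k}) (f : L) (z : int) : q != 0 -> p != 0 -> f * ev q = ev p ->
  rat_fil z f <-> Q * ((size p)%:Z - (size q)%:Z) <= z.
Proof.
move=> q0 p0 e; split=> [[p' [q' [q'0 e' h]]]|h]; last by exists p, q; split=> //; right.
have ee : p * q' = p' * q.
  apply/eqP; rewrite -subr_eq0; apply/eqP/ev_inj.
  by rewrite rmorphB !rmorphM -e -e' mulrAC subrr.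
have p'0 : p' != 0.
  by apply: contraNneq (mulf_neq0 p0 q'0) => p'0; rewrite ee p'0 mul0r.
case: h => [p'z|]; first by rewrite p'z eqxx in p'0.
have [h1 h2 h3] := size_mulS p0 q'0; have [h4 h5 h6] := size_mulS p'0 q0.
rewrite ee in h3.
have -> : (size p')%:Z - (size q')%:Z = (size p)%:Z - (size q)%:Z by lia.
by [].
Qed.

Lemma rat_fil_exact (p q : {poly k}) (f : L) (z : int) : q != 0 -> p != 0 -> f * ev q = ev p ->
  exact rat_fil z f <-> z = Q * ((size p)%:Z - (size q)%:Z).
Proof.
move=> q0 p0 e; rewrite /exact !(rat_filE _ q0 p0 e); split; first by case=> h /negP; lia.
by move=> ->; split=> //; apply/negP; lia.
Qed.

Lemma rat_rep z f : rat_fil z f -> f <> 0 ->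
  exists p q : {poly k}, [/\ q != 0, p != 0 & f * ev q = ev p].
Proof.
move=> [p [q [q0 e _]]] f0; exists p, q; split=> //; apply: contra_notN f0 => /eqP p0.
by move/eqP: e; rewrite p0 rmorph0 mulf_eq0 (negbTE (ev_neq0 q0)) orbF => /eqP.
Qed.

Lemma rat_filtered : filtered rat_fil.
Proof.
split.
- by move=> z; exists 0, 1; rewrite mul0r rmorph0 oner_eq0; split=> //; left.
- move=> z f f' [p [q [q0 e h]]] [p' [q' [q'0 e' h']]].
  have E : (f - f') * ev (q * q') = ev (p * q' - p' * q).
    by rewrite rmorphB !rmorphM -e -e'; ring.
  exists (p * q' - p' * q), (q * q'); split; rewrite ?mulf_neq0 //.
  have [->|n0] := eqVneq (p * q' - p' * q) 0; [by left | right].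
  have s1 : (size (p * q' - p' * q)%R <= maxn (size (p * q')%R) (size (p' * q)%R))%N.
    by have := size_polyD (p * q') (- (p' * q)); rewrite size_polyN.
  have [g1 g2 g3] := size_mulS q0 q'0.
  rewrite -size_poly_gt0 in n0; move: s1 n0; move: (size (p * q' - p' * q)%R) => s s1 n0.
  have H1 : (p * q' = 0) \/ Q * ((size (p * q'))%:Z - (size (q * q'))%:Z) <= z.
    have [->|p0] := eqVneq p 0; first by rewrite mul0r; left.
    case: h => [hp|h]; first by rewrite hp eqxx in p0.
    right; have [h1 h2 h3] := size_mulS p0 q'0.
    by have -> : (size (p * q')%R)%:Z - (size (q * q')%R)%:Z = (size p)%:Z - (size q)%:Z by lia.
  have H2 : (p' * q = 0) \/ Q * ((size (p' * q))%:Z - (size (q * q'))%:Z) <= z.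
    have [->|p0] := eqVneq p' 0; first by rewrite mul0r; left.
    case: h' => [hp|h']; first by rewrite hp eqxx in p0.
    right; have [h1 h2 h3] := size_mulS p0 q0.
    by have -> : (size (p' * q)%R)%:Z - (size (q * q')%R)%:Z = (size p')%:Z - (size q')%:Z by lia.
  move: s1; rewrite leq_max => /orP[] ss.
    case: H1 => [H1|H1]; first by rewrite H1 size_poly0 in ss; lia.
    by apply: le_trans H1; apply: ler_wpM2l; [exact: ltW | lia].
  case: H2 => [H2|H2]; first by rewrite H2 size_poly0 in ss; lia.
  by apply: le_trans H2; apply: ler_wpM2l; [exact: ltW | lia].
- move=> z z' f zz' [p [q [q0 e h]]]; exists p, q; split=> //.
  by case: h => h; [left | right; exact: le_trans h zz'].
- by exists 1, 1; rewrite mul1r oner_eq0; split=> //; right; rewrite subrr mulr0.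
move=> z z' f f' [p [q [q0 e h]]] [p' [q' [q'0 e' h']]].
exists (p * p'), (q * q'); rewrite mulf_neq0 // !rmorphM -e -e'; split=> //; first by ring.
have [->|p0] := eqVneq p 0; first by rewrite mul0r; left.
have [->|p'0] := eqVneq p' 0; first by rewrite mulr0; left.
case: h => [hp|h]; first by rewrite hp eqxx in p0.
case: h' => [hp|h']; first by rewrite hp eqxx in p'0.
right; have [h1 h2 h3] := size_mulS p0 p'0; have [h4 h5 h6] := size_mulS q0 q'0.
by apply: le_trans (lerD h h'); rewrite -mulrDr; apply: ler_wpM2l; [exact: ltW | lia].
Qed.

Lemma rat_valued : valued ev Q rat_fil.
Proof.
split=> //.
- exact: rat_filtered.
- move=> c; exists c%:P, 1; rewrite oner_eq0 rmorph1 mulr1; split=> //.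
  have [->|c0] := eqVneq c 0; [by left | right].
  by rewrite size_polyC c0 size_poly1 subrr mulr0.
- have E : (1 : L) * ev 1 = ev 1 by rewrite mul1r.
  by rewrite (rat_filE _ _ _ E) ?oner_eq0 // subrr mulr0.
- move=> z z' f f' ef ef'.
  have nz w g : exact rat_fil w g -> g <> 0.
    by case=> _ h g0; apply: h; rewrite g0; apply: (fil0 rat_filtered).
  have [p [q [q0 p0 e]]] := rat_rep ef.1 (nz _ _ ef).
  have [p' [q' [q'0 p'0 e']]] := rat_rep ef'.1 (nz _ _ ef').
  have E : f * f' * ev (q * q') = ev (p * p') by rewrite !rmorphM -e -e'; ring.
  move: ef ef'; rewrite (rat_fil_exact _ q0 p0 e) (rat_fil_exact _ q'0 p'0 e').
  rewrite (rat_fil_exact _ _ _ E) ?mulf_neq0 // => -> ->; rewrite -mulrDr.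
  have [h1 h2 h3] := size_mulS p0 p'0; have [h4 h5 h6] := size_mulS q0 q'0.
  by congr (_ * _); lia.
- move=> z f Ff f0; have [p [q [q0 p0 e]]] := rat_rep Ff f0.
  exists ((size p)%:Z - (size q)%:Z).
  rewrite (rat_fil_exact _ q0 p0 e) mulrC; split=> //.
  exact/(rat_filE _ q0 p0 e).
- move=> z f Ff; have [->|/eqP f0] := eqVneq f 0.
    by exists 0; rewrite invr0; apply: (fil0 rat_filtered).
  have [p [q [q0 p0 e]]] := rat_rep Ff f0.
  exists (Q * ((size q)%:Z - (size p)%:Z)), q, p; split=> //; last by right.
  by rewrite -e mulrA mulVf ?mul1r //; apply/eqP.
move=> z f f' ef ef'.
have nz w g : exact rat_fil w g -> g <> 0.
  by case=> _ h g0; apply: h; rewrite g0; apply: (fil0 rat_filtered).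
have [p [q [q0 p0 e]]] := rat_rep ef.1 (nz _ _ ef).
have [p' [q' [q'0 p'0 e']]] := rat_rep ef'.1 (nz _ _ ef').
move: ef ef'; rewrite (rat_fil_exact _ q0 p0 e) (rat_fil_exact _ q'0 p'0 e') => ez ez'.
have es : (size p)%:Z - (size q)%:Z = (size p')%:Z - (size q')%:Z.
  by apply: (mulfI (lt0r_neq0 Q0)); rewrite -ez -ez'.
(* Over the common denominator q q', this constant cancels the top coefficients of the two
   numerators. *)
pose c := lead_coef (p * q') / lead_coef (p' * q).
have l0 : lead_coef (p' * q) != 0 by rewrite lead_coef_eq0 mulf_neq0.
have c0 : c != 0 by rewrite mulf_neq0 ?invr_eq0 // lead_coef_eq0 mulf_neq0.
exists c, (p * q' - c%:P * (p' * q)), (q * q'); rewrite mulf_neq0 //; split=> //.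
  by rewrite rmorphB !rmorphM -e -e'; ring.
right; have ss : size (p * q') = size (p' * q).
  have [h1 h2 h3] := size_mulS p0 q'0; have [h4 h5 h6] := size_mulS p'0 q0; lia.
have : (size (p * q' - c%:P * (p' * q))%R < size (p * q')%R)%N.
  have n0 : (0 < size (p * q')%R)%N by rewrite size_poly_gt0 mulf_neq0.
  rewrite -(prednK n0) ltnS; apply/leq_sizeP => j jn.
  rewrite coefB coefCM; move: jn; rewrite leq_eqVlt => /orP[/eqP <-|jn].
    by rewrite {2}ss -!lead_coefE /c mulfVK // subrr.
  by rewrite !nth_default ?mulr0 ?subrr // -?ss -(prednK n0).
have [h1 h2 h3] := size_mulS p0 q'0; have [h4 h5 h6] := size_mulS q0 q'0.
move=> hlt; rewrite ez; move: hlt; move: (size (p * q' - c%:P * (p' * q))%R) => s lt.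
have : Q * (s%:Z - (size (q * q')%R)%:Z) <= Q * ((size p)%:Z - (size q)%:Z - 1).
  by apply: ler_wpM2l; [exact: ltW | lia].
move=> h; apply: (le_trans h); rewrite mulrBr mulr1.
by rewrite lerD2l lerN2; lia.
Qed.
End RationalFunctions.

(** * Decompositions al^2 + x be^2 and the order of the derivative with respect to x *)

Section SquareDecomposition.
Variables (k L : fieldType) (ev : {rmorphism {poly k} -> L}) (u delta : int).
Variables (F : int -> L -> Prop).
Hypothesis ch : 2%N \in [pchar L].
Hypothesis V : valued ev u F.
Let FF := val_fil V.
Let x := ev 'X.
Hypothesis sqF : forall z a, F z a ->
  exists s al be, [/\ F s al, F s be & a = al ^+ 2 + x * be ^+ 2].
(** One element of odd order whose derivative be^2 has known order suffices: [delta] is then the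
    shift of orders under d/dx for all elements of odd order. *)
Hypothesis odd_gen : exists p al be s m, [/\ exact F ((2 * m + 1) * u) p,
  F s al, F s be, p = al ^+ 2 + x * be ^+ 2
  & exact F ((2 * m + 1) * u + delta) (be ^+ 2)].

Let u0 := val_gt0 V.

Lemma odd_not_square z a m : F z a -> ~ exact F ((2 * m + 1) * u) (a ^+ 2).
Proof.
move=> Fa e; have a0 : a <> 0.
  by move=> a0; apply: (exact_neq0 V e); rewrite a0 expr0n.
have [s [_ es]] := valE V Fa a0.
have := exact_uniq V e (exactX2 V es) => e2.
have : u * (2 * (s - m) - 1) = 0 by lia.
by move/eqP; rewrite mulf_eq0; lia.
Qed.

(** A nontrivial relation would make x a square, hence also p = al0^2 + x be0^2, whose order is
    odd. *)
Lemma sq_free s al be : F s al -> F s be -> al ^+ 2 + x * be ^+ 2 = 0 ->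
  al = 0 /\ be = 0.
Proof.
move=> Fal Fbe e; have [b0|b0] := eqVneq be 0.
  move: e; rewrite b0 expr0n mulr0 addr0 => /eqP.
  by rewrite sqrf_eq0 => /eqP.
have [p [al0 [be0 [s0 [m [ep Fa0 Fb0 e0 _]]]]]] := odd_gen.
have ex : x = (al / be) ^+ 2.
  rewrite expr_div_n; apply: (mulIf (expf_neq0 2 b0)); rewrite mulfVK ?expf_neq0 //.
  by apply/eqP; rewrite -subr_eq0 (oppr2 ch) addrC e.
have [w Fw] := fil_divr V Fal Fbe.
exfalso; apply: (@odd_not_square (`|s0| + `|w| + `|s0 + w|) (al0 + be0 * (al / be)) m).
  apply: (filD FF); first by apply: (fil_le FF) Fa0; lia.
  by apply: (fil_le FF) (filM FF Fb0 Fw); lia.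
have -> : (al0 + be0 * (al / be)) ^+ 2 = p.
  rewrite e0 ex; apply: (eq_char2 ch (c := al0 * (be0 * (al / be)))); ring.
exact: ep.
Qed.

Lemma odd_decomp p m z a : exact F ((2 * m + 1) * u) p -> F z a ->
  exists s al be, [/\ F s al, F s be & a = al ^+ 2 + p * be ^+ 2].
Proof.
move=> ep Fa; have [s [al [be [Fal Fbe e]]]] := sqF Fa.
have [s0 [al0 [be0 [Fa0 Fb0 e0]]]] := sqF ep.1.
have b0 : be0 != 0.
  apply/eqP => b0; apply: (odd_not_square (m := m) Fa0).
  by move: e0; rewrite b0 expr0n mulr0 addr0 => <-.
have [w Fw] := fil_divr V Fbe Fb0.
(* Obtained by substituting x = (p - al0^2) / be0^2 in al^2 + x be^2: an element of odd order can
   replace x. *)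
exists (`|s| + `|w| + `|s0| + `|s0 + w|), (al + al0 * (be / be0)), (be / be0); split.
- apply: (filD FF); first by apply: (fil_le FF) Fal; lia.
  by apply: (fil_le FF) (filM FF Fa0 Fw); lia.
- by apply: (fil_le FF) Fw; lia.
have e1 : be = (be / be0) * be0 by rewrite mulfVK.
rewrite e e0 {1}e1; move: (be / be0) => c.
apply: (eq_char2 ch (c := - (al * (al0 * c) + (al0 * c) ^+ 2))); ring.
Qed.

(* no cancellation: the two terms have orders of different parity *)
Lemma odd_decomp_fil p m t s al be : exact F ((2 * m + 1) * u) p ->
  F s al -> F s be -> F t (al ^+ 2 + p * be ^+ 2) ->
  F t (al ^+ 2) /\ F t (p * be ^+ 2).
Proof.
move=> ep Fal Fbe Ft; have [a0|/eqP a0] := eqVneq al 0.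
  by move: Ft; rewrite a0 expr0n add0r; split=> //; apply: (fil0 FF).
have [b0|/eqP b0] := eqVneq be 0.
  by move: Ft; rewrite b0 expr0n mulr0 addr0; split=> //; apply: (fil0 FF).
have [i [_ ei]] := valE V Fal a0; have [j [_ ej]] := valE V Fbe b0.
have ea := exactX2 V ei; have eb := valM V ep (exactX2 V ej).
have [h|h|h] := ltgtP (i * u + i * u) ((2 * m + 1) * u + (j * u + j * u)).
- have et : exact F ((2 * m + 1) * u + (j * u + j * u)) (al ^+ 2 + p * be ^+ 2).
    by rewrite [X in exact _ _ X]addrC; apply: (exactD V eb); apply: (fil_le FF) ea.1; lia.
  have := exact_le V et Ft.
  by split; [apply: (fil_le FF) ea.1 | apply: (fil_le FF) eb.1]; lia.
- have et : exact F (i * u + i * u) (al ^+ 2 + p * be ^+ 2).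
    by apply: (exactD V ea); apply: (fil_le FF) eb.1; lia.
  have := exact_le V et Ft.
  by split; [apply: (fil_le FF) ea.1 | apply: (fil_le FF) eb.1]; lia.
have : u * (2 * (i - m - j) - 1) = 0 by lia.
by move/eqP; rewrite mulf_eq0; lia.
Qed.

(* be ^+ 2 is the derivative of al ^+ 2 + x * be ^+ 2 with respect to x *)
Lemma sq_deriv_fil t s al be : F s al -> F s be -> F t (al ^+ 2 + x * be ^+ 2) ->
  F (t + delta) (be ^+ 2).
Proof.
move=> Fal Fbe Ft; have [p [al0 [be0 [s0 [m [ep Fa0 Fb0 e0 ed]]]]]] := odd_gen.
have [s1 [al1 [be1 [Fal1 Fbe1 e1]]]] := odd_decomp ep Ft.
have [] := @sq_free (`|s| + `|s1| + `|s0| + `|s0 + s1|) (al + (al1 + al0 * be1)) (be + be0 * be1).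
- apply: (filD FF); first by apply: (fil_le FF) Fal; lia.
  apply: (filD FF); first by apply: (fil_le FF) Fal1; lia.
  by apply: (fil_le FF) (filM FF Fa0 Fbe1); lia.
- apply: (filD FF); first by apply: (fil_le FF) Fbe; lia.
  by apply: (fil_le FF) (filM FF Fb0 Fbe1); lia.
- rewrite e0 in e1.
  have -> : (al + (al1 + al0 * be1)) ^+ 2 + x * (be + be0 * be1) ^+ 2 =
    (al ^+ 2 + x * be ^+ 2) + (al1 ^+ 2 + (al0 ^+ 2 + x * be0 ^+ 2) * be1 ^+ 2) +
    ((al * (al1 + al0 * be1) + al1 * al0 * be1 + x * be * be0 * be1) +
     (al * (al1 + al0 * be1) + al1 * al0 * be1 + x * be * be0 * be1)) by ring.
  by rewrite -e1 !(addrr2 ch).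
move=> _ /eqP; rewrite addr_eq0 (oppr2 ch) => /eqP ->.
rewrite e1 in Ft; have [_ Fb] := odd_decomp_fil ep Fal1 Fbe1 Ft.
have [->|/eqP b0] := eqVneq be1 0; first by rewrite mulr0 expr0n; apply: (fil0 FF).
have [j [_ ej]] := valE V Fbe1 b0; have eb := valM V ep (exactX2 V ej).
have := exact_le V eb Fb => h.
by rewrite exprMn; apply: (fil_le FF) (valM V ed (exactX2 V ej)).1; lia.
Qed.

(** Both the given element and the reference p have odd order. Writing p = al2^2 + b be2^2 over the
    given b, the derivative of p is be2^2 times that of b, so too small an order for the latter
    would contradict the exact order known for p. *)
Lemma sq_deriv_exact m s al be : F s al -> F s be ->
  exact F ((2 * m + 1) * u) (al ^+ 2 + x * be ^+ 2) ->
  exact F ((2 * m + 1) * u + delta) (be ^+ 2).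
Proof.
move=> Fal Fbe eb; split; first exact: (sq_deriv_fil Fal Fbe eb.1).
move=> Fb1; have [p [al0 [be0 [s0 [m0 [ep Fa0 Fb0 e0 ed]]]]]] := odd_gen.
have [w [al1 [be1 [Fal1 Fbe1 e1]]]] := odd_decomp eb Fb0.
have [w' [al2 [be2 [Fal2 Fbe2 e2]]]] := odd_decomp eb ep.1.
have [] := @sq_free (`|s0| + `|w'| + `|s + w'|) (al0 + (al2 + al * be2)) (be0 + be * be2).
- apply: (filD FF); first by apply: (fil_le FF) Fa0; lia.
  apply: (filD FF); first by apply: (fil_le FF) Fal2; lia.
  by apply: (fil_le FF) (filM FF Fal Fbe2); lia.
- apply: (filD FF); first by apply: (fil_le FF) Fb0; lia.
  by apply: (fil_le FF) (filM FF Fbe Fbe2); lia.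
- have -> : (al0 + (al2 + al * be2)) ^+ 2 + x * (be0 + be * be2) ^+ 2 =
    (al0 ^+ 2 + x * be0 ^+ 2) + (al2 ^+ 2 + (al ^+ 2 + x * be ^+ 2) * be2 ^+ 2) +
    ((al0 * (al2 + al * be2) + al2 * al * be2 + x * be0 * be * be2) +
     (al0 * (al2 + al * be2) + al2 * al * be2 + x * be0 * be * be2)) by ring.
  by rewrite -e0 -e2 !(addrr2 ch).
move=> _ /eqP; rewrite addr_eq0 (oppr2 ch) => /eqP eb0.
have Fe := ep.1; rewrite e2 in Fe.
have [_ Fb2] := odd_decomp_fil eb Fal2 Fbe2 Fe.
have b20 : be2 <> 0.
  by move=> b0; move: (exact_neq0 V ed); rewrite eb0 b0 mulr0 expr0n.
have [j [_ ej]] := valE V Fbe2 b20.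
have := exact_le V (valM V eb (exactX2 V ej)) Fb2 => h.
have : F ((2 * m + 1) * u + delta - 1 + (j * u + j * u)) (be0 ^+ 2).
  by rewrite eb0 exprMn; apply: (filM FF) => //; exact: (exactX2 V ej).1.
by move/(exact_le V ed); lia.
Qed.
End SquareDecomposition.

(** * The affine rings of the tower and approximation by regular functions *)

Section Tower.
Variables (k L : fieldType) (ev : {rmorphism {poly k} -> L}) (Q : int).
Hypothesis ch : 2%N \in [pchar L].
Hypothesis perf : forall c : k, exists b, c = b ^+ 2.
Hypothesis ev_inj : forall p : {poly k}, ev p = 0 -> p = 0.
Hypothesis Q0 : 0 < Q.
Local Notation x := (ev 'X).

(* [tower u c F R]: F filters by pole order at infinity the field of a layer X_j
   and R is its affine ring.  Orders are scaled so that x has order Q; they are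
   multiples of u, and c - Q is 2 g - 1 for the genus g, in units of u. *)
Inductive tower : int -> int -> (int -> L -> Prop) -> (L -> Prop) -> Prop :=
| tower0 : tower Q 0 (rat_fil ev Q) (fun f => exists p, f = ev p)
| towerS u c o F R y : tower (2 * u) c F R -> 0 <= o -> R (y ^+ 2 + y) ->
    exact F (u * (2 * o + 1) + u * (2 * o + 1)) (y ^+ 2 + y) ->
    tower u (c + u * (2 * o + 1)) (step_fil (u * (2 * o + 1)) y F)
      (fun f => exists a b, [/\ R a, R b & f = a + b * y]).

Lemma tower_valued u c F R : tower u c F R -> valued ev u F.
Proof.
elim=> [|{}u {}c o {}F {}R y _ V o0 _ eg]; first exact: rat_valued.
exact: step_valued.
Qed.

Record ring_pred (R : L -> Prop) : Prop := RingPred {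
  rp_ev : forall p, R (ev p);
  rpB : forall a b, R a -> R b -> R (a - b);
  rpM : forall a b, R a -> R b -> R (a * b) }.

Section RingPred.
Variables (R : L -> Prop) (RR : ring_pred R).
Lemma rp0 : R 0. Proof. by rewrite -(rmorph0 ev); apply: (rp_ev RR). Qed.
Lemma rp1 : R 1. Proof. by rewrite -(rmorph1 ev); apply: (rp_ev RR). Qed.
Lemma rpD a b : R a -> R b -> R (a + b).
Proof. by move=> Ra Rb; rewrite -[b](oppr2 ch); apply: (rpB RR). Qed.
End RingPred.

Lemma tower_ring u c F R : tower u c F R -> ring_pred R.
Proof.
elim=> [|{}u {}c o {}F {}R y _ RR _ Rg _].
  split=> [p|_ _ [p ->] [q ->]|_ _ [p ->] [q ->]]; first by exists p.
    by exists (p - q); rewrite rmorphB.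
  by exists (p * q); rewrite rmorphM.
split=> [p|_ _ [a [b [Ra Rb ->]]] [a' [b' [Ra' Rb' ->]]]|_ _ [a [b [Ra Rb ->]]] [a' [b' [Ra' Rb' ->]]]].
- by exists (ev p), 0; rewrite mul0r addr0; split=> //; [exact: (rp_ev RR) | exact: rp0].
- by exists (a - a'), (b - b'); split; [exact: (rpB RR) | exact: (rpB RR) | ring].
exists (a * a' + b * b' * (y ^+ 2 + y)), (a * b' + a' * b + b * b'); split.
- by apply: (rpD RR); [exact: (rpM RR) | do 2?apply: (rpM RR)].
- by do 2?apply: (rpD RR); apply: (rpM RR).
apply: (eq_char2 ch (c := - (b * b' * y))); ring.
Qed.

Lemma tower_sub u c F R : tower u c F R -> forall f, R f -> exists z, F z f.
Proof.
elim=> [_ [p ->]|{}u {}c o {}F {}R y tw IH o0 Rg eg _ [a [b [Ra Rb ->]]]].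
  exists (Q * ((size p)%:Z - (size (1 : {poly k}))%:Z)), p, 1.
  by rewrite oner_eq0 rmorph1 mulr1; split=> //; right.
have FF := val_fil (tower_valued tw).
have [z Fa] := IH a Ra; have [z' Fb] := IH b Rb.
exists (`|z| + `|z' + u * (2 * o + 1)|), a, b; split=> //.
  by apply: (fil_le FF) Fa; lia.
by apply: (fil_le FF) Fb; lia.
Qed.

Lemma poly_sq (p : {poly k}) : exists q r, p = q ^+ 2 + 'X * r ^+ 2.
Proof.
elim/poly_ind: p => [|p c [q [r e]]].
  by exists 0, 0; rewrite expr0n mulr0 addr0.
(* Multiplication by X exchanges the two parts: (q^2 + X r^2) X + b^2 = (X r + b)^2 + X q^2. *)
have [b eb] := perf c; exists ('X * r + b%:P), q.
have ch' : 2%N \in [pchar {poly k}].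
  rewrite inE /=; apply/eqP/polyP => i; apply/eqP.
  suff /eqP -> : (2%:R : {poly k}) == 0 by rewrite coef0.
  have -> : (2%:R : {poly k}) = 2%:R%:P by rewrite rmorph_nat.
  rewrite polyC_eq0; apply/eqP.
  have := ev_inj; move=> /(_ (2%:R)%:P); rewrite rmorph_nat rmorph_nat (pcharf0 ch) => /(_ erefl).
  by move/eqP; rewrite -[2%:R](rmorph_nat polyC) polyC_eq0 => /eqP.
rewrite e {}eb expr2 polyCM; apply: (eq_char2 ch' (c := - ('X * r * b%:P))).
ring.
Qed.

Definition sq_closed (x0 : L) (R : L -> Prop) :=
  forall a, R a -> exists al be, [/\ R al, R be & a = al ^+ 2 + x0 * be ^+ 2].

(* y = y ^+ 2 + g keeps y inside the ring generated by squares and x *)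
Lemma step_sq (R : L -> Prop) y : ring_pred R -> sq_closed x R -> R (y ^+ 2 + y) ->
  sq_closed x (fun f => exists a b, [/\ R a, R b & f = a + b * y]).
Proof.
move=> RR sq Rg _ [a [b [Ra Rb ->]]].
have [a1 [a2 [R1 R2 ea]]] := sq a Ra; have [b1 [b2 [R3 R4 eb]]] := sq b Rb.
have [g1 [g2 [R5 R6 eg]]] := sq _ Rg.
exists (a1 + x * b2 * g2 + b1 * g1 + b1 * y), (a2 + b1 * g2 + b2 * g1 + b2 * y); split.
- exists (a1 + x * b2 * g2 + b1 * g1), b1; split=> //.
  by do 2?apply: (rpD RR) => //; do 2?apply: (rpM RR) => //; exact: (rp_ev RR).
- exists (a2 + b1 * g2 + b2 * g1), b2; split=> //.
  by do 2?apply: (rpD RR) => //; apply: (rpM RR).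
have ey : y = y ^+ 2 + (g1 ^+ 2 + x * g2 ^+ 2).
  by rewrite -eg addrA (addrr2 ch) add0r.
rewrite {1}ey ea eb; apply: (eq_char2 ch (c :=
  - (a1 * (x * b2 * g2) + a1 * (b1 * g1) + a1 * (b1 * y) + x * b2 * g2 * (b1 * g1)
     + x * b2 * g2 * (b1 * y) + b1 * g1 * (b1 * y)
   + x * (a2 * (b1 * g2) + a2 * (b2 * g1) + a2 * (b2 * y) + b1 * g2 * (b2 * g1)
     + b1 * g2 * (b2 * y) + b2 * g1 * (b2 * y))))); ring.
Qed.

Lemma tower_sqR u c F R : tower u c F R -> sq_closed x R.
Proof.
elim=> [_ [p ->]|{}u {}c o {}F {}R y tw IH o0 Rg eg].
  have [q [r e]] := poly_sq p; exists (ev q), (ev r); split; [by exists q | by exists r |].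
  by rewrite e rmorphD rmorphXn (rmorphM _ 'X) rmorphXn.
exact: step_sq (tower_ring tw) IH Rg.
Qed.

Lemma tower_frac u c F R : tower u c F R -> forall z f, F z f ->
  exists q, q != 0 /\ R (f * ev q).
Proof.
elim=> [_ f [p [q [q0 e _]]]|{}u {}c o {}F {}R y tw IH o0 Rg eg z _ [a [b [Fa Fb ->]]]].
  by exists q; split=> //; exists p.
have RR := tower_ring tw.
have [p [p0 Rp]] := IH _ a Fa; have [q [q0 Rq]] := IH _ b Fb.
exists (p * q); split; first exact: mulf_neq0.
exists (a * ev (p * q)), (b * ev (p * q)); split; last by ring.
  by rewrite rmorphM mulrA; apply: (rpM RR) => //; exact: (rp_ev RR).
by rewrite rmorphM [ev p * _]mulrC mulrA; apply: (rpM RR) => //; exact: (rp_ev RR).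
Qed.

(** Multiplying f by the square of a polynomial denominator moves the question to the affine
    ring. *)
Lemma tower_sqF u c F R : tower u c F R -> forall z a, F z a ->
  exists s al be, [/\ F s al, F s be & a = al ^+ 2 + x * be ^+ 2].
Proof.
move=> tw z f Ff; have V := tower_valued tw; have FF := val_fil V.
have [q [q0 Rf]] := tower_frac tw Ff; have RR := tower_ring tw.
have Rq2 : R (f * ev q * ev q) by apply: (rpM RR) => //; exact: (rp_ev RR).
have [al [be [Ra Rb e]]] := tower_sqR tw Rq2.
have [z1 F1] := tower_sub tw Ra; have [z2 F2] := tower_sub tw Rb.
have [z3 F3] := tower_sub tw (rp_ev RR q).
have [w1 G1] := fil_divr V F1 F3; have [w2 G2] := fil_divr V F2 F3.
have eq0 : ev q != 0 by exact: ev_neq0.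
exists (`|w1| + `|w2|), (al / ev q), (be / ev q); split.
- by apply: (fil_le FF) G1; lia.
- by apply: (fil_le FF) G2; lia.
by rewrite !expr_div_n mulrA -mulrDl -e expr2 -[f * _ * _]mulrA mulfK // mulf_neq0.
Qed.

(** On the line x itself serves, with derivative 1. In a quadratic layer y serves: y = y^2 + g has
    the derivative of g, of order exactly 2r + (c - Q) because 2r is an odd multiple of 2u. *)
Lemma tower_odd u c F R : tower u c F R -> exists p al be s m,
  [/\ exact F ((2 * m + 1) * u) p, F s al, F s be, p = al ^+ 2 + x * be ^+ 2
  & exact F ((2 * m + 1) * u + (c - Q)) (be ^+ 2)].
Proof.
elim=> [|{}u {}c o {}F {}R y tw IH o0 Rg eg].
  have V := rat_valued ev_inj Q0; have FF := val_fil V.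
  exists x, 0, 1, 0, 0; split.
  - have E : x * ev 1 = x by rewrite rmorph1 mulr1.
    rewrite (rat_fil_exact ev_inj Q0 (q := 1) _ _ _ E) ?oner_eq0 ?polyX_eq0 //.
    by rewrite size_polyX size_poly1; lia.
  - exact: (fil0 FF).
  - exact: (fil1 FF).
  - by rewrite expr0n expr1n add0r mulr1.
  by rewrite expr1n (_ : _ + _ = 0); [exact: (exact1 V) | lia].
have V := tower_valued tw; have FF := val_fil V.
have [s [g1 [g2 [F1 F2 eg']]]] := tower_sqF tw eg.1.
have ed : exact F (u * (2 * o + 1) + u * (2 * o + 1) + (c - Q)) (g2 ^+ 2).
  have -> : u * (2 * o + 1) + u * (2 * o + 1) = (2 * o + 1) * (2 * u) by ring.
  apply: (sq_deriv_exact ch V (tower_sqF tw) IH F1 F2).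
  by rewrite -eg' (_ : _ * (2 * u) = u * (2 * o + 1) + u * (2 * o + 1)) //; ring.
set r := u * (2 * o + 1) in eg ed *.
exists y, (g1 + 1 * y), g2, (`|s| + `|r|), o; split.
- rewrite (_ : (2 * o + 1) * u = r); last by rewrite /r; ring.
  have := @step_exact_gen _ _ _ _ _ _ _ ch V o0 eg r 1.
  by rewrite mul1r; apply; rewrite subrr; apply: (exact1 V).
- exists g1, 1; split=> //; first by apply: (fil_le FF) F1; lia.
  by apply: (fil_le FF) (fil1 FF); lia.
- by apply: (step_filF o y V); apply: (fil_le FF) F2; lia.
- have {1}-> : y = y ^+ 2 + (g1 ^+ 2 + x * g2 ^+ 2).
    by rewrite -eg' addrA (addrr2 ch) add0r.
  by apply: (eq_char2 ch (c := - (g1 * y))); ring.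
rewrite (_ : (2 * o + 1) * u + (c + r - Q) = r + r + (c - Q)); last by rewrite /r; ring.
exact: (step_exactF ch V o0 eg).
Qed.

(** The vanishing of H^1 for (2g - 1) times infinity, proved directly: division with remainder
    leaves an error of order at most -Q, and in a + b y the error of the second coordinate grows by
    r, exactly as c does. *)
Lemma tower_approx u c F R : tower u c F R -> forall z f, F z f ->
  exists g, R g /\ F (c - Q) (f - g).
Proof.
elim=> [_ f [p [q [q0 e _]]]|{}u {}c o {}F {}R y tw IH o0 Rg eg z _ [a [b [Fa Fb ->]]]].
  exists (ev (p %/ q)); split; first by exists (p %/ q).
  exists (p %% q), q; split=> //.
    rewrite mulrBl e {1}(divp_eq p q) rmorphD rmorphM addrAC subrr add0r //.
  right; rewrite sub0r -[- Q]mulrN1; apply: ler_wpM2l; first exact: ltW.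
  have hs : (size (p %% q)%R < size q)%N := ltn_modpN0 p q0.
  by move: hs; move: (size (p %% q)%R) (size q) => i j; lia.
have [g1 [R1 F1]] := IH _ _ Fa; have [g2 [R2 F2]] := IH _ _ Fb.
have FF := val_fil (tower_valued tw); have u0 := val_gt0 (tower_valued tw).
exists (g1 + g2 * y); split; first by exists g1, g2.
exists (a - g1), (b - g2); split; last by ring.
  apply: (fil_le FF) F1; have : 0 <= u * (2 * o + 1) by rewrite mulr_ge0; lia.
  by lia.
by apply: (fil_le FF) F2; lia.
Qed.
End Tower.

(** * Dimensions of spaces of functions with bounded poles, and integrality at places *)

Lemma divz_uniq (m d q s : int) : m = q * d + s -> 0 <= s < d -> (m %/ d)%Z = q.
Proof.
move=> -> /andP[s0 sd]; rewrite divzMDl; last by lia.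
by rewrite divz_small ?addr0 // s0 /=; lia.
Qed.

(* Hermite's identity for the floor function, with an odd shift *)
Lemma divz_pair (t u o : int) : 0 < u ->
  (t %/ (2 * u))%Z + ((t - u * (2 * o + 1)) %/ (2 * u))%Z = (t %/ u)%Z - o - 1.
Proof.
move=> u0; have u1 : u != 0 by lia.
have et := divz_eq t u; have s0 := modz_ge0 t u1; have s1 := ltz_pmod t u0.
move: et s0 s1; move: (t %% u)%Z (t %/ u)%Z => s w et s0 s1.
have [h [e [ew e01]]] : exists h e, w = 2 * h + e /\ (e = 0 \/ e = 1).
  by exists (w %/ 2)%Z, (w %% 2)%Z; lia.
rewrite (@divz_uniq t (2 * u) h (u * e + s)); first last.
- by case: e01 => ->; lia.
- by rewrite et ew; ring.
case: e01 => ee.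
  rewrite (@divz_uniq _ (2 * u) (h - o - 1) (u + s)); first by lia.
    by rewrite et ew ee; ring.
  by lia.
rewrite (@divz_uniq _ (2 * u) (h - o) s); first by lia.
  by rewrite et ew ee; ring.
by lia.
Qed.

Section Dimension.
Variables (k L : fieldType) (ev : {rmorphism {poly k} -> L}).

Definition kbasis (S : L -> Prop) (N : nat) (e : 'I_N -> L) : Prop :=
  (forall w, S w <-> exists c : 'I_N -> k, w = \sum_i ev (c i)%:P * e i) /\
  (forall c : 'I_N -> k, \sum_i ev (c i)%:P * e i = 0 -> forall i, c i = 0).
Definition kdim (S : L -> Prop) (N : nat) : Prop := exists e, kbasis S (N := N) e.
End Dimension.

Section Tower.
Variables (k L : fieldType) (ev : {rmorphism {poly k} -> L}) (Q : int).
Hypothesis ch : 2%N \in [pchar L].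
Hypothesis perf : forall c : k, exists b, c = b ^+ 2.
Hypothesis ev_inj : forall p : {poly k}, ev p = 0 -> p = 0.
Hypothesis Q0 : 0 < Q.
Local Notation x := (ev 'X).
Local Notation tower := (tower ev Q).
Local Notation tower_valued := (tower_valued ch ev_inj Q0).
Local Notation tower_ring := (tower_ring ch).
Local Notation tower_sub := (tower_sub ch ev_inj Q0).
Local Notation tower_frac := (tower_frac ch).

Lemma tower_neg u c F R : tower u c F R -> forall (t : int) f, t < 0 -> R f -> F t f -> f = 0.
Proof.
elim=> [t _ t0 [p ->] Ft|{}u {}c o {}F {}R y tw IH o0 Rg eg t _ t0 [a [b [Ra Rb ->]]] Ft].
  have [->|p0] := eqVneq p 0; first by rewrite rmorph0.
  have E : ev p * ev 1 = ev p by rewrite rmorph1 mulr1.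
  move: Ft; rewrite (rat_filE ev_inj Q0 _ _ p0 E) ?oner_eq0 // size_poly1.
  have : (0 < size p)%N by rewrite size_poly_gt0.
  move: (size p) => s s0; have : 0 <= Q * (s%:Z - 1) by apply: mulr_ge0; lia.
  by lia.
have V := tower_valued tw; have FF := val_fil V; have u0 := val_gt0 V.
have [z1 F1] := tower_sub tw Ra; have [z2 F2] := tower_sub tw Rb.
have [Fa Fb] : F t a /\ F (t - u * (2 * o + 1)) b.
  apply: (step_fil_inv ch V o0 eg (s' := `|z1| + `|z2|) _ _ Ft).
    by apply: (fil_le FF) F1; lia.
  by apply: (fil_le FF) F2; lia.
have r0 : 0 <= u * (2 * o + 1) by apply: mulr_ge0; lia.
by rewrite (IH _ _ t0 Ra Fa) (IH _ _ _ Rb Fb) ?mul0r ?addr0 //; lia.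
Qed.

(** Riemann-Roch in degrees at least 2g - 1, with [kappa] equal to 1 - g. The counts for t and t - r
    add up through [divz_pair], which makes the new [kappa] equal to 2 kappa - o - 1; the range for
    the larger field keeps t - r in the range for the smaller one. *)
Lemma tower_dim u c F R : tower u c F R -> forall t : int, c - Q <= t ->
  exists N (kappa : int), [/\ kdim ev (fun f => R f /\ F t f) N,
    N%:Z = (t %/ u)%Z + kappa & 2 * kappa * u = u + Q - c].
Proof.
elim=> [t tQ|{}u {}c o {}F {}R y tw IH o0 Rg eg t tQ].
  have d0 : 0 <= (t %/ Q)%Z + 1.
    suff : (-1 <= t %/ Q)%Z by lia.
    by rewrite lez_divRL //; lia.
  exists (absz ((t %/ Q)%Z + 1)), 1; split; [|by lia|by lia].
  set N := absz _; have NE : N%:Z = (t %/ Q)%Z + 1 by rewrite /N; lia.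
  have key (p : {poly k}) : rat_fil ev Q t (ev p) <-> (size p <= N)%N.
    have [->|p0] := eqVneq p 0.
      by rewrite size_poly0 rmorph0; split=> _; [|exact (fil0 (val_fil (rat_valued ev_inj Q0)) t)].
    have E : ev p * ev 1 = ev p by rewrite rmorph1 mulr1.
    rewrite (rat_filE ev_inj Q0 _ _ p0 E) ?oner_eq0 // size_poly1.
    move: (size p) => s; rewrite mulrC -lez_divRL //.
    by split=> h; lia.
  exists (fun i => ev 'X^i); split=> [f|cf e i].
    split=> [[[p ->]]|[cf ->]].
      move/key => sp; exists (fun i => p`_i); rewrite -[in LHS](coefK p).
      rewrite poly_def rmorph_sum /=.
      rewrite (big_ord_widen _ (fun i => ev (p`_i *: 'X^i)) sp) big_mkcond /=.
      apply: eq_bigr => i _; case: ltnP => ip; first by rewrite -mul_polyC rmorphM.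
      by rewrite nth_default // rmorph0 mul0r.
    have -> : \sum_(i < N) ev (cf i)%:P * ev 'X^i = ev (\sum_(i < N) (cf i) *: 'X^i).
      by rewrite rmorph_sum; apply: eq_bigr => i _; rewrite -mul_polyC rmorphM.
    split; first by eexists.
    apply/key; apply: leq_trans (size_sum _ _ _) _.
    apply/bigmax_leqP => i _; apply: leq_trans (size_scale_leq _ _) _.
    by rewrite size_polyXn.
  have e2 : \sum_(i < N) (cf i) *: 'X^i = 0.
    apply: ev_inj; rewrite rmorph_sum -[RHS]e; apply: eq_bigr => j _.
    by rewrite -mul_polyC rmorphM.
  have := congr1 (fun q : {poly k} => q`_i) e2; rewrite coef0 coef_sum (bigD1 i) //=.
  rewrite coefZ coefXn eqxx mulr1 big1 ?addr0 // => j ji.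
  by rewrite coefZ coefXn eq_sym (inj_eq val_inj) (negbTE ji) mulr0.
have V := tower_valued tw; have FF := val_fil V; have u0 : 0 < u by have := val_gt0 V; lia.
set r := u * (2 * o + 1) in eg tQ *.
have r0 : 0 <= r by apply: mulr_ge0; lia.
have [N1 [k1 [[e1 [s1 f1]] n1 q1]]] := IH t ltac:(lia).
have [N2 [k2 [[e2 [s2 f2]] n2 q2]]] := IH (t - r) ltac:(lia).
have kk : k1 = k2.
  have /eqP : (k1 - k2) * u = 0 by lia.
  by rewrite mulf_eq0; lia.
subst k2; exists (N1 + N2)%N, (2 * k1 - o - 1); split; first last.
- have -> : 2 * (2 * k1 - o - 1) * u = 2 * k1 * (2 * u) - (r + u) by rewrite /r; ring.
  by lia.
- by rewrite PoszD n1 n2; have := divz_pair t o u0; rewrite -/r; lia.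
pose e (i : 'I_(N1 + N2)) := match split i with inl a => e1 a | inr b => e2 b * y end.
have sumE (cf : 'I_(N1 + N2) -> k) : \sum_i ev (cf i)%:P * e i =
    (\sum_i ev (cf (lshift N2 i))%:P * e1 i) + (\sum_i ev (cf (rshift N1 i))%:P * e2 i) * y.
  rewrite big_split_ord /=; congr (_ + _).
    by apply: eq_bigr => i _; rewrite /e (unsplitK (inl i)).
  rewrite mulr_suml; apply: eq_bigr => i _.
  by rewrite /e (unsplitK (inr i)) mulrA.
exists e; split=> [w|cf].
  split.
    move=> [[a [b [Ra Rb ->]]] Ft].
    have [z1 F1] := tower_sub tw Ra; have [z2 F2] := tower_sub tw Rb.
    have [Fa Fb] : F t a /\ F (t - r) b.
      apply: (step_fil_inv ch V o0 eg (s' := `|z1| + `|z2|) _ _ Ft).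
        by apply: (fil_le FF) F1; lia.
      by apply: (fil_le FF) F2; lia.
    have [c1 ea] := (s1 a).1 (conj Ra Fa); have [c2 eb] := (s2 b).1 (conj Rb Fb).
    exists (fun i => match split i with inl a => c1 a | inr b => c2 b end).
    rewrite sumE ea eb; congr (_ + _ * _); apply: eq_bigr => i _.
      by rewrite (unsplitK (inl i)).
    by rewrite (unsplitK (inr i)).
  move=> [cf ->]; rewrite sumE.
  have [] := (s1 (\sum_i ev (cf (lshift N2 i))%:P * e1 i)).2; first by eexists.
  have [] := (s2 (\sum_i ev (cf (rshift N1 i))%:P * e2 i)).2; first by eexists.
  by move=> Rb Fb Ra Fa; split; do 2!eexists; split; try exact: erefl.
rewrite sumE => E.
have [Rb Fb] := (s2 (\sum_i ev (cf (rshift N1 i))%:P * e2 i)).2 ltac:(by eexists).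
have [Ra Fa] := (s1 (\sum_i ev (cf (lshift N2 i))%:P * e1 i)).2 ltac:(by eexists).
have [z1 F1] := tower_sub tw Ra; have [z2 F2] := tower_sub tw Rb.
have [] := step_free ch V o0 eg (s := `|z1| + `|z2|) _ _ E.
- by apply: (fil_le FF) F1; lia.
- by apply: (fil_le FF) F2; lia.
move=> ea eb i; case: (split_ordP i) => j ->.
  exact: (f1 (fun i => cf (lshift N2 i)) ea).
exact: (f2 (fun i => cf (rshift N1 i)) eb).
Qed.

Lemma tower_conj u c F R y : tower (2 * u) c F R -> R (y ^+ 2 + y) ->
  forall a b, R a -> R b -> R (step_norm y a b).
Proof.
move=> tw Rg a b Ra Rb; have RR := tower_ring tw; rewrite /step_norm.
by apply: (rpD ch RR); [apply: (rpD ch RR)|]; rewrite ?[a ^+ 2]expr2 ?[b ^+ 2]expr2;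
  do ?apply: (rpM RR).
Qed.

(** Conjugates are multiplied layer by layer until the norm is a polynomial. *)
Lemma tower_norm u c F R : tower u c F R -> forall f, R f -> f <> 0 ->
  exists f' (p : {poly k}), [/\ R f', p != 0 & f * f' = ev p].
Proof.
elim=> [_ [p ->] p0|{}u {}c o {}F {}R y tw IH o0 Rg eg _ [a [b [Ra Rb ->]]] f0].
  exists 1, p; rewrite mulr1; split=> //; first by exists 1; rewrite rmorph1.
  by apply/eqP => p1; apply: p0; rewrite p1 rmorph0.
have RR := tower_ring tw; have V := tower_valued tw; have FF := val_fil V.
have RN := tower_conj tw Rg Ra Rb.
have [z1 F1] := tower_sub tw Ra; have [z2 F2] := tower_sub tw Rb.
have N0 : step_norm y a b <> 0.
  rewrite (step_normE y ch) => /eqP; rewrite mulf_eq0 => /orP[/eqP|/eqP e] //.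
  have [] := step_free ch V o0 eg (s := `|z1| + `|z2|) _ _ e.
  - by apply: (filD FF); [apply: (fil_le FF) F1 | apply: (fil_le FF) F2]; lia.
  - by apply: (fil_le FF) F2; lia.
  by move=> ab b0; apply: f0; rewrite b0 addr0 in ab; rewrite ab b0 mul0r addr0.
have [f' [p [Rf p0 e]]] := IH _ RN N0.
exists ((a + b) * f' + (b * f') * y), p; split=> //.
  exists ((a + b) * f'), (b * f'); split=> //; first by apply: (rpM RR) => //; apply: (rpD ch RR).
  exact: (rpM RR).
by rewrite -e (step_normE y ch); ring.
Qed.

Record val_ring (O : L -> Prop) : Prop := ValRing {
  vr_B : forall a b, O a -> O b -> O (a - b);
  vr_M : forall a b, O a -> O b -> O (a * b);
  vr_const : forall c, O (ev c%:P);
  vr_V : forall a, O a \/ O a^-1 }.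

Section ValRing.
Variables (O : L -> Prop) (OO : val_ring O).
Lemma vr1 : O 1. Proof. by have := vr_const OO 1; rewrite !rmorph1. Qed.
Lemma vrD a b : O a -> O b -> O (a + b).
Proof. by move=> Oa Ob; rewrite -[b](oppr2 ch); apply: (vr_B OO). Qed.
(** A valuation ring is integrally closed: if a^-1 lies in it, so does a = N a^-1 - b. *)
Lemma vr_quad a b N : O b -> O N -> a * (a + b) = N -> O a.
Proof.
move=> Ob ON e; have [//|Oa] := vr_V OO a.
have [->|a0] := eqVneq a 0; first by rewrite -(subrr 1); apply: (vr_B OO); exact: vr1.
have -> : a = N * a^-1 - b by rewrite -e mulrAC mulfV // mul1r addrK.
by apply: (vr_B OO) => //; apply: (vr_M OO).
Qed.

Lemma vr_sqrt a : O (a ^+ 2) -> O a.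
Proof.
move=> Oa; apply: (@vr_quad a 0 (a ^+ 2)) => //; last by rewrite addr0 expr2.
by rewrite -(subrr 1); apply: (vr_B OO); exact: vr1.
Qed.
End ValRing.

Lemma tower_finite_place O : val_ring O -> O x ->
  forall u c F R, tower u c F R -> forall f, R f -> O f.
Proof.
move=> OO Ox u c F R; elim=> [_ [p ->]|{}u {}c o {}F {}R y tw IH o0 Rg eg _ [a [b [Ra Rb ->]]]].
  elim/poly_ind: p => [|p b IH]; first by rewrite -(polyC0); apply: (vr_const OO).
  rewrite rmorphD rmorphM; apply: (vrD OO); last exact: (vr_const OO).
  exact: (vr_M OO).
apply: (vrD OO); first exact: IH.
apply: (vr_M OO); first exact: IH.
apply: (@vr_quad O OO y 1 (y ^+ 2 + y)); [exact: vr1 | exact: IH | ring].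
Qed.

(** If x is not in O, a polynomial divided by x to its degree is a unit of O, which settles the
    line; a quadratic layer follows by integrality, trace and norm having nonpositive order. So
    infinity is the only place at which x has a pole. *)
Lemma tower_infinite_place O : val_ring O -> ~ O x ->
  forall u c F R, tower u c F R -> forall f, F 0 f -> O f.
Proof.
move=> OO nOx.
have x0 : x <> 0.
  by move=> x0; apply: nOx; rewrite x0 -(subrr 1); apply: (vr_B OO); exact: vr1.
have Ow : O x^-1 by have [] := vr_V OO x.
have O0 : O 0 by rewrite -(subrr 1); apply: (vr_B OO); exact: vr1.
(* ev p / x ^ (deg p) is the leading coefficient modulo the maximal ideal *)
have Op (p : {poly k}) : O (ev p * (x^-1) ^+ (size p).-1).
  have aux (q : {poly k}) e : (size q <= e.+1)%N -> O (ev q * (x^-1) ^+ e).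
    elim/poly_ind: q e => [|q b IH] e se; first by rewrite rmorph0 mul0r.
    rewrite rmorphD rmorphM mulrDl; apply: (vrD OO); last first.
      apply: (vr_M OO); first exact: (vr_const OO).
      by elim: e {IH se} => [|e IH]; [exact: vr1 | rewrite exprS; apply: (vr_M OO)].
    have [->|q0] := eqVneq q 0; first by rewrite rmorph0 !mul0r.
    move: se; rewrite size_MXaddC (negbTE q0) /=; case: e => [|e].
      by rewrite ltnS leqn0 size_poly_eq0 (negbTE q0).
    move=> se; rewrite exprS -mulrA [x * _]mulrA mulfV ?mul1r; last exact/eqP.
    exact: IH.
  by apply: aux; rewrite leqSpred.
have Oinv (q : {poly k}) : q != 0 -> O ((ev q * (x^-1) ^+ (size q).-1)^-1).
  move=> q0; set h := ev q * _.
  have h0 : h != 0.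
    rewrite mulf_neq0 ?expf_neq0 ?invr_eq0 //; last exact/eqP.
    exact: ev_neq0.
  pose l := lead_coef q; have l0 : l != 0 by rewrite lead_coef_eq0.
  have lo : l%:P != 0 by rewrite polyC_eq0.
  have [s [Os es]] : exists s, O s /\ h = ev l%:P + x^-1 * s.
    case eq : (size q).-1 => [|e].
      exists 0; split=> //; rewrite /h eq mulr1 mulr0 addr0.
      have : (size q <= 1)%N by move: (leqSpred (size q)); rewrite eq.
      by move/size1_polyC => {1}->; rewrite /l lead_coefE eq.
    pose q' := q - l *: 'X^(e.+1).
    have sq' : (size q' <= e.+1)%N.
      apply/leq_sizeP => j; rewrite coefB coefZ coefXn leq_eqVlt => /orP[/eqP <-|ej].
        by rewrite eqxx mulr1 /l lead_coefE eq subrr.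
      rewrite (gtn_eqF ej) mulr0 subr0 nth_default //.
      by move: (leqSpred (size q)); rewrite eq => /leq_trans; apply.
    exists (ev q' * (x^-1) ^+ e); split.
      have -> : ev q' * x^-1 ^+ e = ev q' * x^-1 ^+ (size q').-1 * x^-1 ^+ (e - (size q').-1).
        by rewrite -mulrA -exprD subnKC //; case: (size q') sq'.
      apply: (vr_M OO); first exact: Op.
      elim: (e - _)%N => [|i IH]; first exact: vr1.
      by rewrite exprS; apply: (vr_M OO).
    have {1}-> : h = ev (q' + l *: 'X^(e.+1)) * x^-1 ^+ e.+1 by rewrite /h eq subrK.
    rewrite rmorphD -mul_polyC rmorphM rmorphXn mulrDl -mulrA -exprMn.
    rewrite mulfV ?expr1n ?mulr1; last exact/eqP.
    by rewrite addrC exprS mulrCA.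
  have Ol : O (ev l%:P)^-1.
    have := vr_const OO l^-1; suff -> : (ev l%:P)^-1 = ev l^-1%:P by [].
    have evl0 : ev l%:P != 0 by exact: ev_neq0.
    by apply: (mulfI evl0); rewrite mulfV // -rmorphM -polyCM mulfV // rmorph1.
  have [//|Oh] := vr_V OO (h * x); last first.
    (* x^-1 h^-1 is integral, hence so is l h^-1 = 1 - x^-1 s h^-1 *)
    have -> : h^-1 = (ev l%:P)^-1 * (1 - (h * x)^-1 * s).
      have evl0 : ev l%:P != 0 by exact: ev_neq0.
      apply: (mulfI evl0); rewrite mulrA mulfV // mul1r.
      apply: (mulfI h0); rewrite mulrCA mulfV // mulr1 mulrBr mulr1.
      by rewrite invfM !mulrA mulfV // mul1r es addrK.
    apply: (vr_M OO) => //; apply: (vr_B OO); first exact: vr1.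
    exact: (vr_M OO).
  move=> Oh; exfalso; apply: nOx.
  have -> : x = (ev l%:P)^-1 * (h * x - s).
    have evl0 : ev l%:P != 0 by exact: ev_neq0.
    apply: (mulfI evl0); rewrite mulrA mulfV // mul1r es mulrDl.
    by rewrite mulrAC mulVf ?mul1r ?addrK //; exact/eqP.
  by apply: (vr_M OO) => //; apply: (vr_B OO).
move=> u c F R; elim=> [f Ff|{}u {}c o {}F {}R y tw IH o0 Rg eg f Gf].
  have [->|/eqP f0] := eqVneq f 0; first by [].
  have [p [q [q0 p0 e]]] := rat_rep ev_inj Ff f0.
  move: Ff; rewrite (rat_filE ev_inj Q0 _ q0 p0 e) => h.
  have spq : (size p <= size q)%N.
    move: h; move: (size p) (size q) => i j; rewrite leNgt => /negP h.
    rewrite leqNgt; apply/negP => ij; apply: h.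
    by apply: mulr_gt0; lia.
  have -> : f = (ev p * x^-1 ^+ (size p).-1) * x^-1 ^+ ((size q).-1 - (size p).-1) *
      (ev q * x^-1 ^+ (size q).-1)^-1.
    rewrite -[ev p * _ * _]mulrA -exprD subnKC; last by move: spq; move: (size p) (size q); lia.
    have w0 : x^-1 ^+ (size q).-1 != 0 by rewrite expf_neq0 // invr_eq0; exact/eqP.
    rewrite invfM mulrACA mulfV // mulr1 -e mulfK //; exact: ev_neq0.
  apply: (vr_M OO); last exact: Oinv.
  apply: (vr_M OO); first exact: Op.
  elim: (_ - _)%N => [|i IH]; first exact: vr1.
  by rewrite exprS; apply: (vr_M OO).
have V := tower_valued tw; have FF := val_fil V; have u0 := val_gt0 V.
case: Gf => a [b [Fa Fb ->]].
have r0 : 0 <= u * (2 * o + 1) by apply: mulr_ge0; lia.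
apply: (@vr_quad O OO _ b (step_norm y a b)).
- by apply: IH; apply: (fil_le FF) Fb; lia.
- by apply: IH; have := step_norm_fil ch V o0 eg Fa Fb; rewrite addr0.
by rewrite (step_normE y ch); ring.
Qed.
End Tower.

(** * The Artin-Schreier-Witt equation *)

(* b = al + be z is an approximate square root of a = al^2 + g be^2,
   where z^2 + z = g: the error a - b^2 = be^2 z drops by the order of z *)
Section ApproximateRoots.
Variables (k L : fieldType) (ev : {rmorphism {poly k} -> L}) (u o : int).
Variables (F : int -> L -> Prop) (y z : L).
Hypothesis ch : 2%N \in [pchar L].
Hypothesis V : valued ev (2 * u) F.
Hypothesis o0 : 0 <= o.
Local Notation r := (u * (2 * o + 1)).
Hypothesis eg : exact F (r + r) (y ^+ 2 + y).
Local Notation G := (step_fil r y F).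
Let g := z ^+ 2 + z.
Hypothesis eg' : exact F (r + r) g.
Hypothesis ez : exact G r z.
Let FF := val_fil V.
Let V' := step_valued ch V o0 eg.
Let GG := val_fil V'.
Let u0 := val_gt0 V'.
Let r0 : 0 < r. Proof. by apply: mulr_gt0; have := u0; lia. Qed.
Let eg2 : exact F ((2 * o + 1) * (2 * u)) g.
Proof. by rewrite (_ : _ * (2 * u) = r + r) //; ring. Qed.
Let FG s f : F s f -> G s f. Proof. exact: (step_filF o y V). Qed.
Let eFG s f : exact F s f -> exact G s f. Proof. exact: (step_exactF ch V o0 eg). Qed.

Lemma approx_error al be : (al ^+ 2 + g * be ^+ 2) - (al + be * z) ^+ 2 = be ^+ 2 * z.
Proof. apply: (eq_char2 ch (c := - (al * (be * z)))); rewrite /g; ring. Qed.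

(** The two terms of al^2 + g be^2 have orders of different parity in units of 2u, so each is
    bounded by e. Thus be^2 has order at most e - 2r, and the factor z restores only r. *)
Lemma approx_bound e s al be : F s al -> F s be -> F e (al ^+ 2 + g * be ^+ 2) ->
  [/\ G (e - r) (be ^+ 2 * z), G e ((al + be * z) ^+ 2)
    & forall w, e <= w + w + 1 -> G w (al + be * z)].
Proof.
move=> Fal Fbe Fe; have [Fa2 Fb2] := odd_decomp_fil ch V eg2 Fal Fbe Fe.
have Hbe : be = 0 \/ exists2 t, exact F t be & r + r + (t + t) <= e.
  have [b0|/eqP b0] := eqVneq be 0; [by left | right].
  have [t [_ et]] := valE V Fbe b0; exists (t * (2 * u)) => //.
  exact: (exact_le V (valM V eg' (exactX2 V et)) Fb2).
have Geta : G (e - r) (be ^+ 2 * z).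
  case: Hbe => [->|[t et te]]; first by rewrite expr0n mul0r; apply: (fil0 GG).
  by apply: (fil_le GG) (filM GG (FG (exactX2 V et).1) ez.1); lia.
split=> //.
  rewrite (_ : (al + be * z) ^+ 2 = (al ^+ 2 + g * be ^+ 2) - be ^+ 2 * z); last first.
    by rewrite -(approx_error al be); ring.
  apply: (filB GG); first exact: FG.
  by apply: (fil_le GG) Geta; lia.
move=> w ew; apply: (filD GG).
  by apply/FG/(sqrt_bound V Fal Fa2).
case: Hbe => [->|[t et te]]; first by rewrite mul0r; apply: (fil0 GG).
by apply: (fil_le GG) (filM GG (FG et.1) ez.1); lia.
Qed.

(** An odd order cannot come from al^2, so g be^2 carries it and the first two bounds of
    [approx_bound] become equalities. *)
Lemma approx_exact m e s al be : e = (2 * m + 1) * (2 * u) -> F s al -> F s be ->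
  exact F e (al ^+ 2 + g * be ^+ 2) ->
  exact G (e - r) (be ^+ 2 * z) /\ exact G e ((al + be * z) ^+ 2).
Proof.
move=> em Fal Fbe ea; have [Fa2 Fb2] := odd_decomp_fil ch V eg2 Fal Fbe ea.1.
have Fa1 : F (e - 1) (al ^+ 2).
  case: (exact_or Fa2) => // ea2; exfalso.
  by apply: (odd_not_square ch V (m := m) Fal); rewrite -em.
have eb : exact F e (g * be ^+ 2).
  split=> // Fb1; apply: ea.2; exact: (filD FF).
have b0 : be <> 0.
  by move=> b0; apply: (exact_neq0 V eb); rewrite b0 expr0n mulr0.
have [t [_ et]] := valE V Fbe b0.
have ee := exact_uniq V eb (valM V eg' (exactX2 V et)).
have eeta : exact G (e - r) (be ^+ 2 * z).
  rewrite (_ : e - r = t * (2 * u) + t * (2 * u) + r); last by lia.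
  exact: (valM V' (eFG (exactX2 V et)) ez).
split=> //; rewrite (_ : (al + be * z) ^+ 2 = (al ^+ 2 + g * be ^+ 2) + - (be ^+ 2 * z)).
  apply: (exactD V' (eFG ea)); apply: (filN GG); apply: (fil_le GG) eeta.1; lia.
by rewrite -(approx_error al be); ring.
Qed.
End ApproximateRoots.

(** * One layer of the tower out of the Artin-Schreier-Witt equation *)

Section WittTower.
Variables (k L : fieldType) (ev : {rmorphism {poly k} -> L}) (Q : int).
Hypothesis ch : 2%N \in [pchar L].
Hypothesis perf : forall c : k, exists b, c = b ^+ 2.
Hypothesis ev_inj : forall p : {poly k}, ev p = 0 -> p = 0.
Hypothesis Q0 : 0 < Q.
Variables (n : nat) (Y : wv n L) (D : int).
Hypothesis D0 : 0 < D.
Local Notation Fr := (wmap (pFrobenius_aut ch) : wv n L -> wv n L).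
Hypothesis YR : forall u c F R, tower ev Q u c F R -> forall i, R (wcomp (Fr Y - Y) i).

(* in each component m >= j exactly one of the V^(pos l) [a l] reaches the
   largest possible order, and this order is odd *)
Definition leading (j : nat) (u c : int) (F : int -> L -> Prop) N
    (pos : 'I_N -> nat) (a : 'I_N -> L) : Prop :=
  forall m, (j <= m)%N -> (m < n)%N -> exists l0 e0 s,
    [/\ (pos l0 <= m)%N, exact F e0 (a l0), e0 = (2 * s + 1) * u,
        e0 *+ 2 ^ (m - pos l0) = D *+ 2 ^ m - c
      & forall l, l != l0 -> (pos l <= m)%N ->
          exists2 e, F e (a l) & e *+ 2 ^ (m - pos l) < D *+ 2 ^ m - c].

(** [U] is the solution [Y] minus vectors over the field reached so far, its first j components
    being removed. The right-hand side of its equation is kept as a sum of V^s [a], the shape in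
    which square roots can be extracted term by term; D 2^s - c is the order allowed at position
    s. *)
Definition wstate (j : nat) (u c : int) (F : int -> L -> Prop) (R : L -> Prop) : Prop :=
  exists (U : wv n L) N (pos : 'I_N -> nat) (a : 'I_N -> L),
   [/\ [/\ tower ev Q u c F R, wlow j U, forall i, exists z, F z (wcomp (Y - U) i)
        & forall i : 'I_n, (i < j)%N -> R (wcomp Y i)],
       Fr U - U = \sum_l vt n (pos l) (a l),
       forall l, (j <= pos l)%N,
       forall l, F (D *+ 2 ^ pos l - c) (a l)
     & leading j u c F pos a].

Lemma Fr_comp (x : wv n L) i : wcomp (Fr x) i = wcomp x i ^+ 2.
Proof. by rewrite wmapE. Qed.

Lemma Fr_vt s (a : L) : Fr (vt n s a) = vt n s (a ^+ 2).
Proof. by rewrite wmap_vt. Qed.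

Lemma wlow_vt j s (a : L) : (j <= s)%N -> wlow j (vt n s a).
Proof. by move=> js i ij; rewrite vtE ifN // neq_ltn (leq_trans ij js). Qed.

Lemma wlow_Fr j x : wlow j x -> wlow j (Fr x).
Proof. by move=> lx i ij; rewrite Fr_comp lx // expr0n. Qed.

Lemma sqr_sum (I : finType) (P : pred I) (f : I -> L) :
  (\sum_(i | P i) f i) ^+ 2 = \sum_(i | P i) f i ^+ 2.
Proof. by rewrite -[LHS]/(pFrobenius_aut ch _) rmorph_sum. Qed.

(** The j-th component is additive only where the lower ones vanish. The part built from the
    components below j is split off; it stays over the affine ring. *)
Lemma split_low j (jn : (j < n)%N) : exists Ylo Yhi : wv n L,
  [/\ Y = Ylo + Yhi, wlow j Yhi, wcomp Yhi (Ordinal jn) = wcomp Y (Ordinal jn)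
    & forall S : L -> Prop, S 1 -> (forall a b, S a -> S b -> S (a - b)) ->
    (forall a b, S a -> S b -> S (a * b)) ->
    (forall i : 'I_n, (i < j)%N -> S (wcomp Y i)) -> forall i, S (wcomp Ylo i)].
Proof.
exists (\sum_(i < n) vt n i (if (i < j)%N then wcomp Y i else 0)).
exists (\sum_(i < n) vt n i (if (i < j)%N then 0 else wcomp Y i)).
have low (i : 'I_n) : wlow j (vt n i (if (i < j)%N then 0 else wcomp Y i)).
  by case: ltnP => ij; [rewrite vt0; exact: wlow0 | exact: wlow_vt].
have [l1 l2] := wlow_sum (j := Ordinal jn) low.
split=> //.
- rewrite {1}[Y]wv_decomp -big_split; apply: eq_bigr => i _ /=.
  by case: ifP => _; rewrite vt0 ?addr0 ?add0r.
- rewrite l2 (bigD1 (Ordinal jn)) //= vtE eqxx ltnn big1 ?addr0 // => i.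
  by rewrite -val_eqE /= => ij; rewrite vtE eq_sym (negbTE ij).
move=> S S1 SB SM Sy; have S0 : S 0 by rewrite -(subrr 1); apply: (SB).
apply: wv_closed_sum => // l i; rewrite vtE.
by case: ifP => // _; case: ifP => // lj; apply: Sy.
Qed.

(** [hD] says that the leading order at component j is 2r, [hcr] that approximation errors stay
    below r, and [hodd] that the next leading orders are odd in units of u. *)
Lemma witt_step (j : nat) (u c o : int) F R : (j < n)%N -> 0 <= o -> 0 <= c ->
    D *+ 2 ^ j = c + u * (2 * o + 1) + u * (2 * o + 1) ->
    c - Q < u * (2 * o + 1) ->
    (forall m, (j < m)%N -> (m < n)%N ->
       exists s : int, D *+ 2 ^ m - (c + u * (2 * o + 1)) = (2 * s + 1) * u) ->
  wstate j (2 * u) c F R ->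
  exists y, [/\ R (y ^+ 2 + y),
    exact F (u * (2 * o + 1) + u * (2 * o + 1)) (y ^+ 2 + y)
    & wstate j.+1 u (c + u * (2 * o + 1)) (step_fil (u * (2 * o + 1)) y F)
        (fun f => exists a b, [/\ R a, R b & f = a + b * y])].
Proof.
move=> jn o0 c0 hD hcr hodd [U [N [pos [a [[tw lowU YU RY] eU posj Fa lead]]]]].
have V := tower_valued ch ev_inj Q0 tw; have FF := val_fil V; have RR := tower_ring ch tw.
have u0 : 0 < u by have := val_gt0 V; lia.
set r : int := u * (2 * o + 1) in hD hcr hodd *.
have r0 : 0 < r by apply: mulr_gt0; lia.
pose J := Ordinal jn; pose z := wcomp U J; pose g := z ^+ 2 + z.
have gsum : g = \sum_(l | pos l == j) a l.
  have [_ e1] := wlowB_comp (wlow_Fr lowU) lowU (j := J).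
  rewrite Fr_comp -/z eU in e1.
  have [_ e2] := wlow_sum (j := J) (fun l => wlow_vt (a l) (posj l)).
  rewrite /g -{2}[z](oppr2 ch) -e1 e2 [RHS]big_mkcond; apply: eq_bigr => l _.
  by rewrite vtE eq_sym.
have eg : exact F (r + r) g.
  have [l0 [e0 [s [pl0 el0 _ ee0 others]]]] := lead j (leqnn j) jn.
  have pj0 : pos l0 = j by apply/eqP; rewrite eqn_leq pl0 posj.
  rewrite pj0 subnn mulr1n in ee0.
  have ee : e0 = r + r by lia.
  rewrite gsum (bigD1 l0) ?pj0 //=; rewrite ee in el0; apply: (exactD V el0).
  apply: (fil_sum FF) => l /andP[/eqP pl nl].
  have [e Fe] := others l nl ltac:(by rewrite pl).
  by rewrite pl subnn mulr1n => le; apply: (fil_le FF) Fe; lia.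
have sqz : z ^+ 2 = g + z by rewrite /g -addrA (addrr2 ch) addr0.
(* the j-th component of Y, up to R, differs from z by an element of small order *)
have [Ylo [Yhi [eY lowY eYj Sclosed]]] := split_low jn.
have RYlo : forall i, R (wcomp Ylo i).
  by apply: Sclosed => //; [exact: (rp1 RR) | exact: (rpB RR) | exact: (rpM RR)].
pose yj := wcomp Y J.
have Ryj : R (yj ^+ 2 + yj).
  have [_ e1] := wlowB_comp (wlow_Fr lowY) lowY (j := J).
  rewrite Fr_comp eYj -/yj in e1.
  rewrite -{2}[yj](oppr2 ch) -e1.
  have -> : Fr Yhi - Yhi = (Fr Y - Y) - (Fr Ylo - Ylo).
    by rewrite eY raddfD /= (opprD Ylo) [X in _ = X - _]addrACA [X in _ = X - _]addrC addrK.
  apply: wv_closed; [exact: (rp1 RR) | exact: (rpB RR) | exact: (rpM RR) | exact: (YR tw) |].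
  apply: wv_closed; [exact: (rp1 RR) | exact: (rpB RR) | exact: (rpM RR) | | by []].
  by move=> i; rewrite Fr_comp expr2; apply: (rpM RR).
pose K f := exists w, F w f.
have K1 : K 1 by exists 0; apply: (fil1 FF).
have KB a1 b1 : K a1 -> K b1 -> K (a1 - b1).
  move=> [w1 F1] [w2 F2]; exists (`|w1| + `|w2|).
  by apply: (filB FF); [apply: (fil_le FF) F1 | apply: (fil_le FF) F2]; lia.
have KM a1 b1 : K a1 -> K b1 -> K (a1 * b1).
  by move=> [w1 F1] [w2 F2]; exists (w1 + w2); apply: (filM FF).
have [w Fw] : K (yj - z).
  have [_ <-] : wlow j (Yhi - U) /\ wcomp (Yhi - U) J = yj - z.
    by have := wlowB_comp (j := J) lowY lowU; rewrite eYj.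
  have -> : Yhi - U = (Y - U) - Ylo by rewrite eY [X in X - _ - _]addrC addrAC addrK.
  apply: wv_closed => // i; exact: (tower_sub ch ev_inj Q0 tw (RYlo i)).
(* As r' lies in R, y = yj - r' keeps y^2 + y in R; as the error has order at most c - Q < r, y has
   the same leading behaviour as z. *)
have [r' [Rr' Fr']] := tower_approx ch ev_inj Q0 tw Fw.
pose y := yj - r'; pose e := yj - z - r'.
have yze : y = z + e by rewrite /y /e addrAC addrCA subrr addr0.
have Ry : R (y ^+ 2 + y).
  rewrite (_ : _ + _ = (yj ^+ 2 + yj) + (r' ^+ 2 + r')).
    apply: (rpD ch RR) => //; apply: (rpD ch RR) => //.
    by rewrite expr2; apply: (rpM RR).
  apply: (eq_char2 ch (c := - (yj * r' + r'))); rewrite /y; ring.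
have Fe2 : F (r + r - 1) (e ^+ 2 + e).
  apply: (filD FF); last by apply: (fil_le FF) Fr'; lia.
  by rewrite expr2; apply: (fil_le FF) (filM FF Fr' Fr'); lia.
have egy : exact F (r + r) (y ^+ 2 + y).
  rewrite (_ : _ + _ = g + (e ^+ 2 + e)); first exact: (exactD V eg).
  by apply: (eq_char2 ch (c := z * e)); rewrite yze /g; ring.
exists y; split=> //.
set G := step_fil r y F; set c' : int := c + r.
have V' := step_valued ch V o0 egy; rewrite -/r -/G in V'.
have GG := val_fil V'.
have FG s f : F s f -> G s f by exact: (step_filF o y V).
have ez : exact G r z.
  have ey : exact G r y.
    have := @step_exact_gen _ _ _ _ _ _ _ ch V o0 egy r 1.
    by rewrite mul1r; apply; rewrite subrr; apply: (exact1 V).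
  rewrite (_ : z = y + - e); last by rewrite yze addrK.
  apply: (exactD V' ey); apply: (filN GG); apply: FG.
  by apply: (fil_le FF) Fr'; lia.
have eg2 : exact F ((2 * o + 1) * (2 * u)) g.
  by rewrite (_ : _ * (2 * u) = r + r) //; rewrite /r; ring.
have dec l : exists q : int * (L * L), [/\ F q.1 q.2.1, F q.1 q.2.2
    & a l = q.2.1 ^+ 2 + g * q.2.2 ^+ 2].
  have [s [al [be [h1 h2 h3]]]] := odd_decomp ch V (tower_sqF ch perf ev_inj Q0 tw)
    eg2 (Fa l).
  by exists (s, (al, be)).
pose q l := proj1_sig (constructive_indefinite_description _ (dec l)).
have qP l : [/\ F (q l).1 (q l).2.1, F (q l).1 (q l).2.2
    & a l = (q l).2.1 ^+ 2 + g * (q l).2.2 ^+ 2].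
  exact: (proj2_sig (constructive_indefinite_description _ (dec l))).
pose al l := (q l).2.1; pose be l := (q l).2.2.
pose b l := al l + be l * z.
pose eta l := be l ^+ 2 * z.
have aE l : a l = eta l + b l ^+ 2.
  have [_ _ ea] := qP l; rewrite ea -[LHS](subrK (b l ^+ 2)); congr (_ + _).
  exact: (approx_error z ch (al l) (be l)).
have bound l e0 : F e0 (a l) -> [/\ G (e0 - r) (eta l), G e0 (b l ^+ 2)
    & forall w, e0 <= w + w + 1 -> G w (b l)].
  have [F1 F2 ea] := qP l; rewrite ea => Fe.
  exact: (approx_bound ch V o0 egy eg ez F1 F2 Fe).
have bexact l s e0 : e0 = (2 * s + 1) * (2 * u) -> exact F e0 (a l) ->
    exact G (e0 - r) (eta l) /\ exact G e0 (b l ^+ 2).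
  have [F1 F2 ea] := qP l; rewrite ea => es Fe.
  exact: (approx_exact ch V o0 egy eg ez es F1 F2 Fe).
(* The [a l] with [pos l = j] add up to g = 0^2 + g 1^2; by uniqueness of this decomposition the
   [al l] add up to 0 and the [be l] to 1. *)
have sumb : \sum_(l | pos l == j) b l = z.
  rewrite big_split -mulr_suml /=.
  have E : (\sum_(l | pos l == j) al l) ^+ 2 + g * (\sum_(l | pos l == j) be l) ^+ 2 = g.
    rewrite !sqr_sum mulr_sumr -big_split [RHS]gsum; apply: eq_bigr => l _.
    by have [_ _ ->] := qP l.
  move: E; set A := \sum_(l | _) al l; set B := \sum_(l | _) be l => E.
  have KA : K A /\ K B.
    pose s := \sum_l `|(q l).1|.
    have sl l : (q l).1 <= s.
      rewrite /s (bigD1 l) //=; have := sumr_ge0 (index_enum 'I_N) (fun i _ => normr_ge0 (q i).1) (P := fun i => i != l).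
      by move: (\sum_(i | i != l) _) => w0; lia.
    split; exists s; apply: (fil_sum FF) => l _; have [F1 F2 _] := qP l.
      by apply: (fil_le FF) F1.
    by apply: (fil_le FF) F2.
  (* Otherwise g would be the square of A / (B + 1), although its order is odd. *)
  have B1 : B = 1.
    apply/eqP; apply: NNPP => /negP B1.
    have b0 : B + 1 != 0 by rewrite addr_eq0 (oppr2 ch).
    have [wA FA] := KA.1; have [wB FB] := KB _ _ KA.2 K1; rewrite (oppr2 ch) in FB.
    have [w3 F3] := fil_divr V FA FB.
    apply: (odd_not_square ch V (m := o) F3).
    rewrite (_ : (A / (B + 1)) ^+ 2 = g) //.
    rewrite expr_div_n; apply: (mulIf (expf_neq0 2 b0)); rewrite mulfVK ?expf_neq0 //.
    apply: (eq_char2 ch (c := - (g * B) - g * B ^+ 2 )).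
    rewrite -[X in _ = X + _]addr0; move: E; set g' := g => E.
    have -> : A ^+ 2 = g' - g' * B ^+ 2 by rewrite -{1}E addrK.
    ring.
  have A0 : A = 0.
    move: E; rewrite B1 expr1n mulr1 -[RHS]add0r => /addIr /eqP.
    by rewrite sqrf_eq0 => /eqP.
  by rewrite A0 B1 mul1r add0r.
pose H := \sum_l vt n (pos l) (b l).
pose U' := U - H.
have lowH := wlow_sum (j := J) (fun l => wlow_vt (b l) (posj l)); rewrite -/H in lowH.
have lowU' : wlow j.+1 U'.
  have [l1 e1] := wlowB_comp (j := J) lowU lowH.1.
  move=> i; rewrite ltnS leq_eqVlt => /orP[/eqP ij|]; last exact: l1.
  have -> : i = J by apply: val_inj.
  rewrite e1 lowH.2 -/z (_ : \sum_l _ = z) ?subrr // -[RHS]sumb [RHS]big_mkcond.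
  by apply: eq_bigr => l _; rewrite vtE eq_sym.
have eU' : Fr U' - U' = wfamily n pos eta (fun l => b l ^+ 2) b.
  have -> : Fr U' - U' = (Fr U - U) - (Fr H - H).
    by rewrite /U' raddfB /= !opprB addrACA [RHS]addrACA; congr (_ + _); rewrite addrC.
  rewrite eU /H raddf_sum -!sumrB; apply: eq_bigr => l _.
  by rewrite /= Fr_vt -aE opprB addrA addrAC.
pose X := wfamily n pos eta (fun l => b l ^+ 2) b.
have X0 (i : 'I_n) : (i <= j)%N -> wcomp X i = 0.
  move=> ij; rewrite /X -eU'; have [ji|ji] := ltnP j.+1 n.
    have [l1 _] := wlowB_comp (j := Ordinal ji) (wlow_Fr lowU') lowU'.
    by apply: l1; rewrite ltnS.
  have U0 : U' = 0.
    apply: wvP => l; rewrite lowU'; first by rewrite /wcomp ffunE.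
    exact: leq_trans (ltn_ord l) ji.
  by rewrite U0 raddf0 subrr /wcomp ffunE.
(* Since b^2 has order at most e = D 2^m - c, this bounds the order of b by e - r, and by e - r - 1
   when m > j; the terms [b] then stay below the leading one. *)
have De (m : nat) : (j <= m)%N -> r + r + c + (if (j < m)%N then 1 else 0) <= D *+ 2 ^ m.
  move=> jm; rewrite (mulrn_exp2 _ jm) hD; case: ltnP => h.
    have : (2 <= 2 ^ (m - j))%N by rewrite -{1}(expn1 2) leq_exp2l // subn_gt0.
    by move: (2 ^ (m - j))%N => i i2; nia.
  have : (1 <= 2 ^ (m - j))%N by rewrite expn_gt0.
  by move: (2 ^ (m - j))%N => i i2; nia.
have c'0 : 0 < c' by rewrite /c'; lia.
have Xbound (m : 'I_n) : G (D *+ 2 ^ m - c' *+ 2) (wcomp X m - wlead pos eta (fun l => b l ^+ 2) b m).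
  apply: (wfamily_bound GG); first by lia.
  - move=> l; have [h _ _] := bound l _ (Fa l).
    by rewrite (_ : _ - c' = D *+ 2 ^ pos l - c - r) // /c'; lia.
  - by move=> l; have [_ h _] := bound l _ (Fa l); apply: (fil_le GG) h; lia.
  move=> l; have [_ _] := bound l _ (Fa l); apply.
  by have := De _ (posj l); rewrite /c'; case: ifP => _; lia.
(* Only the term of l0 in [wlead] reaches the bound: its order is e0 - r plus 2^(m - pos l0) - 1
   times e0. All the others, and the remainder of [Xbound], are smaller. *)
have Xexact (m : 'I_n) : (j < m)%N -> exact G (D *+ 2 ^ m - c') (wcomp X m).
  move=> jm; rewrite -[wcomp X m](subrK (wlead pos eta (fun l => b l ^+ 2) b m)) [X in exact _ _ X]addrC.
  have [l0 [e0 [s [pl0 el0 es ee0 others]]]] := lead m (ltnW jm) (ltn_ord m).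
  apply: (exactD V'); last by apply: (fil_le GG) (Xbound m); lia.
  rewrite /wlead (bigD1 l0) //= -addrA; apply: (exactD V').
    have [e1 e2] := bexact l0 s e0 es el0.
    have q0 : (0 < 2 ^ (m - pos l0))%N by rewrite expn_gt0.
    have eX i : exact G (e0 *+ i) ((b l0 ^+ 2) ^+ i).
      elim: i => [|i IH]; first by rewrite mulr0n; apply: (exact1 V').
      by rewrite exprS mulrS; apply: (valM V').
    rewrite (_ : D *+ 2 ^ m - c' = e0 - r + e0 *+ (2 ^ (m - pos l0)).-1).
      exact: (valM V' e1 (eX _)).
    by rewrite /c' opprD addrA -ee0 -{1}(prednK q0) mulrS; lia.
  apply: (filD GG); apply: (fil_sum GG) => l.
    move=> /andP[plm nl]; have [e1 Fe1 le1] := others l nl plm.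
    have [h1 h2 _] := bound l _ Fe1.
    have q0 : (0 < 2 ^ (m - pos l))%N by rewrite expn_gt0.
    apply: (fil_le GG) (filM GG h1 (filX GG (2 ^ (m - pos l)).-1 h2)).
    move: le1; rewrite -{1}(prednK q0) mulrS -[e1 *+ _]mulr_natr natz /c'; lia.
  move=> /eqP pl; have [_ _] := bound l _ (Fa l); apply.
  by have := De _ (ltnW jm); rewrite jm pl /c'; lia.
(* The new family is the component decomposition of X; [maxn] only moves the zero entries with index
   at most j to an admissible position. At component m the entry m leads, since an earlier entry l
   loses 2^(m-l) c' instead of c'. *)
exists U', n, (fun i : 'I_n => maxn i j.+1), (fun i => wcomp X i); split.
- split=> //; first exact: towerS.
  + move=> i; pose K' f := exists w, G w f.
    have K'sub f : K f -> K' f by move=> [w1 Fw1]; exists w1; apply: FG.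
    have K'1 : K' 1 by apply: K'sub.
    have K'B a1 b1 : K' a1 -> K' b1 -> K' (a1 - b1).
      move=> [w1 F1] [w2 F2]; exists (`|w1| + `|w2|).
      by apply: (filB GG); [apply: (fil_le GG) F1 | apply: (fil_le GG) F2]; lia.
    have K'M a1 b1 : K' a1 -> K' b1 -> K' (a1 * b1).
      by move=> [w1 F1] [w2 F2]; exists (w1 + w2); apply: (filM GG).
    have K'0 : K' 0 by exists 0; apply: (fil0 GG).
    rewrite /U' opprB addrA addrAC -[H]opprK -[- H]sub0r.
    apply: (wv_closed (S := K')) => // {}i; first by apply: K'sub; exact: YU.
    apply: (wv_closed (S := K')) => // {}i; first by rewrite /wcomp ffunE.
    apply: (wv_closed_sum (S := K')) => // l {}i; rewrite vtE; case: ifP => // _.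
    have [_ _ hb] := bound l _ (Fa l); exists `|D *+ 2 ^ pos l - c|; apply: hb; lia.
  + move=> i; rewrite ltnS leq_eqVlt => /orP[/eqP ij|ij].
      have -> : i = J by apply: val_inj.
      exists r', 1; split=> //; first exact: (rp1 RR).
      by rewrite mul1r /y addrC subrK.
    by exists (wcomp Y i), 0; rewrite mul0r addr0; split=> //; [exact: RY | exact: (rp0 RR)].
- rewrite eU' -/X [LHS]wv_decomp; apply: eq_bigr => i _.
  have [ij|ij] := leqP i j; first by rewrite X0 // !vt0.
  by rewrite (maxn_idPl _).
- by move=> l; rewrite leq_maxr.
- move=> l; have [lj|lj] := leqP l j; first by rewrite X0 //; apply: (fil0 GG).
  by rewrite (maxn_idPl _) //; exact: (Xexact l lj).1.
move=> m jm mn; have [s es] := hodd m jm mn.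
exists (Ordinal mn), (D *+ 2 ^ m - c'), s; split=> //=.
- by rewrite (maxn_idPl _).
- exact: (Xexact (Ordinal mn)).
- by rewrite (maxn_idPl _) // subnn mulr1n.
move=> l; rewrite -val_eqE /= => nl plm.
have [lj|lj] := leqP l j.
  (* The entry is 0, so any sufficiently negative order will do. *)
  exists (- `|D *+ 2 ^ m - c'| - 1); first by rewrite X0 //; apply: (fil0 GG).
  have : (0 < 2 ^ (m - maxn l j.+1))%N by rewrite expn_gt0.
  by move: (2 ^ (m - maxn l j.+1))%N => i i0; rewrite -mulr_natr natz; nia.
exists (D *+ 2 ^ l - c'); first exact: (Xexact l lj).1.
rewrite (maxn_idPl lj) in plm *.
have lm : (l < m)%N by rewrite ltn_neqAle nl plm.
rewrite (mulrn_exp2 D plm) -[X in X < _]mulr_natr natz mulrBl.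
have : (2 <= 2 ^ (m - l))%N by rewrite -{1}(expn1 2) leq_exp2l // subn_gt0.
by move: (2 ^ (m - l))%N => i i2; nia.
Qed.
End WittTower.

(** * Places and differentials *)

Section MaximalIdeal.
Variables (k L : fieldType) (ev : {rmorphism {poly k} -> L}) (R : L -> Prop).
Hypothesis ch : 2%N \in [pchar L].
Hypothesis RR : ring_pred ev R.

Record ideal (M : L -> Prop) : Prop := Ideal {
  id_sub : forall a, M a -> R a;
  id0 : M 0;
  idB : forall a b, M a -> M b -> M (a - b);
  idM : forall r a, R r -> M a -> M (r * a);
  id1 : ~ M 1 }.

Lemma maximal_ideal (I : L -> Prop) : ideal I ->
  exists M, [/\ ideal M, forall a, I a -> M a
    & forall a b, R a -> R b -> M (a * b) -> M a \/ M b].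
Proof.
move=> II; pose P (A : L -> Prop) := (forall a, ~ A a) \/ (ideal A /\ forall a, I a -> A a).
have [] := @classical_sets.Zorn_bigcup L P.
  move=> C CP Ct; case: (classic (exists X a, C X /\ X a)) => [[X0 [a0 [C0 Xa0]]]|nC].
    have CI X a : C X -> X a -> ideal X /\ forall a, I a -> X a.
      by move=> CX Xa; case: (CP X CX) => // h; case: (h a Xa).
    have [I0 IX0] := CI _ _ C0 Xa0.
    right; split; last by move=> a /IX0 ?; exists X0.
    split.
    - by move=> a [X CX Xa]; apply: (id_sub (CI _ _ CX Xa).1).
    - by exists X0 => //; apply: (id0 I0).
    - move=> a b [X CX Xa] [Y CY Yb]; have [XI _] := CI _ _ CX Xa; have [YI _] := CI _ _ CY Yb.
      case: (Ct X Y CX CY) => h; [exists Y | exists X] => //.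
        by apply: (idB YI) => //; apply: h.
      by apply: (idB XI) => //; apply: h.
    - move=> r a Rr [X CX Xa]; exists X => //; apply: (idM (CI _ _ CX Xa).1) => //.
    - by move=> [X CX X1]; apply: (id1 (CI _ _ CX X1).1).
  by left=> a [X CX Xa]; apply: nC; exists X, a.
move=> M [PM Mmax]; have MM : ideal M /\ forall a, I a -> M a.
  case: PM => // nM; exfalso; apply: (Mmax I); last by right; split.
  by split=> [a /nM|h] //; apply: (nM 0); apply: h; apply: (id0 II).
have {}[MI IM] := MM; exists M; split=> // a b Ra Rb Mab.
case: (classic (M a)) => [|nMa]; [by left | right].
pose B c := exists m r, [/\ M m, R r & c = m + r * a].
have BM c : M c -> B c.
  by move=> Mc; exists c, 0; rewrite mul0r addr0; split=> //; exact: rp0 RR.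
have Ba : B a by exists 0, 1; rewrite mul1r add0r; split=> //; [exact: (id0 MI) | exact: rp1 RR].
(* M + R a strictly contains M, so by maximality it is not a proper ideal. *)
have [m [r [Mm Rr e]]] : B 1.
  apply: NNPP => nB1; apply: (Mmax B); first by split=> [//|h]; apply: nMa; apply: h.
  right; split; last by move=> c /IM /BM.
  split=> // [_ [m [r [Mm Rr ->]]]||_ _ [m [r [Mm Rr ->]]] [m' [r' [Mm' Rr' ->]]]|s _ Rs [m [r [Mm Rr ->]]]].
  - by apply: (rpD ch RR); [exact: (id_sub MI) | exact: (rpM RR)].
  - by apply/BM/(id0 MI).
  - by exists (m - m'), (r - r'); split; [exact: (idB MI) | exact: (rpB RR) | ring].
  - by exists (s * m), (s * r); split; [exact: (idM MI) | exact: (rpM RR) | ring].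
have -> : b = b * m - r * (a * b).
  by rewrite (oppr2 ch) -{1}[b]mulr1 e; ring.
by apply: (idB MI); apply: (idM MI).
Qed.
End MaximalIdeal.

Definition pbool (P : Prop) : bool := if excluded_middle_informative P then true else false.
Lemma pboolP P : reflect P (pbool P).
Proof. by rewrite /pbool; case: excluded_middle_informative => h; constructor. Qed.

(** * Places over the affine line as localizations of the affine ring *)

Section FinitePlaces.
Variables (k L : fieldType) (ev : {rmorphism {poly k} -> L}) (Q : int).
Hypothesis ch : 2%N \in [pchar L].
Hypothesis perf : forall c : k, exists b, c = b ^+ 2.
Hypothesis ev_inj : forall p : {poly k}, ev p = 0 -> p = 0.
Hypothesis Q0 : 0 < Q.
Local Notation x := (ev 'X).
Variables (u c : int) (F : int -> L -> Prop) (R : L -> Prop).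
Hypothesis tw : tower ev Q u c F R.
Hypothesis F_full : forall f, exists z, F z f.
Let RR := tower_ring ch tw.
Let V := tower_valued ch ev_inj Q0 tw.

Lemma full_sq_free al be : al ^+ 2 + x * be ^+ 2 = 0 -> al = 0 /\ be = 0.
Proof.
have FF := val_fil V; have [z1 F1] := F_full al; have [z2 F2] := F_full be.
apply: (@sq_free _ _ _ _ _ _ ch V (tower_odd ch perf ev_inj Q0 tw) (`|z1| + `|z2|)).
  by apply: (fil_le FF) F1; lia.
by apply: (fil_le FF) F2; lia.
Qed.

(** The square of gcd(q, r) divides p. As r^2 is the derivative of p, this is the separability of
    p. *)
Lemma irreducible_sq (p q r : {poly k}) : irreducible_poly p -> p = q ^+ 2 + 'X * r ^+ 2 ->
  exists v w, v * q + w * r = 1.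
Proof.
move=> ip e; suff /Bezout_eq1_coprimepP [[v w] /= h] : coprimep q r by exists v, w.
rewrite coprimep_def; set g := gcdp q r.
have gp : g ^+ 2 %| p.
  rewrite e dvdp_add //; first by rewrite dvdp_exp2r // dvdp_gcdl.
  by apply: dvdp_mull; rewrite dvdp_exp2r // dvdp_gcdr.
have p0 : p != 0 by apply: irredp_neq0.
have g0 : g != 0 by apply: contraTneq gp => ->; rewrite expr0n dvd0p.
apply/eqP; apply: NNPP => g1.
have gdp : g %| p by apply: dvdp_trans gp; rewrite expr2 dvdp_mulr.
have := ip.2 g; move=> /(_ _ gdp) eg; have {}eg : g %= p by apply: eg; apply/eqP.
have := dvdp_leq p0 gp; rewrite expr2 -(eqp_size eg).
have [h1 _ h3] := size_mulS g0 g0.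
by move: g1 h1 h3; move: (size (g * g)%R) (size g) => i j; lia.
Qed.

(* R / p R is reduced for p irreducible, since p is separable *)
Lemma reduced p : irreducible_poly p -> forall t a, R t -> R a ->
  t ^+ 2 = ev p * a -> exists b, R b /\ t = ev p * b.
Proof.
move=> ip t a Rt Ra e; have [q [r ep]] := poly_sq ch perf ev_inj p.
have [v [w evw]] := irreducible_sq ip ep.
have [al [be [Ral Rbe ea]]] := tower_sqR ch perf ev_inj tw Ra.
have Evw : ev v * ev q + ev w * ev r = 1 by rewrite -!rmorphM -rmorphD evw rmorph1.
have Ep : ev p = ev q ^+ 2 + x * ev r ^+ 2 by rewrite ep rmorphD rmorphXn (rmorphM _ 'X) rmorphXn.
(* Expanding t^2 = p a with p = q^2 + x r^2 and a = al^2 + x be^2, uniqueness of the decomposition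
   gives t = q al + x r be and q be = r al. *)
have [] := @full_sq_free (t + (ev q * al + x * ev r * be)) (ev q * be + ev r * al).
  rewrite (_ : _ + _ = t ^+ 2 + (ev q ^+ 2 + x * ev r ^+ 2) * (al ^+ 2 + x * be ^+ 2) +
    ((t * (ev q * al + x * ev r * be) + x * ev q * ev r * al * be + x * ev q * ev r * al * be) +
    (t * (ev q * al + x * ev r * be) + x * ev q * ev r * al * be + x * ev q * ev r * al * be)));
    last by ring.
  by rewrite -Ep -ea -e !(addrr2 ch).
move=> /eqP; rewrite addr_eq0 (oppr2 ch) => /eqP et.
move=> /eqP; rewrite addr_eq0 (oppr2 ch) => /eqP ebe.
(* Bezout turns q be = r al into al = q g and be = r g, whence t = p g. *)
pose g := ev v * al + ev w * be.
have ga : ev q * g = al.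
  rewrite -[RHS]mul1r -Evw /g; transitivity (ev v * ev q * al + ev w * (ev q * be)); first by ring.
  by rewrite ebe; ring.
have gb : ev r * g = be.
  rewrite -[RHS]mul1r -Evw /g; transitivity (ev v * (ev r * al) + ev w * ev r * be); first by ring.
  by rewrite -ebe; ring.
exists g; split.
  by apply: (rpD ch RR); apply: (rpM RR) => //; exact: (rp_ev RR).
by rewrite et Ep -{1}ga -gb; ring.
Qed.

Section Localization.
Variable (M : L -> Prop) (p : {poly k}).
Hypothesis MI : ideal R M.
Hypothesis M_prime : forall a b, R a -> R b -> M (a * b) -> M a \/ M b.
Hypothesis ip : irreducible_poly p.
Hypothesis Mp : M (ev p).

Let Rev q : R (ev q). Proof. exact: (rp_ev RR). Qed.
Let M_mulN a b : R a -> R b -> ~ M a -> ~ M b -> ~ M (a * b).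
Proof. by move=> Ra Rb na nb /(M_prime Ra Rb) []. Qed.
Let p0 : ev p != 0. Proof. apply: ev_neq0 => //; exact: irredp_neq0. Qed.

Lemma M_poly q : M (ev q) -> p %| q.
Proof.
move=> Mq; apply: NNPP => /negP npq.
have /Bezout_eq1_coprimepP [[v w] /= h] : coprimep p q.
  rewrite coprimep_def; apply: contraNT npq => g1.
  by rewrite -(eqp_dvdl _ (ip.2 _ g1 (dvdp_gcdl p q))) dvdp_gcdr.
apply: (id1 MI); rewrite -(rmorph1 ev) -h rmorphD !rmorphM.
rewrite -[ev w * _](oppr2 ch); apply: (idB MI); exact: (idM MI).
Qed.

(* the maximal ideal is generated by p in the localization *)
Lemma tower_uniformizer u' c' F' R' : tower ev Q u' c' F' R' -> (forall f, R' f -> R f) ->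
  forall m, R' m -> M m -> exists s t, [/\ R s, ~ M s, R t & s * m = ev p * t].
Proof.
elim=> [_ _ [q ->] /M_poly /dvdpP [r ->]|{}u' {}c' o {}F' {}R' y tw' IH o0 Rg eg sub _ [a [b [Ra Rb ->]]] Mm].
  exists 1, (ev r); rewrite mul1r mulrC rmorphM; split=> //; [exact: rp1 RR | exact: (id1 MI)].
have sub' f : R' f -> R f by move=> Rf; apply: sub; exists f, 0; rewrite mul0r addr0; split=> //; exact: rp0 (tower_ring ch tw').
have RN := tower_conj ch tw' Rg Ra Rb.
have Ry : R y.
  by apply: sub; exists 0, 1; rewrite mul1r add0r; split=> //; [exact: rp0 (tower_ring ch tw') | exact: rp1 (tower_ring ch tw')].
have Rm : R (a + b * y) by apply: (id_sub MI).
have eN : step_norm y a b = (a + b * y) * (a + b * y + b) by rewrite (step_normE y ch); ring.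
have [] := IH sub' _ RN; first by rewrite eN mulrC; apply: (idM MI) => //; apply: (rpD ch RR) => //; exact: sub'.
move=> s [t [Rs ns Rt e]]; rewrite eN in e.
have Rmb : R (a + b * y + b) by apply: (rpD ch RR) => //; exact: sub'.
(* With m = a + b y in M the conjugate is m + b. If b is outside M so is m + b, and the relation for
   the norm is enough. *)
case: (classic (M b)) => [Mb|nMb]; last first.
  exists (s * (a + b * y + b)), t; split=> //; first exact: (rpM RR).
    apply: M_mulN => // Mmb; apply: nMb.
    by rewrite -(addKr (a + b * y) b) addrC; apply: (idB MI).
  by rewrite -e; ring.
have [s' [t' [Rs' ns' Rt' e']]] := IH sub' _ Rb Mb.
have Rss : R (s * s') by apply: (rpM RR).
(* m^2 = m (m + b) - m b, and p divides both terms once s and s' are multiplied in; [reduced] then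
   extracts p from s s' m itself. *)
have E : (s * s' * (a + b * y)) ^+ 2 = ev p * (s * s' * (s' * t - s * (a + b * y) * t')).
  transitivity (s * s' * (s' * (s * ((a + b * y) * (a + b * y + b))) - s * (a + b * y) * (s' * b))); first by ring.
  by rewrite e e'; ring.
have R1 : R (s * s' * (a + b * y)) by apply: (rpM RR).
have R2 : R (s * s' * (s' * t - s * (a + b * y) * t')).
  apply: (rpM RR) => //; apply: (rpB RR); first exact: (rpM RR).
  by apply: (rpM RR) => //; apply: (rpM RR).
have [d [Rd ed]] := reduced ip R1 R2 E.
by exists (s * s'), d; split=> //; apply: M_mulN.
Qed.

(** As long as g lies in M a factor p is split off and e decreases; at e = 0, g divides w and so
    lies outside M. *)
Lemma local_factor e : forall g g' w, R g -> R g' -> R w -> ~ M w ->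
  g * g' = ev p ^+ e * w ->
  exists e' s t, [/\ R s, R t, ~ M s, ~ M t & s * g = ev p ^+ e' * t].
Proof.
elim: e => [|e IH] g g' w Rg Rg' Rw nw eg.
  exists 0%N, 1, g; rewrite !mul1r; split=> //; [exact: rp1 RR | exact: (id1 MI) |].
  by move=> Mg; apply: nw; rewrite -[w]mul1r -[1](expr0 (ev p)) -eg mulrC; apply: (idM MI).
case: (classic (M g)) => [Mg|nMg]; last first.
  by exists 0%N, 1, g; rewrite !mul1r; split=> //; [exact: rp1 RR | exact: (id1 MI)].
have [s [t [Rs ns Rt e1]]] := tower_uniformizer tw (fun f Rf => Rf) Rg Mg.
have [] := IH t g' (w * s) Rt Rg' ltac:(exact: (rpM RR)) ltac:(exact: M_mulN).
  by apply: (mulfI p0); rewrite !mulrA -e1 -exprS -eg; ring.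
move=> e' [s' [t' [Rs' Rt' ns' nt' e2]]].
exists e'.+1, (s' * s), t'; split=> //; [exact: (rpM RR) | exact: M_mulN |].
by rewrite -mulrA e1 mulrCA e2 exprS mulrA.
Qed.

Lemma poly_factor (q : {poly k}) : q != 0 -> exists e r, q = p ^+ e * r /\ ~~ (p %| r).
Proof.
have [m] := ubnP (size q); elim: m q => // m IH q; rewrite ltnS => sq q0.
case: (boolP (p %| q)) => [/dvdpP [r er]|npq]; last first.
  by exists 0%N, q; rewrite mul1r.
have r0 : r != 0 by apply: contraNneq q0 => r0; rewrite er r0 mul0r.
have pn0 : p != 0 by exact: irredp_neq0.
have [] := IH r _ r0.
  have [h1 h2 h3] := size_mulS r0 pn0; have := ip.1; move: sq; rewrite er.
  by move: h1 h2 h3; move: (size (r * p)%R) (size r) (size p) => i j l; lia.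
move=> e [r' [e1 n1]]; exists e.+1, r'; split=> //.
by rewrite er e1 exprS; ring.
Qed.

Definition local_ring (f : L) : Prop := exists s, [/\ R s, ~ M s & R (s * f)].

(** An element of L is a quotient of an element of R by a polynomial. Both divide nonzero
    polynomials, hence are powers of p up to local units, and comparing exponents decides between f
    and f^-1. *)
Lemma local_val_ring : val_ring ev local_ring.
Proof.
split.
- move=> a b [s [Rs ns Ra]] [s' [Rs' ns' Rb]]; exists (s * s'); split.
  + exact: (rpM RR).
  + exact: M_mulN.
  + rewrite (_ : _ * _ = s' * (s * a) - s * (s' * b)); last by ring.
    by apply: (rpB RR); apply: (rpM RR).
- move=> a b [s [Rs ns Ra]] [s' [Rs' ns' Rb]]; exists (s * s'); split.
  + exact: (rpM RR).
  + exact: M_mulN.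
  + rewrite (_ : _ * _ = (s * a) * (s' * b)); last by ring.
    exact: (rpM RR).
- by move=> b; exists 1; rewrite mul1r; split=> //; [exact: rp1 RR | exact: (id1 MI)].
have fact g : R g -> g <> 0 -> exists e' s t, [/\ R s, R t, ~ M s, ~ M t & s * g = ev p ^+ e' * t].
  move=> Rg g0; have [g' [q [Rg' q0 eg]]] := tower_norm ch ev_inj Q0 tw Rg g0.
  have [e [r [eq nr]]] := poly_factor q0.
  apply: (@local_factor e g g' (ev r)) => //; first by move/M_poly; apply/negP.
  by rewrite eg eq rmorphM rmorphXn.
have key f e1 e2 s1 s2 t1 t2 : R s1 -> R s2 -> R t1 -> R t2 -> ~ M s1 -> ~ M t2 -> 
    (e2 <= e1)%N -> s1 * t2 * ev p ^+ e2 * f = s2 * t1 * ev p ^+ e1 -> local_ring f.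
  move=> R1 R2 R3 R4 n1 n2 le e; exists (s1 * t2); split.
  + exact: (rpM RR).
  + exact: M_mulN.
  have pe : ev p ^+ e2 != 0 by rewrite expf_neq0.
  have -> : s1 * t2 * f = s2 * t1 * ev p ^+ (e1 - e2).
    by apply: (mulIf pe); rewrite mulrAC e -[RHS]mulrA -exprD subnK.
  by apply: (rpM RR); [exact: (rpM RR) | rewrite -rmorphXn].
move=> f; have [z Ff] := F_full f; have [q [q0 Rf]] := tower_frac ch tw Ff.
have [f0|/eqP f0] := eqVneq f 0.
  left; exists 1; rewrite f0 mulr0; split; [exact: rp1 RR | exact: (id1 MI) | exact: rp0 RR].
have q1 : ev q <> 0 by apply/eqP; apply: ev_neq0.
have fq0 : f * ev q <> 0 by apply/eqP; rewrite mulf_neq0 //; apply/eqP.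
have [e1 [s1 [t1 [R1 R3 n1 n3 E1]]]] := fact _ Rf fq0.
have [e2 [s2 [t2 [R2 R4 n2 n4 E2]]]] := fact _ (Rev q) q1.
have E : s1 * t2 * ev p ^+ e2 * f = s2 * t1 * ev p ^+ e1.
  transitivity (s1 * f * (ev p ^+ e2 * t2)); first by ring.
  rewrite -E2; transitivity (s2 * (s1 * (f * ev q))); first by ring.
  by rewrite E1; ring.
have [le|lt] := leqP e2 e1; [left; exact: (key _ _ _ _ _ _ _ R1 R2 R3 R4 n1 n4 le E) | right].
apply: (key _ _ _ _ _ _ _ R2 R1 R4 R3 n2 n3 (ltnW lt)).
have f1 : f != 0 by apply/eqP.
by apply: (mulIf f1); rewrite mulfVK // -E; ring.
Qed.

Lemma local_place : is_place (ev \o polyC) [pred f | pbool (local_ring f)].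
Proof.
have OO := local_val_ring.
split=> [|b|f|].
- split=> [|a b|a b]; rewrite ?inE /=.
  + by apply/pboolP; have := vr_const OO 1; rewrite !rmorph1.
  + by move=> /pboolP Oa /pboolP Ob; apply/pboolP; apply: (vr_B OO).
  + by move=> /pboolP Oa /pboolP Ob; apply/pboolP; apply: (vr_M OO).
- by rewrite inE; apply/pboolP; apply: (vr_const OO).
- by case: (vr_V OO f) => h; [left | right]; rewrite inE; apply/pboolP.
exists (ev p)^-1; rewrite inE; apply/pboolP => -[s [Rs ns Rsp]].
by apply: ns; rewrite -(mulfVK p0 s); apply: (idM MI).
Qed.

(** Since be^2 is the derivative of al^2 + x be^2, this makes the local ring stable under d/dx: the
    curve is unramified over the affine line there. *)
Lemma local_sq f : local_ring f ->
  exists al be, local_ring be /\ f = al ^+ 2 + x * be ^+ 2.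
Proof.
move=> [s [Rs ns Rf]].
have [al [be [Ra Rb e]]] := tower_sqR ch perf ev_inj tw (rpM RR Rs Rf).
have s0 : s != 0 by apply/eqP => s0; apply: ns; rewrite s0; exact: (id0 MI).
exists (al / s), (be / s); split; first by exists s; rewrite mulrCA mulfV // mulr1.
rewrite !expr_div_n mulrA -mulrDl -e mulrA -expr2 mulrAC mulfV ?mul1r //.
exact: expf_neq0.
Qed.
End Localization.

(** The denominators of a form a proper ideal, contained in a maximal one. That one contains a
    polynomial, hence an irreducible p, and localizing at it excludes a. *)
Lemma finite_place_exists a : ~ R a -> exists O : {pred L},
  [/\ is_place (ev \o polyC) O, x \in O, a \notin O
    & forall f, f \in O -> exists al be, be \in O /\ f = al ^+ 2 + x * be ^+ 2].
Proof.
move=> na; pose I s := R s /\ R (s * a).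
have II : ideal R I.
  split=> [s []//||s t [Rs Rsa] [Rt Rta]|r s Rr [Rs Rsa]|[_]].
  - by split; rewrite ?mul0r; exact: rp0 RR.
  - by split; rewrite ?mulrBl; apply: (rpB RR).
  - by split; rewrite -?mulrA; apply: (rpM RR).
  by rewrite mul1r.
have [M [MI IM M_prime]] := maximal_ideal ch RR II.
have [z Fa] := F_full a; have [q [q0 Rq]] := tower_frac ch tw Fa.
have Mq : M (ev q) by apply: IM; split; [exact: (rp_ev RR) | rewrite mulrC].
have [p [ip Mp]] : exists p, irreducible_poly p /\ M (ev p).
  have [m] := ubnP (size q); elim: m q q0 {Rq} Mq => // m IH q q0 Mq sq.
  case: (classic (irreducible_poly q)) => [iq|niq]; first by exists q.
  have sq1 : (1 < size q)%N.
    rewrite ltnNge; apply/negP => /size1_polyC eq; apply: (id1 MI).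
    have l0 : q`_0 != 0 by apply: contraNneq q0 => l0; rewrite eq l0.
    rewrite -(rmorph1 ev) -[1]/(1%:P) -(mulVf l0) polyCM rmorphM -eq.
    by apply: (idM MI) => //; exact: (rp_ev RR).
  have [d [sd dq nd]] : exists d : {poly k}, [/\ size d != 1%N, d %| q & ~ (d %= q)].
    apply: NNPP => h; apply: niq; split=> // d sd dq; apply: NNPP => nd.
    by apply: h; exists d; split=> //; apply/negP.
  have d0 : d != 0 by apply: contraTneq dq => ->; rewrite dvd0p.
  have /dvdpP [r er] := dq.
  have r0 : r != 0 by apply: contraNneq q0 => r0; rewrite er r0 mul0r.
  have [h1 h2 h3] := size_mulS r0 d0; rewrite -er in h3.
  have sr : size r <> 1%N.
    move=> sr; apply: nd; rewrite -dvdp_size_eqp //.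
    by apply/eqP; move: h3 sr; move: (size q) (size d) (size r) => i j l; lia.
  rewrite er rmorphM in Mq.
  have [Mr|Md] := M_prime _ _ (rp_ev RR r) (rp_ev RR d) Mq.
    by apply: (IH r r0 Mr); move: sq sd h1 h2 h3; move: (size q) (size r) (size d) => ? ? ?; lia.
  by apply: (IH d d0 Md); move: sq sr h1 h2 h3; move: (size q) (size r) (size d) => ? ? ?; lia.
pose O : {pred L} := [pred f | pbool (local_ring M f)].
have OP f : reflect (local_ring M f) (f \in O) by rewrite /O inE; exact: pboolP.
exists O; split.
- exact: (local_place MI M_prime ip Mp).
- by apply/OP; exists 1; rewrite mul1r; split; [exact: rp1 RR | exact: (id1 MI) | exact: (rp_ev RR)].
- by apply/OP => -[s [Rs ns Rsa]]; apply: ns; apply: IM; split.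
move=> f /OP /(local_sq MI) [al [be [Ob e]]].
by exists al, be; split=> //; apply/OP.
Qed.
End FinitePlaces.

(** * The derivation d/dx, global differentials and the kernel of the Cartier operator *)

Section Differentials.
Variables (k L : fieldType) (ev : {rmorphism {poly k} -> L}) (Q : int).
Hypothesis ch : 2%N \in [pchar L].
Hypothesis perf : forall c : k, exists b, c = b ^+ 2.
Hypothesis ev_inj : forall p : {poly k}, ev p = 0 -> p = 0.
Hypothesis Q0 : 0 < Q.
Local Notation x := (ev 'X).

(** If f has order 2u, then y f^(-o) has order u (2o + 1) - 2u o = u. *)
Lemma tower_unif u c F R : tower ev Q u c F R -> exists f, exact F u f.
Proof.
elim=> [|{}u {}c o {}F {}R y tw [f ef] o0 Rg eg].
  exists x; have E : x * ev 1 = x by rewrite rmorph1 mulr1.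
  rewrite (rat_fil_exact ev_inj Q0 (q := 1) _ _ _ E) ?oner_eq0 ?polyX_eq0 //.
  by rewrite size_polyX size_poly1; lia.
have V := tower_valued ch ev_inj Q0 tw.
case: o o0 eg => // o o0 eg.
have eX m : exact F (- (2 * u) * m%:Z) (f^-1 ^+ m).
  elim: m => [|m IH]; first by rewrite mulr0; apply: (exact1 V).
  rewrite exprS (_ : _ * _ = - (2 * u) + - (2 * u) * m%:Z); last by lia.
  by apply: (valM V) => //; apply: (exactV V).
exists (f^-1 ^+ o * y); apply: (step_exact_gen ch V o0 eg).
by rewrite (_ : u - _ = - (2 * u) * o%:Z) //; ring.
Qed.

Variables (c : int) (F : int -> L -> Prop) (R : L -> Prop).
Hypothesis tw : tower ev Q 1 c F R.
Hypothesis F_full : forall f, exists z, F z f.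
Let RR := tower_ring ch tw.
Let V1 := tower_valued ch ev_inj Q0 tw.
Let FF := val_fil V1.

Lemma full_sq f : exists be, exists al, f = al ^+ 2 + x * be ^+ 2.
Proof.
have [z Ff] := F_full f.
have [s [al [be [_ _ e]]]] := tower_sqF ch perf ev_inj Q0 tw Ff.
by exists be, al.
Qed.

(** The derivation d/dx; by [full_sq_free] the choice of the decomposition does not matter. *)
Definition ddx (f : L) : L :=
  proj1_sig (constructive_indefinite_description _ (full_sq f)) ^+ 2.

Lemma ddxE f al be : f = al ^+ 2 + x * be ^+ 2 -> ddx f = be ^+ 2.
Proof.
move=> e; rewrite /ddx; case: constructive_indefinite_description => be' /= [al' e'].
have [] := full_sq_free ch perf ev_inj Q0 tw F_full (al := al + al') (be := be + be').
  rewrite (_ : _ + _ = (al ^+ 2 + x * be ^+ 2) + (al' ^+ 2 + x * be' ^+ 2) +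
    ((al * al' + x * be * be') + (al * al' + x * be * be'))); last by ring.
  by rewrite -e -e' !(addrr2 ch).
by move=> _ /eqP; rewrite addr_eq0 (oppr2 ch) => /eqP ->.
Qed.

Lemma ddx_fil t f : F t f -> F (t + (c - Q)) (ddx f).
Proof.
move=> Ft; have [be [al e]] := full_sq f; rewrite (ddxE e).
have [z1 F1] := F_full al; have [z2 F2] := F_full be.
apply: (sq_deriv_fil ch V1 (tower_sqF ch perf ev_inj Q0 tw) (tower_odd ch perf ev_inj Q0 tw)
  (s := `|z1| + `|z2|) (al := al)).
- by apply: (fil_le FF) F1; lia.
- by apply: (fil_le FF) F2; lia.
- by rewrite -e.
Qed.

Lemma ddx_exact m f : exact F (2 * m + 1) f -> exact F (2 * m + 1 + (c - Q)) (ddx f).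
Proof.
move=> Ft; have [be [al e]] := full_sq f; rewrite (ddxE e).
have [z1 F1] := F_full al; have [z2 F2] := F_full be.
have := sq_deriv_exact ch V1 (tower_sqF ch perf ev_inj Q0 tw) (tower_odd ch perf ev_inj Q0 tw)
  (s := `|z1| + `|z2|) (al := al) (be := be) (m := m).
rewrite mulr1 -e; apply=> //.
- by apply: (fil_le FF) F1; lia.
- by apply: (fil_le FF) F2; lia.
Qed.

Lemma ddxD f g : ddx (f + g) = ddx f + ddx g.
Proof.
have [be [al e]] := full_sq f; have [be' [al' e']] := full_sq g.
rewrite (ddxE e) (ddxE e') (@ddxE _ (al + al') (be + be')).
  by apply: (eq_char2 ch (c := be * be')); ring.
rewrite e e'; apply: (eq_char2 ch (c := - (al * al' + x * be * be'))); ring.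
Qed.

Lemma ddxM f g : ddx (f * g) = f * ddx g + g * ddx f.
Proof.
have [be [al e]] := full_sq f; have [be' [al' e']] := full_sq g.
rewrite (ddxE e) (ddxE e') (@ddxE _ (al * al' + x * be * be') (al * be' + al' * be)).
  rewrite e e'; apply: (eq_char2 ch (c := al * be' * (al' * be) - x * (be * be') ^+ 2)); ring.
rewrite e e'; apply: (eq_char2 ch (c := - (al * al' * x * be * be' + x * al * be' * (al' * be)))); ring.
Qed.

Lemma ddx_const b : ddx (ev b%:P) = 0.
Proof.
have [b' ->] := perf b; rewrite (@ddxE _ (ev b'%:P) 0) ?expr0n //.
by rewrite mulr0 addr0 rmorphXn rmorphXn.
Qed.

Lemma ddx_x : ddx x = 1.
Proof. by rewrite (@ddxE _ 0 1) ?expr1n // expr0n add0r mulr1. Qed.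

(** Subtracting the residue, a constant killed by [ddx], lowers the order of f from 0 to -1. *)
Lemma ddx_regular f : F 0 f -> F (c - Q - 1) (ddx f).
Proof.
move=> Ff; have [ef|F1] := exact_or Ff; last first.
  by have := ddx_fil F1; rewrite (_ : 0 - 1 + (c - Q) = c - Q - 1) //; lia.
have [b Fb] := val_res V1 ef (exact1 V1).
have -> : ddx f = ddx (f - ev b%:P * 1).
  by rewrite mulr1 -[X in f - X](oppr2 ch) opprK ddxD ddx_const addr0.
by have := ddx_fil Fb; rewrite (_ : 0 - 1 + (c - Q) = c - Q - 1) //; lia.
Qed.

Variables (Omega : lmodType L) (D : L -> Omega) (V : Omega -> Omega).
Local Notation iota := (ev \o polyC : {rmorphism k -> L}).
Hypothesis hD : is_kaehler iota D.
Hypothesis hV : is_cartier D 2 V.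

Lemma D_ddx f : D f = ddx f *: D x.
Proof.
have [[DD DM _] _] := hD.
have D2 a : D (a ^+ 2) = 0 by rewrite expr2 DM -scalerDl (addrr2 ch) scale0r.
have [be [al e]] := full_sq f; rewrite (ddxE e) {1}e DD D2 add0r DM D2 scaler0 add0r //.
Qed.

Lemma ddx_derivation : is_derivation iota (ddx : L -> L^o).
Proof. by split=> [a b|a b|b]; [exact: ddxD | exact: ddxM | exact: ddx_const]. Qed.

(** The universal property turns the derivation [ddx] into a linear form with value 1 at [D x]. *)
Lemma Dx_free f : f *: D x = 0 -> f = 0.
Proof.
have [phi [phiD _]] := hD.2 _ _ ddx_derivation.
move=> e; have := congr1 phi e.
by rewrite linearZ linear0 phiD ddx_x; move=> <-; rewrite -[LHS]mulr1.
Qed.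

(** The identity and w -> phi(w) dx agree on all [D f], hence everywhere by the uniqueness in the
    universal property. *)
Lemma Dx_gen w : exists f, w = f *: D x.
Proof.
have [dD univ] := hD.
have [phi [phiD _]] := univ _ _ ddx_derivation.
have [phi0 [_ uniq]] := univ Omega D dD.
pose psi (v : Omega) : Omega := (phi v : L) *: D x.
have psi_lin : linear psi by move=> a v v'; rewrite /psi linearP scalerDl scalerA.
pose psi' : {linear Omega -> Omega} := HB.pack psi (GRing.isLinear.Build _ _ _ _ psi psi_lin).
exists (phi w); transitivity (phi0 w).
  by rewrite -(uniq idfun).
by rewrite -(uniq psi') // => f; rewrite [RHS]D_ddx /= /psi phiD.
Qed.

Lemma V_sq f : V (f ^+ 2 *: D x) = 0.
Proof. by have [_ VZ VD _] := hV; rewrite VZ VD scaler0. Qed.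

(** For f = al^2 + x be^2 one finds V(f dx) = be dx. *)
Lemma V_ker w : V w = 0 <-> exists a, w = a ^+ 2 *: D x.
Proof.
split=> [|[a ->]]; last exact: V_sq.
have [f ->] := Dx_gen w; have [be [al e]] := full_sq f.
have [VA VZ VD VX] := hV; rewrite {1}e scalerDl VA V_sq add0r mulrC -scalerA VZ.
have := VX x; rewrite expr1 => -> /Dx_free be0.
by exists al; rewrite e be0 expr0n mulr0 addr0.
Qed.

Lemma place_val_ring (O : {pred L}) : is_place iota O -> val_ring ev (fun f => f \in O).
Proof. by case=> [[O1 OB OM] Oc OV _]; split. Qed.

Lemma infinite_place : is_place iota [pred f | pbool (F 0 f)].
Proof.
split=> [|b|f|].
- split=> [|a b|a b]; rewrite ?inE /=.
  + by apply/pboolP; apply: (fil1 FF).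
  + by move=> /pboolP Oa /pboolP Ob; apply/pboolP; apply: (filB FF).
  + move=> /pboolP Oa /pboolP Ob; apply/pboolP; rewrite -(addr0 0); exact: (filM FF).
- by rewrite inE; apply/pboolP; apply: (val_const V1).
- have [->|/eqP f0] := eqVneq f 0.
    by left; rewrite inE; apply/pboolP; apply: (fil0 FF).
  have [z Ff] := F_full f; have [s [_ es]] := valE V1 Ff f0.
  have [s0|s0] := lerP (s * 1) 0; [left | right]; rewrite inE; apply/pboolP.
    by apply: (fil_le FF) es.1; lia.
  by apply: (fil_le FF) (exactV V1 es).1; lia.
have [f ef] := tower_unif tw; exists f; rewrite inE; apply/pboolP => Ff.
by have := exact_le V1 ef Ff.
Qed.

(** c - Q - 1 is 2g - 2, the order of the zero of dx at infinity, and t is half of it. At a finite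
    place from [finite_place_exists] the local ring is stable under [ddx], so regularity of a^2 dx
    puts a^2, and then a, in that ring. *)
Lemma global_exact a t : 2 * t <= c - Q - 1 -> c - Q - 1 <= 2 * t + 1 ->
  global_differential iota D (a ^+ 2 *: D x) <-> R a /\ F t a.
Proof.
move=> t1 t2; split=> [gl|[Ra Fa] O Opl].
  have reg (O : {pred L}) : is_place iota O -> exists m (f g : 'I_m -> L),
      (forall i, f i \in O /\ g i \in O) /\ a ^+ 2 = \sum_i f i * ddx (g i).
    move=> Opl; have [m [f [g [fg e]]]] := gl O Opl; exists m, f, g; split=> //.
    apply/eqP; rewrite -subr_eq0; apply/eqP/Dx_free.
    rewrite scalerBl e scaler_suml -sumrB big1 // => i _.
    by rewrite D_ddx scalerA subrr.
  split.
    apply: NNPP => nRa.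
    have [O [Opl Ox nOa Osq]] := finite_place_exists ch perf ev_inj Q0 tw F_full nRa.
    have OO := place_val_ring Opl.
    have [m [f [g [fg e]]]] := reg O Opl.
    move/negP: nOa; apply; apply: (vr_sqrt OO); rewrite e.
    apply: (big_ind (fun f => f \in O)) => [|u v|i _].
    - by rewrite -(subrr 1); apply: (vr_B OO); exact: (vr1 OO).
    - exact: (vrD ch OO).
    have [Of Og] := fg i; apply: (vr_M OO) => //.
    by have [al [be [Ob eg]]] := Osq _ Og; rewrite (ddxE eg) expr2; apply: (vr_M OO).
  have [m [f [g [fg e]]]] := reg _ infinite_place.
  have [z Fa] := F_full a.
  apply: (sqrt_bound V1 (t := c - Q - 1) Fa); last by lia.
  rewrite e; apply: (fil_sum FF) => i _; have [] := fg i; rewrite !inE.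
  move=> /pboolP Ff /pboolP Fg; rewrite -[c - Q - 1]add0r; apply: (filM FF) => //.
  exact: ddx_regular.
have OO := place_val_ring Opl.
case: (boolP (x \in O)) => Ox.
  exists 1%N, (fun _ => a ^+ 2), (fun _ => x); split; last by rewrite big_ord1.
  move=> _; split=> //; rewrite expr2.
  by have := tower_finite_place ch OO Ox tw Ra; move=> Oa; apply: (vr_M OO).
have [p ep] := tower_unif tw; have ep' := exactV V1 ep.
have Fin f : F 0 f -> f \in O.
  by apply: (tower_infinite_place ch ev_inj Q0 OO _ tw); apply/negP.
(* The uniformizer p^-1 has odd order -1, so its derivative has order exactly c - Q - 1; it
   generates the regular differentials at infinity. *)
have ed : exact F (c - Q - 1) (ddx p^-1).
  have := @ddx_exact (-1) p^-1; rewrite (_ : 2 * -1 + 1 = - 1) //.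
  by rewrite (_ : - 1 + (c - Q) = c - Q - 1); [apply | lia].
have d0 : ddx p^-1 != 0 by apply/eqP; exact: (exact_neq0 V1 ed).
exists 1%N, (fun _ => a ^+ 2 / ddx p^-1), (fun _ => p^-1); split; last first.
  by rewrite big_ord1 [D p^-1]D_ddx scalerA mulfVK.
move=> _; split; apply: Fin; last by apply: (fil_le FF) ep'.1; lia.
rewrite expr2; apply: (fil_le FF) (filM FF (filM FF Fa Fa) (exactV V1 ed).1); lia.
Qed.

(** a -> a^2 dx is additive and semilinear for squaring on k. As k is perfect it carries bases to
    bases, coefficients being replaced by their squares. *)
Lemma a_number_dim t N : 2 * t <= c - Q - 1 -> c - Q - 1 <= 2 * t + 1 ->
  kdim ev (fun f => R f /\ F t f) N -> is_a_number iota D V N.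
Proof.
move=> t1 t2 [e [span free]].
have sqrt_k (cf : 'I_N -> k) : exists b : 'I_N -> k, forall i, cf i = b i ^+ 2.
  exists (fun i => proj1_sig (constructive_indefinite_description _ (perf (cf i)))) => i.
  exact: (proj2_sig (constructive_indefinite_description _ (perf (cf i)))).
have sqr_sum (b : 'I_N -> k) : \sum_i iota (b i ^+ 2) *: (e i ^+ 2 *: D x) =
    (\sum_i ev (b i)%:P * e i) ^+ 2 *: D x.
  have -> : (\sum_i ev (b i)%:P * e i) ^+ 2 = \sum_i (ev (b i)%:P * e i) ^+ 2.
    by rewrite -[LHS]/(pFrobenius_aut ch _) rmorph_sum.
  rewrite scaler_suml; apply: eq_bigr => i _.
  by rewrite scalerA exprMn /= !rmorphXn.
exists (fun i => e i ^+ 2 *: D x); split=> [w|cf].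
  split=> [[gl /V_ker [a ew]]|[cf ->]].
    rewrite ew in gl *; have [Ra Fa] := (global_exact a t1 t2).1 gl.
    have [b ->] := (span a).1 (conj Ra Fa).
    by exists (fun i => b i ^+ 2); rewrite sqr_sum.
  have [b eb] := sqrt_k cf; under eq_bigr do rewrite eb; rewrite sqr_sum.
  split; last exact: V_sq.
  by apply/(global_exact _ t1 t2)/span; exists b.
have [b eb] := sqrt_k cf; under eq_bigr do rewrite eb; rewrite sqr_sum => /Dx_free /eqP.
by rewrite sqrf_eq0 => /eqP /free b0 i; rewrite eb b0 expr0n.
Qed.
End Differentials.

Lemma fraction_rep (R : idomainType) (f : {fraction R}) :
  exists p q, q != 0 /\ f * @tofrac R q = @tofrac R p.
Proof.
elim/quotW: f => r; exists r.1, r.2; split; first exact: denom_ratioP.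
unlock tofrac; rewrite -[LHS]FracField.pi_mul; apply/eqmodP => /=.
rewrite FracField.equivfE /FracField.mulf !numden_Ratio ?oner_eq0 ?mulf_neq0 ?denom_ratioP //.
all: by rewrite ?oner_eq0 // !mulr1 mulrC.
Qed.

Lemma adjoin_seq_ind (K : fieldType) (L : fieldExtType K) (S : L -> Prop) (rs : seq L) :
    (forall c, S (in_alg L c)) ->
    (forall a b, S a -> S b -> S (a + b)) -> (forall a b, S a -> S b -> S (a * b)) ->
    (forall a, a \in rs -> S a) ->
  forall v, v \in <<1 & rs>>%VS -> S v.
Proof.
move=> Sc SD SM; elim/last_ind: rs => [_ v|rs y IH Srs v].
  by rewrite adjoin_nil subfield_closed => /vlineP[c ->]; apply: Sc.
rewrite adjoin_rcons => /(@Fadjoin_polyP _ _ <<1 & rs>>%AS)[p /polyOverP pK ->].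
have Sy : S y by apply: Srs; rewrite mem_rcons mem_head.
have Sp i : S p`_i.
  by apply: IH (pK i) => a ars; apply: Srs; rewrite mem_rcons in_cons ars orbT.
have S0 : S 0 by rewrite -(rmorph0 (in_alg L)); exact: Sc.
have S1 : S 1 by rewrite -(rmorph1 (in_alg L)); exact: Sc.
rewrite horner_coef; apply: (big_ind S) => // i _; apply: (SM) => //.
by elim: (val i) => [|m IHm]; rewrite ?expr0 // exprS; apply: SM.
Qed.

(** * Numerical invariants of the tower and the final count *)

(* (4 ^ j - 1) / 3 *)
Fixpoint t4 (j : nat) : int := if j is i.+1 then 4 * t4 i + 1 else 0.

Lemma t4E j : (2 ^ j * 2 ^ j)%N%:Z = 3 * t4 j + 1.
Proof. by elim: j => // j IH; rewrite /= expnS; lia. Qed.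

Lemma t4_ge0 j : 0 <= t4 j. Proof. by elim: j => //= j; lia. Qed.

Lemma t4_odd j : exists2 s, 0 <= s & t4 j.+1 = 2 * s + 1.
Proof. by exists (2 * t4 j); have := t4_ge0 j; [lia | move=> _ /=; ring]. Qed.

Section Main.
Variables (k L : fieldType) (ev : {rmorphism {poly k} -> L}).
Hypothesis ch : 2%N \in [pchar L].
Hypothesis perf : forall c : k, exists b, c = b ^+ 2.
Hypothesis ev_inj : forall p : {poly k}, ev p = 0 -> p = 0.
Variables (n e : nat) (cf : nat -> k) (Y : wv n L).
Local Notation d := e.*2.+1.
Local Notation Q := (2 ^ n)%N%:Z.
Local Notation Fr := (wmap (pFrobenius_aut ch) : wv n L -> wv n L).
Hypothesis n1 : (1 < n)%N.
Hypothesis cfd : cf d != 0.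
Let a (i : nat) : L := if odd i then ev (cf i *: 'X^i) else 0.
Hypothesis eqY : Fr Y - Y = \sum_(i < d.+1) vt n 0 (a i).

Let Q0 : 0 < Q. Proof. by have : (0 < 2 ^ n)%N by [rewrite expn_gt0]; lia. Qed.
Let E : int := (e : int) * 2 + 1.
Let D : int := E * Q.

Lemma asw_in_ring u c F R : tower ev Q u c F R -> forall i, R (wcomp (Fr Y - Y) i).
Proof.
move=> tw; have RR := tower_ring ch tw; rewrite eqY.
apply: wv_closed_sum; [exact: (rp1 RR) | exact: (rpB RR) | exact: (rpM RR) |].
move=> l i; rewrite vtE /a; case: ifP => _; last exact: (rp0 RR).
by case: ifP => _; [exact: (rp_ev RR) | exact: (rp0 RR)].
Qed.

Lemma a_exact i : odd i -> cf i != 0 -> exact (rat_fil ev Q) (Q * i%:Z) (a i).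
Proof.
move=> oi ci; rewrite /a oi.
have c0 : cf i *: 'X^i != 0 by rewrite scaler_eq0 negb_or ci -size_poly_eq0 size_polyXn.
have Ea : ev (cf i *: 'X^i) * ev 1 = ev (cf i *: 'X^i) by rewrite rmorph1 mulr1.
rewrite (rat_fil_exact ev_inj Q0 _ _ c0 Ea) ?oner_eq0 //.
rewrite size_scale // size_polyXn size_poly1; lia.
Qed.

Lemma a_fil i : rat_fil ev Q (Q * i%:Z) (a i).
Proof.
have FF := val_fil (rat_valued ev_inj Q0).
have [oi|noi] := boolP (odd i); last by rewrite /a (negbTE noi); apply: (fil0 FF).
have [c0|c0] := eqVneq (cf i) 0; last by have [] := a_exact oi c0.
by rewrite /a oi c0 scale0r rmorph0; apply: (fil0 FF).
Qed.

Lemma wstate0 : wstate ev Q ch Y D 0 Q 0 (rat_fil ev Q) (fun f => exists p, f = ev p).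
Proof.
have FF := val_fil (rat_valued ev_inj Q0).
exists Y, d.+1, (fun _ => 0%N), (fun i => a i); split.
- split; [exact: tower0 | by [] | | by []].
  move=> i; exists 0; rewrite subrr /wcomp ffunE; exact: (fil0 FF).
- by rewrite eqY.
- by [].
- move=> l; rewrite subr0 expn0 mulr1n; apply: (fil_le FF) (a_fil l).
  rewrite /D mulrC; apply: ler_pM => //; rewrite /E; have := ltn_ord l; lia.
move=> m _ mn; exists ord_max, (Q * d%:Z), e%:Z; split=> //=.
- by apply: a_exact; rewrite /= ?odd_double.
- by rewrite mulrC; congr (_ * _); lia.
- by rewrite subn0 subr0 /D /E; congr (_ *+ _); rewrite mulrC; congr (_ * _); lia.
move=> l; rewrite -val_eqE /= => ld _; exists (Q * (l : nat)%:Z); first exact: a_fil.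
rewrite subn0 subr0 /D ltr_pMn2r ?expn_gt0 // mulrC ltr_pM2r //.
by rewrite /E; have := ltn_ord l; lia.
Qed.

(** Orders on layer j are multiples of 2^(n-j). [cj] is the solution, starting at 0, of c_(j+1) =
    c_j + r with D 2^j = c_j + 2 r. *)
Let uj (j : nat) : int := (2 ^ (n - j))%N%:Z.
Let cj (j : nat) : int := E * uj j * t4 j.

Lemma wstate_step j : (j < n)%N -> forall F R, wstate ev Q ch Y D j (uj j) (cj j) F R ->
  exists (o : int) y, [/\ 2 * o + 1 = E * (2 * t4 j + 1), 0 <= o, R (y ^+ 2 + y),
    exact F (uj j.+1 * (2 * o + 1) + uj j.+1 * (2 * o + 1)) (y ^+ 2 + y)
    & wstate ev Q ch Y D j.+1 (uj j.+1) (cj j.+1) (step_fil (uj j.+1 * (2 * o + 1)) y F)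
        (fun f => exists a b, [/\ R a, R b & f = a + b * y])].
Proof.
(* Chosen so that 2o + 1 = d (2^(2j+1) + 1) / 3, the pole order on layer j + 1 of its generator. *)
move=> jn F R st; pose o := (e : int) * (2 * t4 j + 1) + t4 j.
have t0 := t4_ge0 j.
have oE : 2 * o + 1 = E * (2 * t4 j + 1) by rewrite /o /E; ring.
have o0 : 0 <= o by rewrite /o; have : 0 <= (e : int) * (2 * t4 j + 1) by [apply: mulr_ge0; lia]; lia.
have u2 : uj j = 2 * uj j.+1 by rewrite /uj -(subnSK jn) expnS PoszM.
have u0 : 0 < uj j.+1 by rewrite /uj; have : (0 < 2 ^ (n - j.+1))%N by [rewrite expn_gt0]; lia.
have cjE : cj j.+1 = cj j + uj j.+1 * (2 * o + 1) by rewrite /cj oE u2 /=; ring.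
have QE : Q = uj j * (2 ^ j)%N%:Z by rewrite /uj -PoszM -expnD subnK // ltnW.
(* D 2^j is E u_j 4^j, and 4^j = 3 t4 j + 1 splits into t4 j, giving c_j, and 2 t4 j + 1, giving
   2r. *)
have DE : D *+ 2 ^ j = cj j + uj j.+1 * (2 * o + 1) + uj j.+1 * (2 * o + 1).
  have T := t4E j; rewrite PoszM in T; rewrite -mulr_natr natz /D QE.
  transitivity (E * uj j * ((2 ^ j)%N%:Z * (2 ^ j)%N%:Z)); first by ring.
  by rewrite T /cj oE u2; ring.
have E1 : 1 <= E by rewrite /E; lia.
rewrite u2 in st.
have D0 : 0 < D by apply: mulr_gt0 => //; lia.
have c0 : 0 <= cj j by rewrite /cj; apply: mulr_ge0 => //; apply: mulr_ge0; lia.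
have hcr : cj j - Q < uj j.+1 * (2 * o + 1).
  rewrite /cj oE u2; have : 0 < uj j.+1 * E by apply: mulr_gt0; lia.
  lia.
(* D 2^m is an even multiple of u_(j+1), while c_(j+1) = E u_(j+1) t4 (j+1) is an odd one. *)
have hodd m : (j < m)%N -> (m < n)%N ->
    exists s : int, D *+ 2 ^ m - (cj j + uj j.+1 * (2 * o + 1)) = (2 * s + 1) * uj j.+1.
  move=> jm mn; rewrite -cjE; have [s s0 es] := t4_odd j.
  exists ((e : int) * ((2 ^ m)%N%:Z * (2 ^ j)%N%:Z * 2 - t4 j.+1) + (2 ^ m)%N%:Z * (2 ^ j)%N%:Z - s - 1).
  rewrite -mulr_natr natz /D QE u2 /cj; move: (2 ^ m)%N (2 ^ j)%N => A B.
  by rewrite es /E; ring.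
have [y [Ry ey sty]] := witt_step perf ev_inj Q0 D0 asw_in_ring jn o0 c0 DE hcr hodd st.
by exists o, y; split=> //; rewrite cjE.
Qed.

Lemma wstate_all j : (j <= n)%N -> exists F R, wstate ev Q ch Y D j (uj j) (cj j) F R.
Proof.
elim: j => [_|j IH jn].
  exists (rat_fil ev Q), (fun f => exists p, f = ev p).
  by rewrite /cj mulr0 /uj subn0; exact: wstate0.
have [F [R st]] := IH (ltnW jn).
by have [o [y [_ _ _ _ st']]] := wstate_step jn st; eexists; eexists; exact: st'.
Qed.

Hypothesis L_gen : forall S : L -> Prop, (forall p, S (ev p)) ->
  (forall a b, S a -> S b -> S (a - b)) -> (forall a b, S a -> S b -> S (a * b)) ->
  (forall a, S a -> S a^-1) -> (forall i, S (wcomp Y i)) -> forall f, S f.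

Lemma asw_a_number (Omega : lmodType L) (Df : L -> Omega) (V : Omega -> Omega) :
  is_kaehler (ev \o polyC : {rmorphism k -> L}) Df -> is_cartier Df 2 V ->
  exists N, is_a_number (ev \o polyC : {rmorphism k -> L}) Df V N /\
    N%:Z * 2 = d%:Z * t4 n.-1 + 1 + (e./2)%:Z * 2.
Proof.
move=> hD hV; have n0 : (n.-1 < n)%N by lia.
have [F [R st]] := wstate_all (leq_pred n).
have [o [y [oE o0 Ry ey sty]]] := wstate_step n0 st.
have u1 : uj n.-1.+1 = 1 by rewrite /uj prednK ?subnn // ltnW.
have u2 : uj n.-1 = 2 by rewrite /uj -subn1 subKn // ltnW.
rewrite u1 mul1r in ey sty; rewrite u2 in st.
have tw : tower ev Q (2 * 1) (cj n.-1) F R by have [U [N [pos [a' [[]]]]]] := st.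
set G := step_fil _ _ _ in sty; set RG := (fun f => _) in sty; set c' := cj _ in sty.
have [U [N0 [pos [a' [[twG lowU YU _] _ _ _ _]]]]] := sty.
have VG := tower_valued ch ev_inj Q0 twG; have GG := val_fil VG.
have U0 : U = 0.
  apply: wvP => i; rewrite lowU; first by rewrite /wcomp ffunE.
  by rewrite prednK // ltnW.
have G_full f : exists z, G z f.
  apply: (L_gen (S := fun f => exists z, G z f)).
  - by move=> p; apply: (tower_sub ch ev_inj Q0 twG); exact: (rp_ev (tower_ring ch twG)).
  - move=> f1 f2 [z1 F1] [z2 F2]; exists (`|z1| + `|z2|).
    by apply: (filB GG); [apply: (fil_le GG) F1 | apply: (fil_le GG) F2]; lia.
  - by move=> f1 f2 [z1 F1] [z2 F2]; exists (z1 + z2); apply: (filM GG).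
  - by move=> f1 [z1 F1]; exact: (valV VG F1).
  by move=> i; have := YU i; rewrite U0 subr0.
pose T := t4 n.-1; have T0 : 0 <= T := t4_ge0 _.
have [s s0 es] : exists2 s, 0 <= s & T = 2 * s + 1.
  by rewrite /T; case: (n) n1 => [|[|m]] //= _; exact: t4_odd.
pose M := (2 ^ n.-2)%N%:Z.
have QM : Q = 4 * M by rewrite /M; case: (n) n1 => [|[|m]] // _; rewrite !expnS /=; lia.
have c2 : cj n.-1 = 2 * (E * T) by rewrite /cj u2 /T; ring.
have c'E : c' = 2 * (E * T) + 2 * o + 1.
  rewrite /c' /cj u1 /= -/T (_ : 2 * o = E * (2 * T + 1) - 1); first by ring.
  by rewrite -oE; ring.
have oT : o = E * T + e by have := oE; rewrite -/T mulrDr mulr1 {2}/E; lia.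
(* This is g - 1 for the top layer: 2t = c' - Q - 1, with Q = 4M. *)
pose t := 2 * (E * T) + e%:Z - 2 * M.
have ET0 : 0 <= E * T by apply: mulr_ge0 => //; rewrite /E; lia.
have M0 : 0 <= M by rewrite /M.
have [N [kap [dimN NE kE]]] := tower_dim ch ev_inj Q0 tw (t := t) ltac:(rewrite /t; lia).
have V' := tower_valued ch ev_inj Q0 tw; have FF := val_fil V'.
exists N; split.
  apply: (a_number_dim ch perf ev_inj Q0 twG G_full hD hV (t := t)).
  - by rewrite /t c'E QM; lia.
  - by rewrite /t c'E QM; lia.
  have ey' : exact F (1 * (2 * o + 1) + 1 * (2 * o + 1)) (y ^+ 2 + y) by rewrite mul1r.
  have [bs [span free]] := dimN; exists bs; split=> // f; rewrite -span; split.
    move=> [[a1 [b1 [Ra Rb ef]]] Gf].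
    have [z1 F1] := tower_sub ch ev_inj Q0 tw Ra; have [z2 F2] := tower_sub ch ev_inj Q0 tw Rb.
    have [Fa Fb] : F t a1 /\ F (t - (2 * o + 1)) b1.
      have := @step_fil_inv _ _ _ _ _ _ _ ch V' o0 ey' t (`|z1| + `|z2|) a1 b1.
      rewrite mul1r; apply.
      - by apply: (fil_le FF) F1; lia.
      - by apply: (fil_le FF) F2; lia.
      - by rewrite -ef.
    (* t < 2o + 1, so b1 has negative order bound while lying in the affine ring; the sections all
       come from the layer below. *)
    have b0 : b1 = 0.
      by apply: (tower_neg ch ev_inj Q0 tw _ Rb Fb); rewrite /t; lia.
    by rewrite ef b0 mul0r addr0.
  move=> [Rf Ff]; split.
    by exists f, 0; rewrite mul0r addr0; split=> //; exact: (rp0 (tower_ring ch tw)).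
  by exists f, 0; rewrite mul0r addr0; split=> //; exact: (fil0 FF).
have -> : d%:Z = E by rewrite /E; lia.
rewrite -/T NE; rewrite c2 QM in kE.
(* Here n > 1 enters: M = 2^(n-2) is an integer, so only e is rounded. *)
have -> : (t %/ (2 * 1))%Z = E * T - M + (e./2)%:Z by rewrite /t; lia.
lia.
Qed.
End Main.

Lemma of_poly_inj (k : fieldType) (L : fieldExtType {fraction {poly k}}) (p : {poly k}) :
  of_poly L p = 0 -> p = 0.
Proof.
move=> /eqP; rewrite -[of_poly L p]/(in_alg L (tofrac p)) fmorph_eq0 tofrac_eq0.
by move/eqP.
Qed.

Lemma finField_perfect2 (k : finFieldType) (chark : 2%N \in [pchar k]) (c : k) :
  exists b, c = b ^+ 2.
Proof.
have [g fK gK] := injF_bij (fmorph_inj (pFrobenius_aut chark)).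
by exists (g c); rewrite -[RHS]/(pFrobenius_aut chark _) gK.
Qed.

Lemma a_number_formula (N T e : nat) (n : nat) : (0 < n)%N ->
  (T%:Z = t4 n.-1) -> N%:Z * 2 = (e.*2.+1)%:Z * t4 n.-1 + 1 + (e./2)%:Z * 2 ->
  (N%:R : rat) = (e.*2.+1)%:R / 24%:R * 2%:R ^+ (2 * n)
      + ((e.*2.+1)%:R + (-1) ^+ ((e.*2.+1 - 1) %/ 2) * 3%:R) / 12%:R /\
    (N%:R : rat) = (e.*2.+1)%:R / 4%:R * ((2%:R ^+ (2 * n - 1) + 1) / 3%:R)
      + (-1) ^+ ((e.*2.+1 - 1) %/ 2) / 4%:R.
Proof.
case: n => // n _ /= eT eN; rewrite -eT in eN.
have p4 : (2%:R : rat) ^+ (2 * n) = 3%:R * T%:R + 1.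
  have h : (2 ^ (2 * n) = 3 * T + 1)%N.
    by have := t4E n; rewrite -eT -expnD addnn -mul2n; move: (2 ^ _)%N => A; lia.
  by rewrite -natrX h natrD natrM.
have -> : (2 * n.+1 = (2 * n).+2)%N by lia.
have -> : ((2 * n).+2 - 1 = (2 * n).+1)%N by lia.
rewrite !exprS p4 subn1 /= -muln2 mulnK //.
have eN' : (N * 2 = (e * 2 + 1) * T + 1 + e./2 * 2)%N by rewrite muln2; lia.
have {}eN' : (N%:R : rat) * 2%:R = (e%:R * 2%:R + 1) * T%:R + 1 + (e./2)%:R * 2%:R.
  by rewrite -natrM eN' !natrD !natrM natrD natrM.
have ee : (e%:R : rat) = (odd e)%:R + (e./2)%:R * 2%:R.
  by rewrite -[e in LHS]odd_double_half natrD -muln2 natrM.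
have NE : (N%:R : rat) = ((e%:R * 2%:R + 1) * T%:R + 1 + (e./2)%:R * 2%:R) / 2%:R.
  by rewrite -eN' mulfK.
rewrite -signr_odd -[(e * 2).+1]addn1 !natrD !natrM NE ee.
(* As (d - 1)/2 = e, the sign and the rounding in [e./2] both depend only on the parity of e. *)
by case: (odd e); rewrite ?expr0 ?expr1 /=; split; field.
Qed.

Theorem theorem1p4 (k : finFieldType) (chark : 2%N \in [pchar k])
    (d : nat) (hd : odd d) (X : basic_tower 2 k d) (n : nat) (hn : (1 < n)%N)
    (Omega : lmodType (X n)) (D : X n -> Omega)
    (hD : is_kaehler (of_const (X n)) D)
    (V : Omega -> Omega) (hV : is_cartier D 2 V) :
  exists a : nat, is_a_number (of_const (X n)) D V a /\
    (a%:R : rat) = d%:R / 24%:R * 2%:R ^+ (2 * n)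
      + (d%:R + (-1) ^+ ((d - 1) %/ 2) * 3%:R) / 12%:R /\
    (a%:R : rat) = d%:R / 4%:R * ((2%:R ^+ (2 * n - 1) + 1) / 3%:R)
      + (-1) ^+ ((d - 1) %/ 2) / 4%:R.
Proof.
have [e ed] : exists e, d = e.*2.+1.
  by exists d./2; rewrite -[LHS]odd_double_half hd.
subst d; have ch : 2%N \in [pchar X n] := rmorph_pchar (of_const (X n)) chark.
pose Y : wv n (X n) := sol X n.
have eqY : wmap (pFrobenius_aut ch) Y - Y = \sum_(i < e.*2.+2)
    vt n 0 (if odd i then of_poly (X n) (tower_coef X i *: 'X^i) else 0).
  rewrite -witt_subE -(witt_frobeniusE ch).
  have := sol_eq X n; rewrite -/Y => ->.
  (* Teichmüller representatives are the [vt] at position 0; terms with even index, 0 included, are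
     then restored with value 0. *)
  transitivity (\sum_(1 <= i < e.*2.+2 | coprime i 2)
    vt n 0 (of_poly (X n) (tower_coef X i *: 'X^i))); first by [].
  transitivity (\sum_(0 <= i < e.*2.+2 | coprime i 2)
    vt n 0 (of_poly (X n) (tower_coef X i *: 'X^i))); first by rewrite [RHS]big_ltn_cond.
  rewrite big_mkord big_mkcond; apply: eq_bigr => i _.
  by rewrite coprimen2; case: (odd i); rewrite ?vt0.
(* The layer is generated over k(x) by the components of the solution, and fractions of polynomials
   are reached by closure under inverses. *)
have L_gen (S : X n -> Prop) : (forall p, S (of_poly (X n) p)) ->
    (forall a b, S a -> S b -> S (a - b)) -> (forall a b, S a -> S b -> S (a * b)) ->
    (forall a, S a -> S a^-1) -> (forall i, S (wcomp Y i)) -> forall f, S f.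
  move=> Sp SB SM SV SY f.
  have S0 : S 0 by rewrite -(rmorph0 (of_poly (X n))); exact: Sp.
  apply: (@adjoin_seq_ind _ (X n) S (codom (sol X n))).
  - move=> c; have [p [q [q0 e0]]] := fraction_rep c.
    have q1 : of_poly (X n) q != 0 by apply: contraNneq q0 => /of_poly_inj ->.
    have -> : in_alg (X n) c = of_poly (X n) p / of_poly (X n) q.
      by apply: (mulIf q1); rewrite mulfVK // -[of_poly _ p]/(in_alg (X n) (tofrac p)) -e0 rmorphM.
    by apply: SM => //; apply: SV.
  - by move=> a b Sa Sb; rewrite -[b](oppr2 ch); apply: SB.
  - exact: SM.
  - by move=> _ /codomP[i ->]; exact: SY.
  by rewrite sol_gen memvf.
have [N [aN eN]] := asw_a_number (@finField_perfect2 k chark) (@of_poly_inj k (X n)) hn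
  (tower_coef_neq0 X) eqY L_gen hD hV.
exists N; split=> //.
have [T eT] : exists T : nat, T%:Z = t4 n.-1.
  by exists (absz (t4 n.-1)); have := t4_ge0 n.-1; lia.
exact: (@a_number_formula N T e n (ltnW hn) eT eN).
Qed.
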